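(* Assume (A1)–(A5) below. Fix $i\le s$ with $\omega_i^2>1/g(\lambda_+^+)$, and let $\rho_i>\lambda_+$ be the unique real number with $\omega_i^2g(\rho_i)=1$. Let $(b_{1,n})$, $(b_{2,n})$ be deterministic sequences of vectors in $\mathbb C^N$ with bounded norms. Then \[ b_{1,n}^*\widehat\Pi_{i,n}b_{2,n}-\frac{\rho_im(\rho_i)^2\tilde m(\rho_i)}{(\rho m(\rho)\tilde m(\rho))'|_{\rho=\rho_i}}\,b_{1,n}^*\Pi_{i,n}b_{2,n}\xrightarrow[n\to\infty]{a.s.}0 . \]
   Context: $N=N(n)$. (A1) $N\le n$, $n\to\infty$, $N/n\to c\in(0,1]$. (A2) $X_n=L_n\Gamma_nR_n^*$ random $N\times n$, with $L_n,\Gamma_n,R_n$ independent, $L_n$ Haar on $\mathcal U(N)$, $\Gamma_n$ $N\times N$ diagonal nonnegative, $R_n$ an $n\times N$ submatrix (made of $N$ columns) of a Haar matrix on $\mathcal U(n)$. $Q_n(z)=(X_nX_n^*-zI_N)^{-1}$, $\alpha_n(z)=N^{-1}\operatorname{tr}Q_n(z)$. (A3) For all $z$ with $\Im z>0$, $\alpha_n(z)\to m(z)$ a.s., $m(z)=\int\frac{\pi(dt)}{t-z}$ the Stieltjes transform of a probability measure $\pi$ supported on a compact $[\lambda_-,\lambda_+]$; $m$ is defined off $[\lambda_-,\lambda_+]$ by the same integral and $\tilde m(z)=cm(z)-(1-c)/z$. (A4) $\|X_nX_n^*\|\to\lambda_+$ a.s. (A5) $P_n$ deterministic $N\times n$ of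 rank $r$ (fixed) for $n$ large, with SVD $P_n=U_n\Omega_nV_n^*$, $U_n=[u_{1,n},\dots,u_{r,n}]$ ($N\times r$ isometry), $\Omega_n=\operatorname{diag}(\omega_{1,n}\ge\dots\ge\omega_{r,n})\to O=\operatorname{diag}(\omega_1I_{j_1},\dots,\omega_sI_{j_s})$, $\omega_1>\dots>\omega_s>0$, $j_1+\dots+j_s=r$. Let $\Sigma_n=X_n+P_n$, with eigenvalues $\hat\lambda_{1,n}\ge\dots\ge\hat\lambda_{N,n}$ of $\Sigma_n\Sigma_n^*$ and associated orthonormal eigenvectors $\hat u_{k,n}$. For $k\le r$, $i(k)$ is the index $i$ with $j_1+\dots+j_{i-1}<k\le j_1+\dots+j_i$. $\widehat\Pi_{i,n}=\sum_{k:i(k)=i}\hat u_{k,n}\hat u_{k,n}^*$ and $\Pi_{i,n}=\sum_{k:i(k)=i}u_{k,n}u_{k,n}^*$. For $x>\lambda_+$, $g(x)=xm(x)\tilde m(x)$; it decreases to $0$ on $(\lambda_+,\infty)$, and $g(\lambda_+^+)=\lim_{x\downarrow\lambda_+}g(x)$. *)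

(* Defs.v *)
From HB Require Import structures.
From mathcomp Require Import all_boot all_order all_algebra.
From mathcomp Require Import all_classical all_reals all_analysis.
From mathcomp Require Import complex.
Import Order.TTheory GRing.Theory Num.Theory.
Import numFieldNormedType.Exports.

Set Implicit Arguments.
Unset Strict Implicit.
Unset Printing Implicit Defensive.

Local Open Scope ring_scope.
Local Open Scope classical_set_scope.

Section Defs.
Variable R : realType.

Definition cR (x : R) : R[i] := (x%:C)%C.

Definition mxH (p q : nat) (A : 'M[R[i]]_(p, q)) : 'M[R[i]]_(q, p) :=
  (map_mx (@conjc R) A)^T.

Definition unitary_mx (p : nat) (U : 'M[R[i]]_p) : Prop :=
  U *m mxH U = 1%:M.

Definition vnorm (p : nat) (v : 'cV[R[i]]_p) : R :=
  Num.sqrt (\sum_(k < p) (complex.Re (v k 0) ^+ 2 + complex.Im (v k 0) ^+ 2)).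

Definition opnorm (p q : nat) (A : 'M[R[i]]_(p, q)) : R :=
  sup [set vnorm (A *m v) | v in [set v : 'cV[R[i]]_q | vnorm v = 1]].

Definition ccvg (u : nat -> R[i]) (l : R[i]) : Prop :=
  ((fun n => complex.Re (u n) : R) @ \oo --> (complex.Re l : R)) /\
  ((fun n => complex.Im (u n) : R) @ \oo --> (complex.Im l : R)).

Definition mx_gen (p q : nat) : set (set 'M[R[i]]_(p, q)) :=
  [set A | exists (i : 'I_p) (j : 'I_q) (B : set R), measurable B /\
     (A = (fun M : 'M[R[i]]_(p, q) => complex.Re (M i j)) @^-1` B \/
      A = (fun M : 'M[R[i]]_(p, q) => complex.Im (M i j)) @^-1` B)].

Definition mx_meas (p q : nat) : set (set 'M[R[i]]_(p, q)) := <<s @mx_gen p q >>.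

Section Prob.
Context {d : measure_display} {T : measurableType d} (P : probability T R).

Definition rmx_measurable (p q : nat) (X : T -> 'M[R[i]]_(p, q)) : Prop :=
  forall S, mx_meas S -> measurable (X @^-1` S).

Definition indep3 (p1 q1 p2 q2 p3 q3 : nat)
  (X1 : T -> 'M[R[i]]_(p1, q1)) (X2 : T -> 'M[R[i]]_(p2, q2))
  (X3 : T -> 'M[R[i]]_(p3, q3)) : Prop :=
  forall S1 S2 S3, mx_meas S1 -> mx_meas S2 -> mx_meas S3 ->
    P (X1 @^-1` S1 `&` X2 @^-1` S2 `&` X3 @^-1` S3) =
    (P (X1 @^-1` S1) * P (X2 @^-1` S2) * P (X3 @^-1` S3))%E.

(** W is Haar distributed on the unitary group U(p): W is a.s. unitary
    and its law is the (unique) left-invariant probability, i.e. for every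
    fixed unitary U, U W has the same law as W. *)
Definition haar_unitary (p : nat) (W : T -> 'M[R[i]]_p) : Prop :=
  rmx_measurable W /\
  {ae P, forall x, unitary_mx (W x)} /\
  forall U : 'M[R[i]]_p, unitary_mx U ->
    forall S, mx_meas S ->
      P (W @^-1` S) = P ((fun x => U *m W x) @^-1` S).

End Prob.

Definition stieltjes (pi : probability R R) (z : R[i]) : R[i] :=
  (Rintegral pi setT (fun t => complex.Re ((cR t - z)^-1)) +i*
   Rintegral pi setT (fun t => complex.Im ((cR t - z)^-1)))%C.

(** its restriction to real arguments outside the support *)
Definition stieltjesR (pi : probability R R) (x : R) : R :=
  Rintegral pi setT (fun t => (t - x)^-1).

Definition mtilde (pi : probability R R) (c x : R) : R :=
  c * stieltjesR pi x - (1 - c) / x.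

Definition gfun (pi : probability R R) (c x : R) : R :=
  x * stieltjesR pi x * mtilde pi c x.

Definition inblock (s : nat) (j : 'I_s -> nat) (i : 'I_s) (k : nat) : bool :=
  ((\sum_(l < s | (l < i)%N) j l <= k) && (k < \sum_(l < s | (l <= i)%N) j l))%N.

Definition colv (p q : nat) (A : 'M[R[i]]_(p, q)) (k : 'I_q) : 'cV[R[i]]_p :=
  col k A.

Definition blockproj (p q s : nat) (j : 'I_s -> nat) (i : 'I_s)
  (A : 'M[R[i]]_(p, q)) : 'M[R[i]]_p :=
  \sum_(k < q | inblock j i k) (col k A *m mxH (col k A)).

End Defs.

Definition Xmat (R : realType) (p q : nat) (L G : 'M[R[i]]_p) (Rm : 'M[R[i]]_(q, p))
  : 'M[R[i]]_(p, q) := L *m G *m mxH Rm.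

(* Main.v *)
(** Bi-unitary invariance lets one replace a deterministic vector [u] by a vector of
    equal norm with independent random signs, so a fourth moment bound for Rademacher
    chaoses and Borel-Cantelli give, for every real [x > lp] and [Q = (X X^* - x)^-1],
    [<a, Q b> ~ m <a, b>], [<a, Q X v> ~ 0] and
    [<u, (X^* Q X - 1) v> ~ w <u, v>], with [m = m(x)] and [w = x mtilde(x)].

    With [Sigma = X + U Om V^*], the linearized matrix [[-x, Sigma], [Sigma^*, -1]] is the
    perturbation [A + B J B^*] of [A = [[-x, X], [X^*, -1]]], where [B = diag(U, V)] and
    [J = [[0, Om], [Om, 0]]], and [B^* A^-1 B] converges to [diag(m, w)].  Two
    explicit families of test vectors then show that, for large [n], exactly as many
    eigenvalues of [Sigma Sigma^*] exceed [x] as there are [k] with [om_k^2 g(x) > 1];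
    since [g] is strictly decreasing at [rho] (because [x m(x) <= -1]), the block [i] of
    eigenvalues is squeezed to [rho] and stays isolated.

    Solving [(Sigma Sigma^* - x) a = b2] up to [o(1)] gives
    [<b1, a> ~ m (<b1, b2> - sum_k om_k^2 g / (om_k^2 g - 1) <b1, u_k> <u_k, b2>)].
    At [x = rho + eta], the spectral decomposition shows that [- eta <b1, a>] is
    [<b1, Pihat b2>] up to [O(eta) + o(1)]; let [n] tend to infinity, then [eta] to [0]. *)

Require Import Defs.
From HB Require Import structures.
From mathcomp Require Import all_boot all_order all_algebra.
From mathcomp Require Import all_classical all_reals all_analysis.
From mathcomp Require Import complex.
From mathcomp Require Import measurable_realfun.
From mathcomp Require Import ring lra.
Import Order.TTheory GRing.Theory Num.Theory.
Import numFieldNormedType.Exports.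
Set Implicit Arguments.
Unset Strict Implicit.
Unset Printing Implicit Defensive.
Local Open Scope ring_scope.
Local Open Scope classical_set_scope.

(** * Hermitian algebra of column vectors *)

(** Each instance of (A3) and each concentration statement holds outside its own null set, and (A3)
    speaks only of the open upper half-plane. The isotropic limits are therefore taken at countably
    many real points, [rho + ka / n.+1] and [rho - ka / n.+1]; once they hold, the rest is
    deterministic, at a fixed outcome.

    Why signs help: a vector whose entries all have the same modulus sees the diagonal of a matrix
    only through its trace, so the centred form is a pure off-diagonal chaos. Its fourth moment is
    of order [n^-2], which is summable, whereas a second moment would only be of order [n^-1].

    The moment bounds ask for bounded functions of the singular values, but these are bounded only
    almost surely and for large [n]. Hence every such function is truncated at a level between [lp]
    and the spectral point, and agrees eventually with the untruncated one.

    The matrix [Sigma Sigma^* - x] is never inverted: an explicit vector solves the equation up to a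
    small residual, and the isolation of the block of eigenvalues keeps that residual harmless. *)

Section Hermitian.
Variable R : realType.
Implicit Types (m n p q : nat).

Local Notation C := R[i].
Local Notation Re := (@complex.Re R).
Local Notation Im := (@complex.Im R).

Lemma ReD (a b : C) : Re (a + b) = Re a + Re b. Proof. by case: a; case: b. Qed.
Lemma ImD (a b : C) : Im (a + b) = Im a + Im b. Proof. by case: a; case: b. Qed.
Lemma ReN (a : C) : Re (- a) = - Re a. Proof. by case: a. Qed.
Lemma ImN (a : C) : Im (- a) = - Im a. Proof. by case: a. Qed.
Lemma ReM (a b : C) : Re (a * b) = Re a * Re b - Im a * Im b.
Proof. by case: a; case: b. Qed.
Lemma ImM (a b : C) : Im (a * b) = Re a * Im b + Im a * Re b.
Proof. by case: a => a1 a2; case: b => b1 b2. Qed.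
Lemma ReJ (a : C) : Re (conjc a) = Re a. Proof. by case: a. Qed.
Lemma ImJ (a : C) : Im (conjc a) = - Im a. Proof. by case: a. Qed.
Lemma Re_sum (I : Type) (s : seq I) (Q : pred I) (F : I -> C) :
  Re (\sum_(i <- s | Q i) F i) = \sum_(i <- s | Q i) Re (F i).
Proof. exact: (big_morph _ ReD). Qed.
Lemma Im_sum (I : Type) (s : seq I) (Q : pred I) (F : I -> C) :
  Im (\sum_(i <- s | Q i) F i) = \sum_(i <- s | Q i) Im (F i).
Proof. exact: (big_morph _ ImD). Qed.
Lemma conjc_sum (I : Type) (s : seq I) (Q : pred I) (F : I -> C) :
  conjc (\sum_(i <- s | Q i) F i) = \sum_(i <- s | Q i) conjc (F i).
Proof. exact: rmorph_sum. Qed.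

Lemma conjcM (a b : C) : conjc (a * b) = conjc a * conjc b.
Proof. exact: rmorphM. Qed.
Lemma conjcB (a b : C) : conjc (a - b) = conjc a - conjc b.
Proof. exact: rmorphB. Qed.
Lemma cRE (x : R) : cR x = (x +i* 0)%C. Proof. by []. Qed.
Lemma cRD (x y : R) : cR (x + y) = cR x + cR y. Proof. exact: rmorphD. Qed.
Lemma cRN (x : R) : cR (- x) = - cR x. Proof. exact: rmorphN. Qed.
Lemma cRM (x y : R) : cR (x * y) = cR x * cR y. Proof. exact: rmorphM. Qed.
Lemma cRV (x : R) : cR x^-1 = (cR x)^-1. Proof. exact: fmorphV. Qed.
Lemma cR_sum (I : Type) (s : seq I) (Q : pred I) (F : I -> R) :
  cR (\sum_(i <- s | Q i) F i) = \sum_(i <- s | Q i) cR (F i).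
Proof. exact: rmorph_sum. Qed.
Lemma conjc_cR (x : R) : conjc (cR x) = cR x. Proof. exact: conjc_real. Qed.

Lemma eqCP (a b : C) : Re a = Re b -> Im a = Im b -> a = b.
Proof. by case: a => a1 a2; case: b => b1 b2 /= -> ->. Qed.

Definition cabs (z : C) : R := Num.sqrt (Re z ^+ 2 + Im z ^+ 2).

Lemma cabsE z : cabs z = ComplexField.Normc.normc z.
Proof. by case: z. Qed.
Lemma cabs_ge0 z : 0 <= cabs z. Proof. exact: sqrtr_ge0. Qed.
Lemma cabsM z w : cabs (z * w) = cabs z * cabs w.
Proof. by rewrite !cabsE ComplexField.Normc.normcM. Qed.
Lemma cabsD z w : cabs (z + w) <= cabs z + cabs w.
Proof. by rewrite !cabsE le_normcD. Qed.
Lemma cabsN z : cabs (- z) = cabs z.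
Proof. by rewrite /cabs ReN ImN !sqrrN. Qed.
Lemma cabsB z w : cabs (z - w) <= cabs z + cabs w.
Proof. by rewrite -(cabsN w) cabsD. Qed.
Lemma cabs0 : cabs 0 = 0. Proof. by rewrite /cabs /= expr0n addr0 sqrtr0. Qed.
Lemma cabs_cR x : cabs (cR x) = `|x|.
Proof. by rewrite /cabs /= expr0n addr0 sqrtr_sqr. Qed.
Lemma cabsJ z : cabs (conjc z) = cabs z.
Proof. by rewrite /cabs ReJ ImJ sqrrN. Qed.
Lemma sqr_cabs z : cabs z ^+ 2 = Re z ^+ 2 + Im z ^+ 2.
Proof. by rewrite sqr_sqrtr // addr_ge0 // sqr_ge0. Qed.
Lemma cabs_Re z : `|Re z| <= cabs z.
Proof. by rewrite -sqrtr_sqr ler_wsqrtr // lerDl sqr_ge0. Qed.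
Lemma cabs_Im z : `|Im z| <= cabs z.
Proof. by rewrite -sqrtr_sqr ler_wsqrtr // lerDr sqr_ge0. Qed.
Lemma cabs_le z : cabs z <= `|Re z| + `|Im z|.
Proof.
rewrite -(@ler_pXn2r _ 2) ?nnegrE ?cabs_ge0 ?addr_ge0 // sqr_cabs.
rewrite -[Re z ^+ 2]real_normK ?num_real // -[Im z ^+ 2]real_normK ?num_real //.
have := mulr_ge0 (normr_ge0 (Re z)) (normr_ge0 (Im z)); lra.
Qed.
Lemma cabs_sum (I : Type) (s : seq I) (Q : pred I) (F : I -> C) :
  cabs (\sum_(i <- s | Q i) F i) <= \sum_(i <- s | Q i) cabs (F i).
Proof.
elim/big_rec2 : _ => [|i x y _ IH]; first by rewrite cabs0.
by apply: le_trans (cabsD _ _) _; rewrite lerD2l.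
Qed.
Lemma cabs_eq0 z : cabs z = 0 -> z = 0.
Proof. by rewrite cabsE; exact: ComplexField.Normc.eq0_normc. Qed.

Lemma mulcJ z : conjc z * z = cR (cabs z ^+ 2).
Proof.
by case: z => a b; rewrite sqr_cabs; apply: eqCP;
  rewrite ?ReM ?ImM /=; ring.
Qed.

Lemma mxHE p q (A : 'M[C]_(p, q)) i j : mxH A i j = conjc (A j i).
Proof. by rewrite !mxE. Qed.
Lemma mxHK p q (A : 'M[C]_(p, q)) : mxH (mxH A) = A.
Proof. by apply/matrixP => i j; rewrite !mxE conjcK. Qed.
Lemma mxHM p q m (A : 'M[C]_(p, q)) (B : 'M[C]_(q, m)) :
  mxH (A *m B) = mxH B *m mxH A.
Proof. by rewrite /mxH map_mxM trmx_mul. Qed.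
Lemma mxHD p q (A B : 'M[C]_(p, q)) : mxH (A + B) = mxH A + mxH B.
Proof. by rewrite /mxH map_mxD linearD. Qed.
Lemma mxHN p q (A : 'M[C]_(p, q)) : mxH (- A) = - mxH A.
Proof. by rewrite /mxH map_mxN linearN. Qed.
Lemma mxHB p q (A B : 'M[C]_(p, q)) : mxH (A - B) = mxH A - mxH B.
Proof. by rewrite mxHD mxHN. Qed.
Lemma mxHZ p q a (A : 'M[C]_(p, q)) : mxH (a *: A) = conjc a *: mxH A.
Proof. by rewrite /mxH map_mxZ linearZ. Qed.
Lemma mxH0 p q : mxH (0 : 'M[C]_(p, q)) = 0.
Proof. by rewrite /mxH map_mx0 trmx0. Qed.
Lemma mxH_scalar p (a : C) : mxH (a%:M : 'M[C]_p) = (conjc a)%:M.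
Proof. by rewrite /mxH map_scalar_mx tr_scalar_mx. Qed.
Lemma mxH1 p : mxH (1%:M : 'M[C]_p) = 1%:M.
Proof. by rewrite mxH_scalar rmorph1. Qed.
Lemma mxH_diag p (d : 'rV[C]_p) : mxH (diag_mx d) = diag_mx (map_mx conjc d).
Proof. by rewrite /mxH map_diag_mx tr_diag_mx. Qed.
Lemma mxH_diagR p (d : 'I_p -> R) :
  mxH (diag_mx (\row_k cR (d k))) = diag_mx (\row_k cR (d k)).
Proof.
by rewrite mxH_diag; congr diag_mx; apply/rowP => k; rewrite !mxE conjc_cR.
Qed.
Lemma mxH_block p q m n (A : 'M[C]_(p, q)) (B : 'M[C]_(p, n)) (D : 'M[C]_(m, q)) (E : 'M[C]_(m, n)) :
  mxH (block_mx A B D E) = block_mx (mxH A) (mxH D) (mxH B) (mxH E).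
Proof. by rewrite /mxH map_block_mx tr_block_mx. Qed.
Lemma mxH_col p q m (A : 'M[C]_(p, q)) (B : 'M[C]_(m, q)) :
  mxH (col_mx A B) = row_mx (mxH A) (mxH B).
Proof. by rewrite /mxH map_col_mx tr_col_mx. Qed.

Definition dot p (a b : 'cV[C]_p) : C := (mxH a *m b) 0 0.
Definition n2 p (a : 'cV[C]_p) : R := Re (dot a a).

Lemma dotE p (a b : 'cV[C]_p) : dot a b = \sum_k conjc (a k 0) * b k 0.
Proof. by rewrite /dot mxE; apply: eq_bigr => k _; rewrite mxHE. Qed.
Lemma dotDr p (a b c : 'cV[C]_p) : dot a (b + c) = dot a b + dot a c.
Proof. by rewrite /dot mulmxDr mxE. Qed.
Lemma dotDl p (a b c : 'cV[C]_p) : dot (a + b) c = dot a c + dot b c.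
Proof. by rewrite /dot mxHD mulmxDl mxE. Qed.
Lemma dotNr p (a b : 'cV[C]_p) : dot a (- b) = - dot a b.
Proof. by rewrite /dot mulmxN mxE. Qed.
Lemma dotNl p (a b : 'cV[C]_p) : dot (- a) b = - dot a b.
Proof. by rewrite /dot mxHN mulNmx mxE. Qed.
Lemma dotBr p (a b c : 'cV[C]_p) : dot a (b - c) = dot a b - dot a c.
Proof. by rewrite dotDr dotNr. Qed.
Lemma dotBl p (a b c : 'cV[C]_p) : dot (a - b) c = dot a c - dot b c.
Proof. by rewrite dotDl dotNl. Qed.
Lemma dotZr p x (a b : 'cV[C]_p) : dot a (x *: b) = x * dot a b.
Proof. by rewrite /dot -scalemxAr mxE. Qed.
Lemma dotZl p x (a b : 'cV[C]_p) : dot (x *: a) b = conjc x * dot a b.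
Proof. by rewrite /dot mxHZ -scalemxAl mxE. Qed.
Lemma dot0r p (a : 'cV[C]_p) : dot a 0 = 0.
Proof. by rewrite /dot mulmx0 mxE. Qed.
Lemma dotC p (a b : 'cV[C]_p) : dot a b = conjc (dot b a).
Proof.
rewrite !dotE conjc_sum; apply: eq_bigr => k _.
by rewrite conjcM conjcK mulrC.
Qed.
Lemma dotMr p q (M : 'M[C]_(p, q)) (a : 'cV[C]_p) (b : 'cV[C]_q) :
  dot a (M *m b) = dot (mxH M *m a) b.
Proof. by rewrite /dot mxHM mxHK mulmxA. Qed.
Lemma dotMl p q (M : 'M[C]_(p, q)) (a : 'cV[C]_q) (b : 'cV[C]_p) :
  dot (M *m a) b = dot a (mxH M *m b).
Proof. by rewrite dotMr mxHK. Qed.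

Lemma n2E p (a : 'cV[C]_p) : n2 a = \sum_k cabs (a k 0) ^+ 2.
Proof.
by rewrite /n2 dotE Re_sum; apply: eq_bigr => k _; rewrite mulcJ.
Qed.
Lemma dotvv p (a : 'cV[C]_p) : dot a a = cR (n2 a).
Proof.
rewrite n2E dotE cR_sum.
by apply: eq_bigr => k _; rewrite mulcJ.
Qed.
Lemma n2_ge0 p (a : 'cV[C]_p) : 0 <= n2 a.
Proof. by rewrite n2E sumr_ge0 // => k _; rewrite sqr_ge0. Qed.
Lemma n20 p : n2 (0 : 'cV[C]_p) = 0. Proof. by rewrite /n2 dot0r. Qed.
Lemma n2_eq0 p (a : 'cV[C]_p) : n2 a = 0 -> a = 0.
Proof.
rewrite n2E => /eqP; rewrite psumr_eq0 => [/allP h|k _]; last exact: sqr_ge0.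
apply/colP => k; rewrite mxE; apply: cabs_eq0.
have := h k (mem_index_enum k).
by rewrite /= sqrf_eq0 => /eqP.
Qed.
Lemma n2_gt0 p (a : 'cV[C]_p) : a != 0 -> 0 < n2 a.
Proof.
move=> a0; rewrite lt_def n2_ge0 andbT; apply: contra a0 => /eqP h.
by apply/eqP; exact: n2_eq0.
Qed.
Lemma vnormE p (a : 'cV[C]_p) : vnorm a = Num.sqrt (n2 a).
Proof.
by rewrite /vnorm n2E; congr Num.sqrt; apply: eq_bigr => k _; rewrite sqr_cabs.
Qed.
Lemma sqr_vnorm p (a : 'cV[C]_p) : vnorm a ^+ 2 = n2 a.
Proof. by rewrite vnormE sqr_sqrtr ?n2_ge0. Qed.
Lemma vnorm_ge0 p (a : 'cV[C]_p) : 0 <= vnorm a.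
Proof. by rewrite vnormE sqrtr_ge0. Qed.
Lemma n2N p (a : 'cV[C]_p) : n2 (- a) = n2 a.
Proof. by rewrite /n2 dotNl dotNr opprK. Qed.
Lemma n2Z p x (a : 'cV[C]_p) : n2 (x *: a) = cabs x ^+ 2 * n2 a.
Proof.
rewrite !n2E mulr_sumr; apply: eq_bigr => k _.
by rewrite mxE cabsM exprMn.
Qed.

(* [|<b,b> a - <b,a> b|^2 >= 0] *)
Lemma cauchy_schwarz p (a b : 'cV[C]_p) : cabs (dot a b) <= vnorm a * vnorm b.
Proof.
rewrite -(@ler_pXn2r _ 2) ?nnegrE ?cabs_ge0 ?mulr_ge0 ?vnorm_ge0 //.
rewrite exprMn !sqr_vnorm.
have [->|b0] := eqVneq b 0; first by rewrite dot0r cabs0 n20 expr0n mulr0.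
have := n2_ge0 (dot b b *: a - dot b a *: b).
rewrite {1}/n2 dotBl !dotBr !dotZl !dotZr.
rewrite [dot a b]dotC !dotvv conjc_cR.
set z := dot b a.
have -> : cR (n2 b) * (cR (n2 b) * cR (n2 a)) - cR (n2 b) * (z * conjc z) -
   (conjc z * (cR (n2 b) * z) - conjc z * (z * cR (n2 b)))
   = cR (n2 b * (n2 b * n2 a - cabs z ^+ 2)).
  rewrite !cRM !(cRD, cRN) -mulcJ !cRM; ring.
rewrite /= pmulr_rge0 ?n2_gt0 // subr_ge0 cabsJ.
by rewrite mulrC.
Qed.

Lemma cabs_dot_amgm p (a b : 'cV[C]_p) : cabs (dot a b) <= (n2 a + n2 b) / 2.
Proof.
apply: le_trans (cauchy_schwarz _ _) _; rewrite -!sqr_vnorm.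
have := sqr_ge0 (vnorm a - vnorm b); lra.
Qed.

Lemma n2D_le p (a b : 'cV[C]_p) : n2 (a + b) <= 2 * (n2 a + n2 b).
Proof.
rewrite !n2E mulrDr !mulr_sumr -big_split /=; apply: ler_sum => k _.
rewrite mxE; have := cabsD (a k 0) (b k 0).
have := cabs_ge0 (a k 0 + b k 0).
have := sqr_ge0 (cabs (a k 0) - cabs (b k 0)); nra.
Qed.

Lemma unitary_mxC p (U : 'M[C]_p) : unitary_mx U -> mxH U *m U = 1%:M.
Proof. exact: mulmx1C. Qed.
Lemma dot_isom p q (U : 'M[C]_(p, q)) a b :
  mxH U *m U = 1%:M -> dot (U *m a) (U *m b) = dot a b.
Proof. by move=> h; rewrite dotMl mulmxA h mul1mx. Qed.
Lemma n2_isom p q (U : 'M[C]_(p, q)) a : mxH U *m U = 1%:M -> n2 (U *m a) = n2 a.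
Proof. by move=> h; rewrite /n2 dot_isom. Qed.

(* The reflection-like map [1 - (|u|^2 - <w,u>)^-1 (u-w)(u-w)^*]; when
   [u = w] the inverse is [0^-1 = 0] and the map is the identity. *)
Lemma unitary_transitive p (u w : 'cV[C]_p) : n2 u = n2 w ->
  exists2 U : 'M[C]_p, unitary_mx U & U *m u = w.
Proof.
move=> uw; have [v vE] : exists v, v = u - w by exists (u - w).
pose be := cR (n2 u) - dot w u.
have vu : dot v u = be by rewrite vE dotBl dotvv.
have vv : dot v v = be + conjc be.
  rewrite vE dotBl !dotBr !dotvv -uw /be conjcB -dotC.
  have -> : conjc (cR (n2 u)) = cR (n2 u) by exact: conjc_cR.
  ring.
have [be0|be0] := eqVneq be 0.
  exists 1%:M; first by rewrite /unitary_mx mxH1 mul1mx.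
  rewrite mul1mx; apply/eqP; rewrite -subr_eq0; apply/eqP.
  by apply: n2_eq0; rewrite /n2 -vE vv be0 rmorph0 addr0.
have cbe0 : conjc be != 0 by rewrite conjc_eq0.
have dvv x : v *m mxH v *m (x *: (v *m mxH v)) = (x * dot v v) *: (v *m mxH v).
  rewrite -scalemxAr -!mulmxA [mxH v *m (_ *m _)]mulmxA.
  rewrite [mxH v *m v]mx11_scalar -/(dot v v) mul_scalar_mx.
  by rewrite -scalemxAr scalerA.
exists (1%:M - be^-1 *: (v *m mxH v)); last first.
  rewrite mulmxBl mul1mx -scalemxAl -mulmxA [mxH v *m u]mx11_scalar.
  rewrite -/(dot v u) vu mul_mx_scalar scalerA mulVf // scale1r.
  by rewrite vE opprB addrC subrK.
rewrite /unitary_mx mxHB mxH1 mxHZ mxHM mxHK mulmxBl mul1mx mulmxBr mulmx1.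
rewrite -scalemxAl dvv scalerA -[RHS]addr0 -addrA; congr (_ + _).
rewrite -scaleNr -!scalerBl vv conjc_inv.
suff -> : - (conjc be)^-1 - (be^-1 - be^-1 * ((conjc be)^-1 * (be + conjc be))) = 0.
  by rewrite scale0r.
by field; rewrite be0 cbe0.
Qed.

End Hermitian.

(** * Moments of Rademacher chaoses *)

Section RademacherChaos.
Variable R : realType.

(** The expectation over [n] independent uniform signs, by recursion on the first one. Conditioning
    on a sign is then a reduction step, with no probability space for the signs. *)
Fixpoint avg (n : nat) (F : seq R -> R) : R :=
  if n is m.+1 then (avg m (fun s => F (1 :: s)) + avg m (fun s => F (-1 :: s))) / 2
  else F [::].

Definition signs (n : nat) (s : seq R) := forall k, (k < n)%N -> nth 0 s k ^+ 2 = 1.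

Lemma signs_cons n e s : e ^+ 2 = 1 -> signs n s -> signs n.+1 (e :: s).
Proof. by move=> e1 h [|k] //=; apply: h. Qed.

Lemma le_avg n F G : (forall s, signs n s -> F s <= G s) -> avg n F <= avg n G.
Proof.
elim: n F G => [|n IH] F G h /=; first exact: h.
rewrite ler_pM2r ?invr_gt0 //; apply: lerD; apply: IH => s hs; apply: h;
  by apply: signs_cons; rewrite ?sqrrN ?expr1n.
Qed.

Lemma eq_avg n F G : (forall s, signs n s -> F s = G s) -> avg n F = avg n G.
Proof.
by move=> h; apply/eqP; rewrite eq_le !le_avg // => s hs; rewrite h.
Qed.

Lemma avgD n F G : avg n (fun s => F s + G s) = avg n F + avg n G.
Proof. by elim: n F G => [|n IH] F G //=; rewrite !IH; lra. Qed.

Lemma avgZ n c F : avg n (fun s => c * F s) = c * avg n F.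
Proof. by elim: n F => [|n IH] F //=; rewrite !IH; lra. Qed.

Lemma avg_cst n c : avg n (fun=> c) = c.
Proof. by elim: n => [|n IH] //=; rewrite !IH; lra. Qed.

Lemma avg_ge0 n F : (forall s, 0 <= F s) -> 0 <= avg n F.
Proof. by move=> h; rewrite -(avg_cst n 0); apply: le_avg. Qed.

Lemma avg_cs n F G :
  avg n (fun s => F s * G s) ^+ 2 <= avg n (fun s => F s ^+ 2) * avg n (fun s => G s ^+ 2).
Proof.
have pos (t u : R) : 0 <= t ^+ 2 * avg n (fun s => F s ^+ 2) +
    2 * (t * u) * avg n (fun s => F s * G s) + u ^+ 2 * avg n (fun s => G s ^+ 2).
  rewrite -!avgZ -!avgD; apply: avg_ge0 => s.
  have := sqr_ge0 (t * F s + u * G s); lra.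
set A := avg n (fun s => F s ^+ 2) in pos *.
set B := avg n (fun s => F s * G s) in pos *.
set D := avg n (fun s => G s ^+ 2) in pos *.
have D0 : 0 <= D by apply: avg_ge0 => s; exact: sqr_ge0.
have A0 : 0 <= A by apply: avg_ge0 => s; exact: sqr_ge0.
have [d0|dp] := eqVneq D 0.
  (* When [D = 0], the form at [(- B, 1 + 2 A)] equals [- B^2 (2 + 3 A)], which forces [B = 0]. *)
  have := pos (- B) (1 + A * 2 : R); rewrite d0; have := pos B 1; rewrite d0 => h1.
  have h3 := sqr_ge0 B; nra.
have {dp D0} dp : 0 < D by rewrite lt_def dp.
have := pos D (- B) => h.
have : 0 <= D * (D * A - B ^+ 2) by nra.
by rewrite pmulr_rge0 // => ?; lra.
Qed.

(** Multilinear polynomials of degree at most [d] in the first [n] signs, with the first sign split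
    off. For [n = 0] nothing is asked, because [avg 0] evaluates only at [[::]]. *)
Fixpoint chaos (d n : nat) (f : seq R -> R) : Prop :=
  match n, d with
  | 0, _ => True
  | _.+1, 0 => exists c, forall s, f s = c
  | m.+1, d'.+1 => exists g h, [/\ chaos d m g, chaos d' m h &
                     forall e s, f (e :: s) = g s + e * h s]
  end.

(** The cross term [2 e g h] cancels between [e = 1] and [e = -1]. *)
Lemma avg_recE n f g h : (forall e s, f (e :: s) = g s + e * h s) ->
  avg n.+1 (fun s => f s ^+ 2) =
    avg n (fun s => g s ^+ 2) + avg n (fun s => h s ^+ 2).
Proof.
move=> fE /=; rewrite -!avgD mulrC -avgZ.
by apply: eq_avg => s _; rewrite !fE; lra.
Qed.

(* Bonami's hypercontractive inequality, by conditioning on all signs but one. *)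
Lemma chaos_moment4 d n f : chaos d n f ->
  avg n (fun s => f s ^+ 4) <= 9 ^+ d * avg n (fun s => f s ^+ 2) ^+ 2.
Proof.
elim: n d f => [|n IH] d f.
  move=> _ /=; rewrite -exprM; apply: ler_peMl; first exact: exprn_even_ge0.
  by rewrite exprn_ege1 // ler1n.
case: d => [[c hc]|d [g [h [cg ch fE]]]].
  rewrite (@eq_avg n.+1 (fun s => f s ^+ 4) (fun=> c ^+ 4)) ?avg_cst; last first.
    by move=> s _; rewrite hc.
  rewrite (@eq_avg n.+1 (fun s => f s ^+ 2) (fun=> c ^+ 2)) ?avg_cst; last first.
    by move=> s _; rewrite hc.
  by rewrite expr0 mul1r -exprM.
rewrite (avg_recE _ fE) /=.
have {IH} [hg hh] := (IH _ _ cg, IH _ _ ch).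
have cs := avg_cs n (fun s => g s ^+ 2) (fun s => h s ^+ 2).
have -> : (avg n (fun s => f (1 :: s) ^+ 4) + avg n (fun s => f (-1 :: s) ^+ 4)) / 2
   = avg n (fun s => (g s ^+ 2) ^+ 2) + 6 * avg n (fun s => g s ^+ 2 * h s ^+ 2)
     + avg n (fun s => (h s ^+ 2) ^+ 2).
  rewrite -avgZ -!avgD mulrC -avgZ; apply: eq_avg => s _; rewrite !fE; lra.
have e4 (F : seq R -> R) : avg n (fun s => (F s ^+ 2) ^+ 2) = avg n (fun s => F s ^+ 4).
  by apply: eq_avg => s _; rewrite -exprM.
rewrite !e4 in cs *.
set x := avg n (fun s => g s ^+ 2) in hg *.
set y := avg n (fun s => h s ^+ 2) in hh *.
set z := avg n (fun s => g s ^+ 2 * h s ^+ 2) in cs *.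
have x0 : 0 <= x by apply: avg_ge0 => s; exact: sqr_ge0.
have y0 : 0 <= y by apply: avg_ge0 => s; exact: sqr_ge0.
have z0 : 0 <= z by apply: avg_ge0 => s; rewrite mulr_ge0 // sqr_ge0.
have c0 : 0 < 9 ^+ d :> R by rewrite exprn_gt0.
rewrite exprS in hg *; set c := 9 ^+ d in hg hh c0 *.
(* The three averages are at most [9 c x^2], [3 c x y] and [c y^2]; with the mixed one counted 6
   times they add up to at most [9 c (x + y)^2]. This mixed term is what fixes the constant 9. *)
have zb : z <= 3 * c * x * y.
  rewrite -(@ler_pXn2r _ 2) ?nnegrE ?mulr_ge0 ?(ltW c0) //.
  apply: le_trans cs _.
  have -> : (3 * c * x * y) ^+ 2 = (9 * c * x ^+ 2) * (c * y ^+ 2) by ring.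
  apply: ler_pM => //; apply: avg_ge0 => s; exact: exprn_even_ge0.
have : 0 <= c * y ^+ 2 by rewrite mulr_ge0 ?sqr_ge0 ?ltW.
nra.
Qed.

Definition lin_form (n : nat) (a : nat -> R) (s : seq R) : R :=
  \sum_(l < n) nth 0 s l * a l.

Definition offdiag_form (n : nat) (S : nat -> nat -> R) (s : seq R) : R :=
  \sum_(k < n) \sum_(l < n | l != k :> nat) nth 0 s k * nth 0 s l * S k l.

Lemma lin_form_cons n a e s :
  lin_form n.+1 a (e :: s) = lin_form n (fun l => a l.+1) s + e * a 0%N.
Proof.
by rewrite /lin_form big_ord_recl /= addrC; congr (_ + _); apply: eq_bigr.
Qed.

Lemma offdiag_form_cons n S e s :
  offdiag_form n.+1 S (e :: s) = offdiag_form n (fun k l => S k.+1 l.+1) s +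
    e * lin_form n (fun l => S 0%N l.+1 + S l.+1 0%N) s.
Proof.
rewrite /offdiag_form big_ord_recl /= [in LHS]big_mkcond big_ord_recl /= add0r.
rewrite addrC; under [X in X + _ = _]eq_bigr do
  rewrite big_mkcond big_ord_recl /=.
rewrite big_split /= [X in X + _ = _]addrC -addrA; congr (_ + _).
  apply: eq_bigr => k _; rewrite [RHS]big_mkcond; apply: eq_bigr => l _.
  by rewrite /bump /= !add1n eqSS.
rewrite /lin_form mulr_sumr -big_split; apply: eq_bigr => k _ /=; ring.
Qed.

Lemma chaos_lin n a : chaos 1 n (lin_form n a).
Proof.
elim: n a => [|n IH] a //=.
exists (lin_form n (fun l => a l.+1)), (fun=> a 0%N); split => //.
  by case: n {IH} => //= n; exists (a 0%N).
by move=> e s; exact: lin_form_cons.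
Qed.

Lemma chaos_offdiag n S : chaos 2 n (offdiag_form n S).
Proof.
elim: n S => [|n IH] S //=.
exists (offdiag_form n (fun k l => S k.+1 l.+1)),
  (lin_form n (fun l => S 0%N l.+1 + S l.+1 0%N)); split => //.
  exact: chaos_lin.
by move=> e s; exact: offdiag_form_cons.
Qed.

Lemma avg_lin2 n a : avg n (fun s => lin_form n a s ^+ 2) = \sum_(l < n) a l ^+ 2.
Proof.
elim: n a => [|n IH] a; first by rewrite /= /lin_form !big_ord0 expr0n.
rewrite (@avg_recE _ _ (lin_form n (fun l => a l.+1)) (fun=> a 0%N)) ?IH; last first.
  exact: lin_form_cons.
by rewrite avg_cst big_ord_recl addrC.
Qed.

(** The first sign contributes a linear form with coefficients [S 0 l + S l 0]. As [S] need not be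
    symmetric, [(a + b)^2 <= 2 (a^2 + b^2)] costs the factor 2. *)
Lemma avg_offdiag2 n S :
  avg n (fun s => offdiag_form n S s ^+ 2) <= 2 * \sum_(k < n) \sum_(l < n) S k l ^+ 2.
Proof.
elim: n S => [|n IH] S.
  by rewrite /= /offdiag_form !big_ord0 expr0n mulr0.
rewrite (avg_recE _ (@offdiag_form_cons n S)) avg_lin2.
apply: le_trans (lerD (IH _) (lexx _)) _.
rewrite [in leRHS]big_ord_recl /= [X in 2 * (X + _)]big_ord_recl /=.
under [X in 2 * (_ + X)]eq_bigr do rewrite big_ord_recl /=.
rewrite [X in 2 * (_ + X)]big_split /=.
set A := \sum_(k < n) \sum_(l < n) _.
set a := \sum_(l < n) _; set b := \sum_(l < n) S 0%N _ ^+ 2.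
set c := \sum_(l < n) S _ 0%N ^+ 2.
have : a <= 2 * (b + c).
  rewrite -big_split mulr_sumr; apply: ler_sum => k _ /=; rewrite /bump /= add1n.
  have := sqr_ge0 (S 0%N k.+1 - S k.+1 0%N); lra.
have := sqr_ge0 (S 0%N 0%N); lra.
Qed.

(** [18 = 9 * 2]: hypercontractivity in degree 2 costs [9 ^ 2], and the bound on the second moment
    enters squared with its factor 2. *)
Lemma avg_offdiag4 n S : avg n (fun s => offdiag_form n S s ^+ 4) <=
  (18 * \sum_(k < n) \sum_(l < n) S k l ^+ 2) ^+ 2.
Proof.
apply: le_trans (chaos_moment4 (chaos_offdiag n S)) _.
have h := avg_offdiag2 n S.
have h0 : 0 <= avg n (fun s => offdiag_form n S s ^+ 2).
  by apply: avg_ge0 => s; exact: sqr_ge0.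
set a := avg _ _ in h h0 *; set b := \sum_(k < n) _ in h *; nra.
Qed.

End RademacherChaos.

(** * Measurability and joint laws of random matrices *)

HB.instance Definition _ (R : realType) := isPointed.Build R[i] 0.

Section MatrixMeasurability.
Variable R : realType.
Local Notation C := R[i].
Local Notation Re := (@complex.Re R).
Local Notation Im := (@complex.Im R).

Definition cmeas d (T : measurableType d) (f : T -> C) :=
  measurable_fun setT (fun x => Re (f x)) /\
  measurable_fun setT (fun x => Im (f x)).

Definition mxmeas d (T : measurableType d) p q (F : T -> 'M[C]_(p, q)) :=
  forall i j, cmeas (fun x => F x i j).

Section Closure.
Context d (T : measurableType d).
Implicit Types f g : T -> C.

Lemma cmeas_cst (c : C) : cmeas (fun _ : T => c).
Proof. by split; exact: measurable_cst. Qed.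
Lemma cmeas_cR (h : T -> R) : measurable_fun setT h -> cmeas (fun x => cR (h x)).
Proof. by split => //=; exact: measurable_cst. Qed.
Lemma cmeasM f g : cmeas f -> cmeas g -> cmeas (fun x => f x * g x).
Proof.
move=> [f1 f2] [g1 g2]; split.
  by under eq_fun do rewrite ReM; apply: measurable_funB; exact: measurable_funM.
by under eq_fun do rewrite ImM; apply: measurable_funD; exact: measurable_funM.
Qed.
Lemma cmeasJ f : cmeas f -> cmeas (fun x => conjc (f x)).
Proof.
move=> [f1 f2]; split; first by under eq_fun do rewrite ReJ.
by under eq_fun do rewrite ImJ; exact: measurable_funN.
Qed.
Lemma cmeas_sum (I : Type) (s : seq I) (h : I -> T -> C) :
  (forall i, cmeas (h i)) -> cmeas (fun x => \sum_(i <- s) h i x).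
Proof.
move=> hm; split.
  by under eq_fun do rewrite Re_sum; apply: measurable_sum => i; case: (hm i).
by under eq_fun do rewrite Im_sum; apply: measurable_sum => i; case: (hm i).
Qed.

Lemma mxmeas_cst p q (A : 'M[C]_(p, q)) : mxmeas (fun _ : T => A).
Proof. by move=> i j; exact: cmeas_cst. Qed.
Lemma mxmeasM p q r (A : T -> 'M[C]_(p, q)) (B : T -> 'M[C]_(q, r)) :
  mxmeas A -> mxmeas B -> mxmeas (fun x => A x *m B x).
Proof.
move=> mA mB i j; under eq_fun do rewrite mxE.
by apply: cmeas_sum => k; exact: cmeasM.
Qed.
Lemma mxmeasH p q (A : T -> 'M[C]_(p, q)) : mxmeas A -> mxmeas (fun x => mxH (A x)).
Proof. by move=> mA i j; under eq_fun do rewrite mxHE; exact: cmeasJ. Qed.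
Lemma mxmeas_diag p (h : 'I_p -> T -> R) :
  (forall k, measurable_fun setT (h k)) ->
  mxmeas (fun x => diag_mx (\row_k cR (h k x))).
Proof.
move=> mh i j; under eq_fun do rewrite !mxE.
case: (i == j) => /=; last exact: cmeas_cst.
by under eq_fun do rewrite mulr1n; exact: cmeas_cR.
Qed.
Lemma cmeas_tr p (A : T -> 'M[C]_p) : mxmeas A -> cmeas (fun x => \tr (A x)).
Proof. by move=> mA; exact: cmeas_sum. Qed.
Lemma cmeas_qf p q (A : T -> 'M[C]_(p, q)) u v :
  mxmeas A -> cmeas (fun x => dot u (A x *m v)).
Proof.
move=> mA; apply: (@mxmeasM _ _ _ (fun=> mxH u) (fun x => A x *m v)).
  exact: mxmeas_cst.
by apply: mxmeasM => //; exact: mxmeas_cst.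
Qed.
End Closure.

Local Notation mxS p q := (g_sigma_algebraType (@mx_gen R p q)).

Lemma mxmeas_id p q : mxmeas (fun M : mxS p q => M).
Proof.
move=> i j; split => _ B mB; rewrite setTI; apply: sub_sigma_algebra; exists i, j, B.
  by split => //; left.
by split => //; right.
Qed.

Lemma mxmeas_measurable d (T : measurableType d) p q (F : T -> mxS p q) :
  mxmeas (F : T -> 'M[C]_(p, q)) -> measurable_fun setT F.
Proof.
move=> mF; apply: (@measurability _ _ _ _ setT F (@mx_gen R p q)) => //.
move=> _ [_ [i [j [B [mB [->|->]]]]] <-]; case: (mF i j) => m1 m2.
  exact: (m1 measurableT B mB).
exact: (m2 measurableT B mB).
Qed.

Lemma mx_meas_preimage p q p' q' (phi : 'M[C]_(p, q) -> 'M[C]_(p', q')) :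
  mxmeas (phi : mxS p q -> _) -> forall S, mx_meas S -> mx_meas (phi @^-1` S).
Proof.
move=> mphi S mS.
have := @mxmeas_measurable _ (mxS p q) _ _ phi mphi measurableT S mS.
by rewrite setTI.
Qed.

Lemma rmx_measurable_mxmeas d (T : measurableType d) p q (X : T -> 'M[C]_(p, q)) :
  rmx_measurable X -> mxmeas X.
Proof.
move=> mX i j; have [h1 h2] := @mxmeas_id p q i j; split => _ B mB.
  rewrite setTI; have := h1 measurableT B mB; rewrite setTI; exact: mX.
rewrite setTI; have := h2 measurableT B mB; rewrite setTI; exact: mX.
Qed.

Section Triple.
Variables p1 q1 p2 q2 p3 q3 : nat.

Definition mtriple := ('M[C]_(p1, q1) * 'M[C]_(p2, q2) * 'M[C]_(p3, q3))%type.
(** The intersection-stable family on which independence determines the joint law; it also generates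
    the sigma-algebra put on triples. *)
Definition rect : set (set mtriple) :=
  [set S | exists S1 S2 S3, [/\ mx_meas S1, mx_meas S2, mx_meas S3 &
     S = S1 `*` S2 `*` S3]].
Local Notation tripleT := (g_sigma_algebraType rect).

Lemma mx_measT p q : mx_meas ([set: 'M[C]_(p, q)]).
Proof. exact: (@measurableT _ (mxS p q)). Qed.

Lemma mxmeas_pr1 : mxmeas (fun t : tripleT => t.1.1).
Proof.
apply: rmx_measurable_mxmeas => S mS; apply: sub_sigma_algebra.
exists S, setT, setT; split; [by []|exact: mx_measT|exact: mx_measT|].
by apply/seteqP; split => [[[a b] e]|[[a b] e] [[]]].
Qed.

Lemma mxmeas_pr2 : mxmeas (fun t : tripleT => t.1.2).
Proof.
apply: rmx_measurable_mxmeas => S mS; apply: sub_sigma_algebra.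
exists setT, S, setT; split; [exact: mx_measT|by []|exact: mx_measT|].
by apply/seteqP; split => [[[a b] e]|[[a b] e] [[]]].
Qed.

Lemma mxmeas_pr3 : mxmeas (fun t : tripleT => t.2).
Proof.
apply: rmx_measurable_mxmeas => S mS; apply: sub_sigma_algebra.
exists setT, setT, S; split; [exact: mx_measT|exact: mx_measT|by []|].
by apply/seteqP; split => [[[a b] e]|[[a b] e] []].
Qed.

Context d (T : measurableType d) (P : probability T R).
Variables (X1 : T -> 'M[C]_(p1, q1)) (X2 : T -> 'M[C]_(p2, q2))
  (X3 : T -> 'M[C]_(p3, q3)).
Hypotheses (m1 : rmx_measurable X1) (m2 : rmx_measurable X2) (m3 : rmx_measurable X3).

Lemma measurable_triple (Y1 : T -> 'M[C]_(p1, q1)) (Y2 : T -> 'M[C]_(p2, q2))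
    (Y3 : T -> 'M[C]_(p3, q3)) :
  rmx_measurable Y1 -> rmx_measurable Y2 -> rmx_measurable Y3 ->
  measurable_fun setT (fun x => (Y1 x, Y2 x, Y3 x) : tripleT).
Proof.
move=> n1 n2 n3; apply: (@measurability _ _ _ tripleT setT _ rect) => //.
move=> _ [_ [S1 [S2 [S3 [h1 h2 h3 ->]]]] <-]; rewrite setTI.
rewrite [X in measurable X](_ : _ = Y1 @^-1` S1 `&` Y2 @^-1` S2 `&` Y3 @^-1` S3).
  by apply: measurableI; [apply: measurableI|]; [exact: n1|exact: n2|exact: n3].
by apply/seteqP; split => x.
Qed.

Lemma setI_closed_rect : setI_closed rect.
Proof.
move=> _ _ [A1 [A2 [A3 [a1 a2 a3 ->]]]] [B1 [B2 [B3 [b1 b2 b3 ->]]]].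
exists (A1 `&` B1), (A2 `&` B2), (A3 `&` B3); split.
- exact: (@measurableI _ (mxS p1 q1)).
- exact: (@measurableI _ (mxS p2 q2)).
- exact: (@measurableI _ (mxS p3 q3)).
- by apply/seteqP; split => [[[a b] e] /= [[[? ?] ?] [[? ?] ?]]|
     [[a b] e] /= [[[? ?] [? ?]] [? ?]]].
Qed.

(** By independence, applied to [S1], [S3] and to their preimages under [phi1], [phi3], the two
    joint laws agree on rectangles, hence everywhere. This transfers the invariance of single
    factors to functions of the triple. *)
Lemma indep3_law (phi1 : 'M[C]_(p1, q1) -> 'M[C]_(p1, q1))
    (phi3 : 'M[C]_(p3, q3) -> 'M[C]_(p3, q3)) (F : tripleT -> \bar R) :
  indep3 P X1 X2 X3 ->
  (forall S, mx_meas S -> mx_meas (phi1 @^-1` S) /\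
     P (X1 @^-1` S) = P ((fun x => phi1 (X1 x)) @^-1` S)) ->
  (forall S, mx_meas S -> mx_meas (phi3 @^-1` S) /\
     P (X3 @^-1` S) = P ((fun x => phi3 (X3 x)) @^-1` S)) ->
  measurable_fun setT F -> (forall t, 0 <= F t)%E ->
  (\int[P]_x F (X1 x, X2 x, X3 x) = \int[P]_x F (phi1 (X1 x), X2 x, phi3 (X3 x)))%E.
Proof.
move=> ind h1 h3 mF F0.
have n1 : rmx_measurable (fun x => phi1 (X1 x)).
  by move=> S mS; have [h _] := h1 S mS; have := m1 h.
have n3 : rmx_measurable (fun x => phi3 (X3 x)).
  by move=> S mS; have [h _] := h3 S mS; have := m3 h.
have mf := measurable_triple m1 m2 m3.
have mg := measurable_triple n1 m2 n3.
set f := (fun x => (X1 x, X2 x, X3 x) : tripleT) in mf.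
set g := (fun x => (phi1 (X1 x), X2 x, phi3 (X3 x)) : tripleT) in mg.
have := @ge0_integral_pushforward _ _ _ _ _ _ mf P setT F measurableT mF
  (fun y _ => F0 y).
have := @ge0_integral_pushforward _ _ _ _ _ _ mg P setT F measurableT mF
  (fun y _ => F0 y).
rewrite !preimage_setT => <- <-.
apply: eq_measure_integral => A mA _.
have rT : rect setT.
  exists setT, setT, setT; split; [exact: mx_measT..|].
  by apply/seteqP; split.
have cov : \bigcup_(k : nat) [set: tripleT] = setT by rewrite bigcup_const //; exists 0%N.
apply: (@measure_unique _ R tripleT rect (fun=> setT) erefl setI_closed_rect
  (fun=> rT) cov
  (measure_function_pushforward__canonical__measure_function_Measure P mf)
  (measure_function_pushforward__canonical__measure_function_Measure P mg)
  _ _ A mA) => [_ [S1 [S2 [S3 [s1 s2 s3 ->]]]] /=|_] /=; rewrite /pushforward.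
  have [t1 e1] := h1 _ s1; have [t3 e3] := h3 _ s3.
  have := ind _ _ _ s1 s2 s3; rewrite e1 e3 -(ind _ _ _ t1 s2 t3) => e.
  rewrite [X in P X = _](_ : _ = X1 @^-1` S1 `&` X2 @^-1` S2 `&` X3 @^-1` S3) //.
by rewrite preimage_setT probability_setT ltry.
Qed.
End Triple.
End MatrixMeasurability.

(** * Concentration of quadratic forms *)

Section Concentration.
Variable R : realType.
Local Notation C := R[i].
Local Notation Re := (@complex.Re R).
Local Notation Im := (@complex.Im R).

(** The subtracted term is the mean of the quadratic form over the sphere of vectors with the norm
    of [u]. *)
Definition fluc p (u : 'cV[C]_p) (Z : 'M[C]_p) : R :=
  Re (dot u (Z *m u)) - n2 u * Re (\tr Z) / p%:R.

Definition frob p q (Z : 'M[C]_(p, q)) : R := \sum_k \sum_l cabs (Z k l) ^+ 2.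

Lemma frob_ge0 p q (Z : 'M[C]_(p, q)) : 0 <= frob Z.
Proof. by apply: sumr_ge0 => k _; apply: sumr_ge0 => l _; rewrite sqr_ge0. Qed.

Definition sign_vec p (ka : R) (s : seq R) : 'cV[C]_p := \col_k cR (ka * nth 0 s k).

Lemma n2_sign_vec p ka s : signs p s -> n2 (sign_vec p ka s) = ka ^+ 2 * p%:R.
Proof.
move=> hs; rewrite n2E (eq_bigr (fun=> ka ^+ 2)) ?sumr_const ?card_ord ?mulr_natr //.
move=> k _; rewrite mxE cabs_cR real_normK ?num_real // exprMn hs ?mulr1 //.
Qed.

(** All entries of the vector have square [ka ^ 2], so the diagonal of [Z] contributes exactly the
    centring term and only the off-diagonal chaos is left. *)
Lemma fluc_sign_vec p ka s (Z : 'M[C]_p.+1) : signs p.+1 s ->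
  fluc (sign_vec p.+1 ka s) Z =
  ka ^+ 2 * offdiag_form p.+1 (fun k l => Re (Z (inord k) (inord l))) s.
Proof.
move=> hs; rewrite /fluc n2_sign_vec //.
have -> (t : R) : ka ^+ 2 * p.+1%:R * t / p.+1%:R = ka ^+ 2 * t.
  by rewrite mulrAC mulfK ?pnatr_eq0.
rewrite dotE Re_sum /mxtrace Re_sum /offdiag_form !mulr_sumr -sumrB.
apply: eq_bigr => k _.
rewrite [(Z *m _) k 0]mxE [X in Re X]mulr_sumr Re_sum (bigD1 k) //= mulr_sumr.
rewrite !mxE conjc_cR !ReM !ImM /= !mul0r !subr0.
have -> : ka * s`_k * (Re (Z k k) * (ka * s`_k) - Im (Z k k) * 0) = ka ^+ 2 * Re (Z k k).
  by rewrite mulr0 subr0 -[RHS]mulr1 -(hs k (ltn_ord k)); ring.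
rewrite addrAC subrr add0r; apply: eq_bigr => l kl.
rewrite !mxE ?conjc_cR !ReM !ImM /= !inord_val; ring.
Qed.

Lemma avg_fluc4 p ka (Z : 'M[C]_p.+1) :
  avg p.+1 (fun s => fluc (sign_vec p.+1 ka s) Z ^+ 4) <=
  ka ^+ 8 * (18 * frob Z) ^+ 2.
Proof.
set S := fun k l => Re (Z (inord k) (inord l)).
rewrite (@eq_avg _ _ _ (fun s => ka ^+ 8 * offdiag_form p.+1 S s ^+ 4)); last first.
  by move=> s hs; rewrite fluc_sign_vec // exprMn -exprM.
have t0 : 0 <= ka ^+ 8 by exact: exprn_even_ge0.
have S2_ge0 : 0 <= \sum_(k < p.+1) \sum_(l < p.+1) S k l ^+ 2.
  by apply: sumr_ge0 => k _; apply: sumr_ge0 => l _; rewrite sqr_ge0.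
have S2_le : \sum_(k < p.+1) \sum_(l < p.+1) S k l ^+ 2 <= frob Z.
  apply: ler_sum => k _; apply: ler_sum => l _.
  by rewrite /S !inord_val sqr_cabs lerDl sqr_ge0.
have h : (18 * \sum_(k < p.+1) \sum_(l < p.+1) S k l ^+ 2) ^+ 2 <= (18 * frob Z) ^+ 2.
  by have := frob_ge0 Z; nra.
by rewrite avgZ; exact: (ler_wpM2l t0 (le_trans (avg_offdiag4 _ _) h)).
Qed.

Section Probability.
Context d (T : measurableType d) (P : probability T R).

Lemma measurable_avg n (H : seq R -> T -> R) :
  (forall s, measurable_fun setT (H s)) ->
  measurable_fun setT (fun x => avg n (fun s => H s x)).
Proof.
elim: n H => [|n IH] H mH //=.
by apply: measurable_funM => //; apply: measurable_funD; apply: IH => s.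
Qed.

(** [I] is an extended real because the fourth moment is not known to be finite beforehand: its
    bound is obtained only after averaging over the signs. *)
Lemma integral_avg n (H : seq R -> T -> R) (I : \bar R) :
  (forall s, measurable_fun setT (H s)) -> (forall s x, 0 <= H s x) ->
  (forall s, signs n s -> (\int[P]_x (H s x)%:E = I)%E) ->
  (\int[P]_x (avg n (fun s => H s x))%:E = I)%E.
Proof.
elim: n H => [|n IH] H mH H0 HI; first by apply: HI.
have I0 : (0 <= I)%E.
  rewrite -(HI (nseq n.+1 1)); first by apply: integral_ge0 => x _; rewrite lee_fin.
  by move=> k kn; rewrite nth_nseq kn expr1n.
have mE (F : T -> R) : measurable_fun setT F -> measurable_fun setT (EFin \o F).
  by move=> ?; apply/measurable_EFinP.
have e1 := IH (fun s => H (1 :: s)) (fun s => mH _) (fun s x => H0 _ _)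
  (fun s hs => HI _ (signs_cons (expr1n _ _) hs)).
have sN1 : (-1) ^+ 2 = 1 :> R by rewrite sqrrN expr1n.
have e2 := IH (fun s => H (-1 :: s)) (fun s => mH _) (fun s x => H0 _ _)
  (fun s hs => HI _ (signs_cons sN1 hs)).
under eq_integral => x _ do rewrite /= mulrC EFinM EFinD.
rewrite ge0_integralZl_EFin //; last first.
- apply: emeasurable_funD; apply: mE; exact: measurable_avg.
- by move=> x _; rewrite adde_ge0 // lee_fin avg_ge0.
rewrite ge0_integralD //; last first.
- by apply: mE; exact: measurable_avg.
- by move=> x _; rewrite lee_fin avg_ge0.
- by apply: mE; exact: measurable_avg.
- by move=> x _; rewrite lee_fin avg_ge0.
rewrite e1 e2; case: I I0 {IH HI e1 e2} => [r||] //= r0.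
  by rewrite -EFinD -EFinM; congr EFin; lra.
by rewrite addye // mulry gtr0_sg ?invr_gt0 // mul1e.
Qed.

Lemma measurable_fluc p (u : 'cV[C]_p) (Z : T -> 'M[C]_p) :
  mxmeas Z -> measurable_fun setT (fun x => fluc u (Z x)).
Proof.
move=> mZ; apply: measurable_funB; first by have [] := cmeas_qf u u mZ.
apply: measurable_funM => //; apply: measurable_funM => //.
by have [] := cmeas_tr mZ.
Qed.

(* By invariance [u] may be replaced by any vector with entries [+-|u| / sqrt p], hence by
   the average over all choices of signs. *)
Lemma integral_fluc4 p (Z : T -> 'M[C]_p.+1) (F : R) (u : 'cV[C]_p.+1) :
  mxmeas Z ->
  (forall v w : 'cV[C]_p.+1, n2 v = n2 w ->
     \int[P]_x (fluc v (Z x) ^+ 4)%:E = \int[P]_x (fluc w (Z x) ^+ 4)%:E)%E ->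
  {ae P, forall x, frob (Z x) <= F} ->
  (\int[P]_x (fluc u (Z x) ^+ 4)%:E <=
     ((n2 u / p.+1%:R) ^+ 4 * (18 * F) ^+ 2)%:E)%E.
Proof.
move=> mZ inv aeF; pose ka := Num.sqrt (n2 u / p.+1%:R).
have ka2 : ka ^+ 2 = n2 u / p.+1%:R by rewrite sqr_sqrtr // divr_ge0 ?n2_ge0.
have mf v : measurable_fun setT (fun x => fluc v (Z x) ^+ 4).
  by apply: measurable_funX; exact: measurable_fluc.
have eq_avgI := @integral_avg p.+1 (fun s x => fluc (sign_vec p.+1 ka s) (Z x) ^+ 4)
  (\int[P]_x (fluc u (Z x) ^+ 4)%:E)%E.
rewrite -eq_avgI; first last.
- move=> s hs; apply: inv; rewrite n2_sign_vec // ka2 -mulrA mulVf ?mulr1 ?pnatr_eq0 //.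
- by move=> s x; exact: exprn_even_ge0.
- by move=> s.
have ka8 : ka ^+ 8 = (n2 u / p.+1%:R) ^+ 4 by rewrite (exprM ka 2 4) ka2.
have ka0 : 0 <= ka ^+ 8 by exact: exprn_even_ge0.
rewrite -ka8.
apply: (@le_trans _ _ (\int[P]_x (ka ^+ 8 * (18 * F) ^+ 2)%:E)%E).
  apply: ae_ge0_le_integral => //.
  - by move=> x _; rewrite lee_fin avg_ge0 // => s; exact: exprn_even_ge0.
  - by apply/measurable_EFinP; exact: measurable_avg.
  - by move=> x _; rewrite lee_fin mulr_ge0 ?sqr_ge0.
  apply: filterS aeF => x hF _; rewrite lee_fin; apply: le_trans (avg_fluc4 _ _) _.
  by apply: (ler_wpM2l ka0); have := frob_ge0 (Z x); nra.
rewrite integral_cst // (_ : _ setT = 1%E) ?mule1 //; exact: probability_setT.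
Qed.

Lemma sum_inv_sqr_le n : \sum_(i < n) (i.+1%:R ^+ 2)^-1 <= 2 :> R.
Proof.
case: n => [|n]; first by rewrite big_ord0.
(* The subtracted [1 / n.+1] makes the induction close, by [1 / n.+2 ^ 2 <= 1 / n.+1 - 1 / n.+2]. *)
suff h : \sum_(i < n.+1) (i.+1%:R ^+ 2)^-1 <= 2 - n.+1%:R^-1 :> R.
  by apply: le_trans h _; rewrite lerBlDr lerDl invr_ge0.
elim: n => [|n IH]; first by rewrite big_ord1 expr1n invr1; lra.
rewrite big_ord_recr /=; apply: le_trans (lerD IH (lexx _)) _.
have a0 : 0 < n.+1%:R :> R by rewrite ltr0n.
have b0 : 0 < n.+2%:R :> R by rewrite ltr0n.
have ab : n.+2%:R = n.+1%:R + 1 :> R by rewrite -natr1.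
rewrite -addrA lerD2l addrC -subr_ge0.
have -> : - n.+2%:R^-1 - ((n.+2%:R ^+ 2)^-1 - n.+1%:R^-1)
   = (n.+1%:R * n.+2%:R ^+ 2)^-1 :> R.
  move: (n.+1%:R : R) (n.+2%:R : R) ab a0 b0 => x y -> x0 y0; field.
  by rewrite !gt_eqF.
by rewrite invr_ge0 mulr_ge0 ?exprn_ge0 // ltW.
Qed.

(** Markov's inequality for the fourth power, then Borel-Cantelli, at each threshold of a countable
    family tending to 0. *)
Lemma ae_cvg0_moment4 (Y : nat -> T -> R) (K : R) :
  (forall n, measurable_fun setT (Y n)) ->
  (\forall n \near \oo, (\int[P]_x (Y n x ^+ 4)%:E <= (K / n.+1%:R ^+ 2)%:E)%E) ->
  {ae P, forall x, (fun n => Y n x) @ \oo --> (0 : R)}.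
Proof.
move=> mY [n0 _ hY].
have mE n : measurable_fun setT (fun x => (Y n x ^+ 4)%:E).
  by apply/measurable_EFinP; exact: measurable_funX.
have Y4 n x : 0 <= Y n x ^+ 4 by exact: exprn_even_ge0.
suff ae_eps (e : R) : 0 < e ->
    {ae P, forall x, \forall n \near \oo, Y n x ^+ 4 < e}.
  have : {ae P, forall x, forall k, \forall n \near \oo, Y n x ^+ 4 < (k.+1%:R^-1) ^+ 4}.
    by apply: ae_foralln => k; apply: ae_eps; rewrite exprn_gt0 // invr_gt0.
  apply: filterS => x hx; apply/cvgrPdist_lt => e e0.
  have [k ke] : exists k, k.+1%:R^-1 < e.
    exists (Num.truncn e^-1); rewrite invf_plt ?posrE //.
    exact: truncnS_gt.
  apply: filterS (hx k) => n; rewrite sub0r normrN => h.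
  apply: lt_trans ke; rewrite -(@ltr_pXn2r _ 4) ?nnegrE ?invr_ge0 //.
  by rewrite -normrX ger0_norm.
move=> e0; pose A n := [set x | (e%:E <= `|(Y n x ^+ 4)%:E|)%E].
have mA n : measurable (A n).
  rewrite -[A n]setTI; apply: emeasurable_fun_c_infty => //.
  exact: measurableT_comp.
have PA n : (e%:E * P (A n) <= \int[P]_x (Y n x ^+ 4)%:E)%E.
  have := le_integral_abse P measurableT (mE n) e0; rewrite setTI => h.
  apply: le_trans h _; rewrite le_eqVlt; apply/orP; left; apply/eqP.
  by apply: eq_integral => x _; rewrite gee0_abs // lee_fin.
(* The moment bound starts at [n0]. The second entry of the maximum makes [M / n.+1 ^ 2] at least 1
   before [n0], so that one summable bound covers every index. *)
pose M : R := Num.max (K / e) (n0.+1%:R ^+ 2).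
have PM n : (P (A n) <= (M / n.+1%:R ^+ 2)%:E)%E.
  have [nn0|nn0] := ltnP n n0.
    apply: le_trans (probability_le1 P (mA n)) _; rewrite lee_fin.
    rewrite ler_pdivlMr ?exprn_gt0 // mul1r /M le_max; apply/orP; right.
    by rewrite ler_pXn2r ?nnegrE // ler_nat ltnW.
  have := le_trans (PA n) (hY n nn0); rewrite -lee_pdivlMl //.
  move/le_trans; apply; rewrite -EFinM lee_fin mulrA ler_pM2r ?invr_gt0 ?exprn_gt0 //.
  by rewrite mulrC le_max lexx.
have M0 : 0 <= M by rewrite le_max sqr_ge0 orbT.
have : P (lim_sup_set A) = 0.
  apply: lim_sup_set_cvg0 => //; apply: (@le_lt_trans _ _ (M * 2)%:E); last by rewrite ltry.
  apply: lime_le; first by apply: is_cvg_nneseries => n _ _.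
  near=> n; rewrite big_mkord.
  apply: (@le_trans _ _ (\sum_(i < n) (M / i.+1%:R ^+ 2)%:E)%E); first by apply: lee_sum => i _; exact: PM.
  by rewrite sumEFin lee_fin -mulr_sumr ler_wpM2l // sum_inv_sqr_le.
move=> PA0; exists (lim_sup_set A); split => //.
  apply: bigcapT_measurable => n; exact: bigcup_measurable.
move=> x /= hx n _; apply: contrapT => hn; apply: hx; exists n => // m nm.
rewrite ltNge; apply/negP => em; apply: hn; exists m => //=.
by rewrite /A /= lee_fin ger0_norm.
Unshelve. all: by end_near. Qed.
End Probability.
End Concentration.

(** * Functions of bi-unitarily invariant matrices *)

Section InvariantEnsembles.
Variable R : realType.
Local Notation C := R[i].
Local Notation Re := (@complex.Re R).
Local Notation Im := (@complex.Im R).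

Lemma frobE p q (Z : 'M[C]_(p, q)) : frob Z = Re (\tr (mxH Z *m Z)).
Proof.
rewrite /frob exchange_big /mxtrace Re_sum; apply: eq_bigr => l _.
by rewrite mxE Re_sum; apply: eq_bigr => k _; rewrite mxHE mulcJ.
Qed.

Definition rdiag p (d : 'I_p -> R) : 'M[C]_p := diag_mx (\row_k cR (d k)).

Lemma mxH_rdiag p (d : 'I_p -> R) : mxH (rdiag d) = rdiag d.
Proof. exact: mxH_diagR. Qed.

Lemma rdiagM p (d e : 'I_p -> R) : rdiag d *m rdiag e = rdiag (fun k => d k * e k).
Proof.
rewrite /rdiag mulmx_diag; congr diag_mx; apply/rowP => k.
by rewrite !mxE cRM.
Qed.

Lemma rdiag_mulE p (d : 'I_p -> R) (v : 'cV[C]_p) k : (rdiag d *m v) k 0 = cR (d k) * v k 0.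
Proof. by rewrite /rdiag mul_diag_mx !mxE. Qed.

Lemma rdiagB p (d e : 'I_p -> R) : rdiag d - rdiag e = rdiag (fun k => d k - e k).
Proof.
rewrite /rdiag -linearB /=; congr diag_mx; apply/rowP => k.
by rewrite !mxE cRD cRN.
Qed.

Lemma rdiag_cst p (x : R) : rdiag (fun _ : 'I_p => x) = (cR x)%:M.
Proof.
by rewrite /rdiag; apply/matrixP => k l; rewrite !mxE.
Qed.

Lemma tr_rdiag p (d : 'I_p -> R) : Re (\tr (rdiag d)) = \sum_k d k.
Proof.
by rewrite /rdiag mxtrace_diag Re_sum; apply: eq_bigr => k _; rewrite mxE.
Qed.

Section Conjugate.
Variables (p q : nat) (A : 'M[C]_(p, q)) (dg : 'I_q -> R).
Hypothesis (AA : mxH A *m A = 1%:M).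

(** With [A] the left or right singular vectors of [X] and [dg] a function of the singular values,
    this covers both [Q] and [X^* Q X]. *)
Definition conjdiag := A *m rdiag dg *m mxH A.

Lemma conjdiagH : mxH conjdiag = conjdiag.
Proof. by rewrite /conjdiag !mxHM mxHK mxH_rdiag mulmxA. Qed.

Lemma tr_conjdiag : Re (\tr conjdiag) = \sum_k dg k.
Proof. by rewrite /conjdiag mxtrace_mulC mulmxA AA mul1mx tr_rdiag. Qed.

Lemma frob_conjdiag K : (forall k, `|dg k| <= K) -> frob conjdiag <= q%:R * K ^+ 2.
Proof.
move=> hK; rewrite frobE conjdiagH /conjdiag.
rewrite -!mulmxA (mulmxA _ A) AA mul1mx (mulmxA (rdiag dg)) rdiagM.
rewrite mxtrace_mulC -mulmxA AA mulmx1 tr_rdiag.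
have -> : q%:R * K ^+ 2 = \sum_(k < q) K ^+ 2 by rewrite sumr_const card_ord mulr_natl.
apply: ler_sum => k _; rewrite -expr2 -real_normK ?num_real //.
by rewrite ler_pXn2r ?nnegrE // (le_trans _ (hK k)).
Qed.
End Conjugate.

Lemma n2_rdiag_le p (dg : 'I_p -> R) K (v : 'cV[C]_p) :
  (forall k, `|dg k| <= K) -> n2 (rdiag dg *m v) <= K ^+ 2 * n2 v.
Proof.
move=> hK; rewrite !n2E mulr_sumr; apply: ler_sum => k _.
rewrite rdiag_mulE cabsM exprMn ler_wpM2r ?sqr_ge0 // cabs_cR.
by rewrite ler_pXn2r ?nnegrE // (le_trans _ (hK k)).
Qed.

(** Pythagoras: [A A^*] is an orthogonal projection, and [|v|^2 - |A^* v|^2] is the squared norm of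
    [v - A A^* v]. *)
Lemma n2_isomH_le p q (A : 'M[C]_(p, q)) (v : 'cV[C]_p) :
  mxH A *m A = 1%:M -> n2 (mxH A *m v) <= n2 v.
Proof.
move=> AA; have := n2_ge0 (v - A *m (mxH A *m v)).
set w := mxH A *m v.
have e : dot v (A *m w) = cR (n2 w) by rewrite dotMr dotvv.
have -> : n2 (v - A *m w) = n2 v - n2 w.
  rewrite /n2 dotBl !dotBr (dotC (A *m w) v) e conjc_cR dot_isom // dotvv.
  by rewrite !ReD !ReN !ReD !ReN /= -!/(n2 _); ring.
by rewrite subr_ge0.
Qed.

Lemma mxtrace_rank1 p (xi : 'cV[C]_p) : Re (\tr (xi *m mxH xi)) = n2 xi.
Proof. by rewrite mxtrace_mulC trace_mx11. Qed.

Lemma frob_rank1 p (xi : 'cV[C]_p) : frob (xi *m mxH xi) = n2 xi ^+ 2.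
Proof.
rewrite frobE mxHM mxHK -mulmxA (mulmxA _ xi) [mxH xi *m xi]mx11_scalar.
rewrite -/(dot xi xi) dotvv mul_scalar_mx -scalemxAr linearZ /=.
rewrite ReM /= mul0r subr0 mxtrace_rank1.
by [].
Qed.

Lemma fluc_unitary p (U Z : 'M[C]_p) u : unitary_mx U ->
  fluc u (U *m Z *m mxH U) = fluc (mxH U *m u) Z.
Proof.
move=> hU; have hU' := unitary_mxC hU.
rewrite /fluc; have -> : \tr (U *m Z *m mxH U) = \tr Z by rewrite mxtrace_mulC mulmxA hU' mul1mx.
by rewrite n2_isom ?mxHK // -!mulmxA dotMr.
Qed.

Section OneDimension.
Context d (T : measurableType d) (P : probability T R).
Variables (p q : nat).
Variables (L Gm : T -> 'M[C]_p) (W : T -> 'M[C]_q) (f : 'I_p -> 'I_q).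
Hypotheses (f_inj : injective f) (hL : haar_unitary P L) (hW : haar_unitary P W)
  (mG : rmx_measurable Gm).
Let Rm x := colsub f (W x).
Hypothesis (ind : indep3 P L Gm Rm).

Lemma mxmeas_colsub d' (T' : measurableType d') (F : T' -> 'M[C]_q) :
  mxmeas F -> mxmeas (fun x => colsub f (F x)).
Proof. by move=> mF i j; under eq_fun do rewrite mxE; exact: mF. Qed.

Lemma mx_meas_mull k l (U : 'M[C]_k) S :
  mx_meas S -> mx_meas ((fun M : 'M[C]_(k, l) => U *m M) @^-1` S).
Proof.
apply: mx_meas_preimage; apply: mxmeasM; [exact: mxmeas_cst|exact: mxmeas_id].
Qed.

Lemma rmx_measurable_Rm : rmx_measurable Rm.
Proof.
move=> S mS; have [mW _] := hW.
apply: (mW ((fun M : 'M[C]_q => colsub f M) @^-1` S)).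
by apply: mx_meas_preimage mS; apply: mxmeas_colsub; exact: mxmeas_id.
Qed.

Lemma haar_left (U : 'M[C]_p) : unitary_mx U -> forall S, mx_meas S ->
  mx_meas ((fun M => U *m M) @^-1` S) /\
  P (L @^-1` S) = P ((fun x => U *m L x) @^-1` S).
Proof.
move=> hU S mS; split; first exact: mx_meas_mull.
by have [_ [_ h]] := hL; exact: h.
Qed.

(** Selecting columns commutes with left multiplication, so a column submatrix inherits the
    invariance of the Haar matrix. *)
Lemma haar_colsub (U : 'M[C]_q) : unitary_mx U -> forall S, mx_meas S ->
  mx_meas ((fun M => U *m M) @^-1` S) /\
  P (Rm @^-1` S) = P ((fun x => U *m Rm x) @^-1` S).
Proof.
move=> hU S mS; split; first exact: mx_meas_mull.
have [_ [_ h]] := hW.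
have mS' : mx_meas ((fun M : 'M[C]_q => colsub f M) @^-1` S).
  by apply: mx_meas_preimage mS; apply: mxmeas_colsub; exact: mxmeas_id.
have := h U hU _ mS'; rewrite -[_ @^-1` (_ @^-1` S)]/(Rm @^-1` S) => ->.
congr (P _); apply/seteqP; split => x /=; by rewrite /Rm -mulmx_colsub.
Qed.

Lemma id_law k l (X : T -> 'M[C]_(k, l)) S : mx_meas S ->
  mx_meas (id @^-1` S) /\ P (X @^-1` S) = P ((fun x => id (X x)) @^-1` S).
Proof. by []. Qed.

Local Notation tripleT := (g_sigma_algebraType (@rect R p p p p q p)).

(** If a change of [L] or [Rm] that preserves its law conjugates [G] by [U], then conjugation
    preserves the law of [G] as well; taking [U v = w] moves [w] to [v] inside the form. *)
Lemma fluc_law k (G : 'M[C]_p -> 'M[C]_p -> 'M[C]_(q, p) -> 'M[C]_k) :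
  mxmeas (fun t : tripleT => G t.1.1 t.1.2 t.2) ->
  (forall U, unitary_mx U -> exists phi1 phi3,
    [/\ forall S, mx_meas S -> mx_meas (phi1 @^-1` S) /\
          P (L @^-1` S) = P ((fun x => phi1 (L x)) @^-1` S),
        forall S, mx_meas S -> mx_meas (phi3 @^-1` S) /\
          P (Rm @^-1` S) = P ((fun x => phi3 (Rm x)) @^-1` S) &
        forall a b e, G (phi1 a) b (phi3 e) = U *m G a b e *m mxH U]) ->
  forall v w, n2 v = n2 w ->
  (\int[P]_x (fluc v (G (L x) (Gm x) (Rm x)) ^+ 4)%:E =
   \int[P]_x (fluc w (G (L x) (Gm x) (Rm x)) ^+ 4)%:E)%E.
Proof.
move=> mGt hphi v w vw; have [U hU Uv] := unitary_transitive vw.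
have [phi1 [phi3 [h1 h3 hG]]] := hphi U hU.
have mF : measurable_fun setT
    (fun t : tripleT => (fluc w (G t.1.1 t.1.2 t.2) ^+ 4)%:E).
  by apply/measurable_EFinP; apply: measurable_funX; exact: measurable_fluc.
have F0 (t : tripleT) : (0 <= (fluc w (G t.1.1 t.1.2 t.2) ^+ 4)%:E)%E.
  by rewrite lee_fin exprn_even_ge0.
have [mL _] := hL.
rewrite (indep3_law mL mG rmx_measurable_Rm ind h1 h3 mF F0) /=.
apply: eq_integral => x _; rewrite hG fluc_unitary //.
by rewrite -Uv mulmxA unitary_mxC // mul1mx.
Qed.

Lemma ae_unitary_L : {ae P, forall x, mxH (L x) *m L x = 1%:M}.
Proof.
by have [_ [h _]] := hL; apply: filterS h => x; exact: unitary_mxC.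
Qed.

Lemma ae_isom_Rm : {ae P, forall x, mxH (Rm x) *m Rm x = 1%:M}.
Proof.
have [_ [h _]] := hW; apply: filterS h => x /unitary_mxC /matrixP WW.
apply/matrixP => k l; have := WW (f k) (f l); rewrite !mxE (inj_eq f_inj) => <-.
by apply: eq_bigr => m _; rewrite !mxE.
Qed.

Definition gam x k := Re (Gm x k k).

Variables (h : R -> R) (K : R).
Hypotheses (mh : measurable_fun setT h) (hK : forall t, `|h t| <= K).

(** It reads the real diagonal of an arbitrary [M], so that it is a measurable map on the whole
    matrix space, as the comparison of joint laws requires. *)
Definition diagG (M : 'M[C]_p) := rdiag (fun k => h (Re (M k k))).
Definition ZL x := conjdiag (L x) (fun k => h (gam x k)).
Definition ZR x := conjdiag (Rm x) (fun k => h (gam x k)).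
(** The mixed form [<a, xi>] is reached through the rank-one matrix [xi xi^*] of [ZLR]: its
    quadratic form at [a] is [|<a, xi>|^2], so the bound for Hermitian quadratic forms applies. *)
Definition xiLR (v : 'cV[C]_q) x := L x *m rdiag (fun k => h (gam x k)) *m mxH (Rm x) *m v.
Definition ZLR v x := xiLR v x *m mxH (xiLR v x).

Lemma mxmeas_diagG : mxmeas (fun t : tripleT => diagG t.1.2).
Proof.
apply: mxmeas_diag => k; apply: measurableT_comp => //.
by have [] := @mxmeas_pr2 R p p p p q p k k.
Qed.

Lemma mxmeas_diagGm : mxmeas (fun x => rdiag (fun k => h (gam x k))).
Proof.
apply: mxmeas_diag => k; apply: measurableT_comp => //.
by have [] := rmx_measurable_mxmeas mG k k.
Qed.

Lemma mxmeas_L : mxmeas L.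
Proof. by have [mL _] := hL; exact: rmx_measurable_mxmeas. Qed.
Lemma mxmeas_Rm : mxmeas Rm.
Proof. exact: rmx_measurable_mxmeas rmx_measurable_Rm. Qed.

Lemma mxmeas_ZL : mxmeas ZL.
Proof.
apply: mxmeasM; last exact: mxmeasH mxmeas_L.
by apply: mxmeasM; [exact: mxmeas_L|exact: mxmeas_diagGm].
Qed.
Lemma mxmeas_ZR : mxmeas ZR.
Proof.
apply: mxmeasM; last exact: mxmeasH mxmeas_Rm.
by apply: mxmeasM; [exact: mxmeas_Rm|exact: mxmeas_diagGm].
Qed.
Lemma mxmeas_ZLR v : mxmeas (ZLR v).
Proof.
have m : mxmeas (xiLR v).
  apply: mxmeasM; last exact: mxmeas_cst.
  apply: mxmeasM; last exact: mxmeasH mxmeas_Rm.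
  by apply: mxmeasM; [exact: mxmeas_L|exact: mxmeas_diagGm].
by apply: mxmeasM => //; exact: mxmeasH.
Qed.

Lemma ZL_inv v w : n2 v = n2 w ->
  (\int[P]_x (fluc v (ZL x) ^+ 4)%:E = \int[P]_x (fluc w (ZL x) ^+ 4)%:E)%E.
Proof.
move=> vw; apply: (@fluc_law p (fun a b _ => a *m diagG b *m mxH a)) vw.
  apply: mxmeasM; last by apply: mxmeasH; exact: mxmeas_pr1.
  by apply: mxmeasM; [exact: mxmeas_pr1|exact: mxmeas_diagG].
move=> U hU; exists (fun M => U *m M), id; split.
- exact: haar_left.
- exact: id_law.
- by move=> a b e; rewrite mxHM !mulmxA.
Qed.

Lemma ZR_inv v w : n2 v = n2 w ->
  (\int[P]_x (fluc v (ZR x) ^+ 4)%:E = \int[P]_x (fluc w (ZR x) ^+ 4)%:E)%E.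
Proof.
move=> vw; apply: (@fluc_law q (fun _ b a => a *m diagG b *m mxH a)) vw.
  apply: mxmeasM; last by apply: mxmeasH; exact: mxmeas_pr3.
  by apply: mxmeasM; [exact: mxmeas_pr3|exact: mxmeas_diagG].
move=> U hU; exists id, (fun M => U *m M); split.
- exact: id_law.
- exact: haar_colsub.
- by move=> a b e; rewrite mxHM !mulmxA.
Qed.

Lemma ZLR_inv y v w : n2 v = n2 w ->
  (\int[P]_x (fluc v (ZLR y x) ^+ 4)%:E = \int[P]_x (fluc w (ZLR y x) ^+ 4)%:E)%E.
Proof.
move=> vw; apply: (@fluc_law p (fun a b e => (a *m diagG b *m mxH e *m y) *m
   mxH (a *m diagG b *m mxH e *m y))) vw.
  have m : mxmeas (fun t : tripleT => t.1.1 *m diagG t.1.2 *m mxH t.2 *m y).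
    apply: mxmeasM; last exact: mxmeas_cst.
    apply: mxmeasM; last by apply: mxmeasH; exact: mxmeas_pr3.
    by apply: mxmeasM; [exact: mxmeas_pr1|exact: mxmeas_diagG].
  by apply: mxmeasM => //; exact: mxmeasH.
move=> U hU; exists (fun M => U *m M), id; split.
- exact: haar_left.
- exact: id_law.
- by move=> a b e; rewrite !mxHM !mulmxA.
Qed.

Lemma ae_frob_ZL : {ae P, forall x, frob (ZL x) <= p%:R * K ^+ 2}.
Proof.
by apply: filterS ae_unitary_L => x LL; apply: frob_conjdiag.
Qed.
Lemma ae_frob_ZR : {ae P, forall x, frob (ZR x) <= p%:R * K ^+ 2}.
Proof.
by apply: filterS ae_isom_Rm => x LL; apply: frob_conjdiag.
Qed.
Lemma ae_n2_xiLR v : {ae P, forall x, n2 (xiLR v x) <= K ^+ 2 * n2 v}.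
Proof.
apply: filterS2 ae_unitary_L ae_isom_Rm => x LL RR.
rewrite /xiLR -!mulmxA n2_isom //; apply: le_trans (n2_rdiag_le _ _) _ => //.
by rewrite ler_wpM2l ?sqr_ge0 // n2_isomH_le.
Qed.

End OneDimension.
End InvariantEnsembles.

Lemma cvg0_subM (R : realType) (u v : nat -> R) (k : R) :
  u @ \oo --> (0 : R) -> v @ \oo --> (0 : R) ->
  (fun n => (u n - v n) * k) @ \oo --> (0 : R).
Proof.
move=> hu hv.
suff h : ((u - v) \* cst k) @ \oo --> ((0 - 0) * k : R) by rewrite subrr mul0r in h.
apply: cvgM; first exact: cvgB.
exact: cvg_cst.
Qed.

(** * Complex sequences tending to 0 *)

Section SmallSequences.
Variable R : realType.
Local Notation C := R[i].
Local Notation Re := (@complex.Re R).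
Local Notation Im := (@complex.Im R).

Definition csmall (u : nat -> C) := (fun n => cabs (u n)) @ \oo --> (0 : R).

Lemma csmallP u : csmall u <-> forall e : R, 0 < e -> \forall n \near \oo, cabs (u n) < e.
Proof.
split=> [/cvgrPdist_lt h e e0|h].
  by apply: filterS (h e e0) => n; rewrite sub0r normrN ger0_norm ?cabs_ge0.
apply/cvgrPdist_lt => e e0; apply: filterS (h e e0) => n.
by rewrite sub0r normrN ger0_norm ?cabs_ge0.
Qed.

Lemma csmall_le (u : nat -> C) (e : nat -> R) :
  (\forall n \near \oo, cabs (u n) <= e n) -> e @ \oo --> (0 : R) -> csmall u.
Proof.
move=> h he; apply: (@squeeze_cvgr _ _ _ _ (fun=> 0) e) => //; last exact: cvg_cst.
by apply: filterS h => n ->; rewrite cabs_ge0.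
Qed.

Lemma csmallD u v : csmall u -> csmall v -> csmall (fun n => u n + v n).
Proof.
move=> hu hv; apply: (@csmall_le _ (fun n => cabs (u n) + cabs (v n))).
  by apply: nearW => n; exact: cabsD.
by rewrite -(addr0 0); exact: cvgD.
Qed.
Lemma csmallN u : csmall u -> csmall (fun n => - u n).
Proof. by rewrite /csmall; under [in X in _ -> X]eq_fun do rewrite cabsN. Qed.
Lemma csmallB u v : csmall u -> csmall v -> csmall (fun n => u n - v n).
Proof. by move=> hu hv; apply: csmallD => //; exact: csmallN. Qed.
Lemma csmallJ u : csmall u -> csmall (fun n => conjc (u n)).
Proof. by rewrite /csmall; under [in X in _ -> X]eq_fun do rewrite cabsJ. Qed.
Lemma csmall0 : csmall (fun=> 0).
Proof. by rewrite /csmall; under eq_fun do rewrite cabs0; exact: cvg_cst. Qed.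
Lemma csmall_sum (I : Type) (s : seq I) (Q : pred I) (F : I -> nat -> C) :
  (forall i, csmall (F i)) -> csmall (fun n => \sum_(i <- s | Q i) F i n).
Proof.
move=> h; elim: s => [|a s IH].
  by under eq_fun do rewrite big_nil; exact: csmall0.
under eq_fun do rewrite big_cons; case: (Q a) => //.
by apply: csmallD.
Qed.
Lemma csmallMbnd u v B : csmall u -> (\forall n \near \oo, cabs (v n) <= B) ->
  csmall (fun n => v n * u n).
Proof.
move=> hu hv; apply: (@csmall_le _ (fun n => B * cabs (u n))).
  by apply: filterS hv => n h; rewrite cabsM ler_wpM2r ?cabs_ge0.
by rewrite -(mulr0 B); apply: cvgM => //; exact: cvg_cst.
Qed.
Lemma csmall_near u v : (\forall n \near \oo, u n = v n) -> csmall u -> csmall v.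
Proof.
move=> h hu; apply: (@csmall_le _ (fun n => cabs (u n))) => //.
by apply: filterS h => n ->.
Qed.
Lemma csmall_cR (e : nat -> R) : e @ \oo --> (0 : R) -> csmall (fun n => cR (e n)).
Proof.
move=> h; apply: (@csmall_le _ (fun n => `|e n|)).
  by apply: nearW => n; rewrite cabs_cR.
by rewrite -(@normr0 _ R); apply: cvg_norm.
Qed.

Lemma csmall_ccvg0 u : csmall u -> ccvg u 0.
Proof.
move=> hu; split; apply: norm_cvg0; apply: (@squeeze_cvgr _ _ _ _ (fun=> 0) (fun n => cabs (u n))) => //;
  try exact: cvg_cst; apply: nearW => n; rewrite normr_ge0.
  exact: cabs_Re.
exact: cabs_Im.
Qed.

Lemma csmallReIm u : (fun n => Re (u n)) @ \oo --> (0 : R) ->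
  (fun n => Im (u n)) @ \oo --> (0 : R) -> csmall u.
Proof.
move=> h1 h2; apply: (@csmall_le _ (fun n => `|Re (u n)| + `|Im (u n)|)).
  by apply: nearW => n; exact: cabs_le.
by rewrite -(addr0 0) -(@normr0 _ R); apply: cvgD; exact: cvg_norm.
Qed.
End SmallSequences.

(** * From quadratic forms to bilinear forms *)

Section IsotropicLaw.
Variable R : realType.
Local Notation C := R[i].
Local Notation Re := (@complex.Re R).
Local Notation Im := (@complex.Im R).

(* [4 <b, E a> = \sum_{w^4 = 1} conj(w) <b + w a, E (b + w a)>], and the quadratic
   forms on the right are real when [E] is Hermitian. *)
Lemma polarization p (Z : 'M[C]_p) (a b : 'cV[C]_p) : mxH Z = Z ->
  dot b (Z *m a) - cR (Re (\tr Z) / p%:R) * dot b a =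
  (((fluc (b + a) Z - fluc (b - a) Z) / 4) +i*
   ((fluc (b - 'i%C *: a) Z - fluc (b + 'i%C *: a) Z) / 4))%C.
Proof.
move=> ZH; rewrite /fluc /n2.
have ba : dot a b = conjc (dot b a) by exact: dotC.
have Zba : dot a (Z *m b) = conjc (dot b (Z *m a)) by rewrite dotMr ZH dotC.
rewrite !(mulmxDr, mulmxBr, mulmxN) -!scalemxAr !(dotDl, dotBl, dotDr, dotBr, dotZl, dotZr).
rewrite !(dotNl, dotNr, dotZl, dotZr) ba Zba.
move: (dot b (Z *m a)) (dot b (Z *m b)) (dot a (Z *m a)) (dot b a) (dot b b)
  (dot a a) => [z1 z2] [x1 x2] [y1 y2] [v1 v2] [s1 s2] [t1 t2].
rewrite -!mulrA; move: (Re (\tr Z) / p%:R) => t.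
by apply: eqCP; rewrite /=; lra.
Qed.

Section Sequence.
Context d (T : measurableType d) (P : probability T R).

(** A Frobenius norm bounded by [p * K] turns the moment bound into one of order [p^-2], and [p]
    grows at least linearly in [n]. *)
Lemma ae_fluc_cvg0 (p : nat -> nat) (Z : forall n, T -> 'M[C]_(p n))
    (u : forall n, 'cV[C]_(p n)) (c0 K B : R) :
  0 < c0 -> (\forall n \near \oo, c0 * n.+1%:R <= (p n)%:R) ->
  (forall n, mxmeas (Z n)) ->
  (forall n (v w : 'cV[C]_(p n)), n2 v = n2 w ->
     \int[P]_x (fluc v (Z n x) ^+ 4)%:E = \int[P]_x (fluc w (Z n x) ^+ 4)%:E)%E ->
  (forall n, {ae P, forall x, frob (Z n x) <= (p n)%:R * K}) ->
  (\forall n \near \oo, n2 (u n) <= B) ->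
  {ae P, forall x, (fun n => fluc (u n) (Z n x)) @ \oo --> (0 : R)}.
Proof.
move=> c00 hp mZ inv hF hu.
apply: (@ae_cvg0_moment4 _ _ _ P _ (B ^+ 4 * (18 * K) ^+ 2 / c0 ^+ 2)).
  by move=> n; exact: measurable_fluc.
near=> n.
have hpn : c0 * n.+1%:R <= (p n)%:R by near: n.
have hun : n2 (u n) <= B by near: n.
have cn0 : 0 < c0 * n.+1%:R by rewrite mulr_gt0.
have pn0 : 0 < (p n)%:R :> R by apply: lt_le_trans hpn.
have I4 : (\int[P]_x (fluc (u n) (Z n x) ^+ 4)%:E <=
    ((n2 (u n) / (p n)%:R) ^+ 4 * (18 * ((p n)%:R * K)) ^+ 2)%:E)%E.
  move: (p n) (u n) (Z n) (mZ n) (inv n) (hF n) pn0 => [|m] v Y mY invY FY.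
    by rewrite ltxx.
  by move=> _; exact: integral_fluc4.
apply: le_trans I4 _; rewrite lee_fin.
have u0 := n2_ge0 (u n).
move: (n2 (u n)) ((p n)%:R : R) (n.+1%:R : R) hpn hun cn0 pn0 u0 (ltr0Sn R n) =>
  v m k hpn hun cn0 pn0 u0 k0.
have -> : (v / m) ^+ 4 * (18 * (m * K)) ^+ 2 = v ^+ 4 * (18 * K) ^+ 2 / m ^+ 2.
  by field; rewrite gt_eqF.
have -> : B ^+ 4 * (18 * K) ^+ 2 / c0 ^+ 2 / k ^+ 2 =
    B ^+ 4 * (18 * K) ^+ 2 / (c0 * k) ^+ 2.
  by field; rewrite !gt_eqF.
have vB : v ^+ 4 <= B ^+ 4 by rewrite ler_pXn2r ?nnegrE // (le_trans u0).
have mk : (m ^+ 2)^-1 <= ((c0 * k) ^+ 2)^-1.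
  by rewrite lef_pV2 ?posrE ?exprn_gt0 // ler_pXn2r ?nnegrE // ltW.
have a0 : 0 <= v ^+ 4 * (18 * K) ^+ 2 by rewrite mulr_ge0 ?sqr_ge0 // exprn_ge0.
have b0 : 0 <= (m ^+ 2)^-1 by rewrite invr_ge0 sqr_ge0.
have ab : v ^+ 4 * (18 * K) ^+ 2 <= B ^+ 4 * (18 * K) ^+ 2.
  by apply: ler_wpM2r => //; exact: sqr_ge0.
exact: (ler_pM a0 b0 ab mk).
Unshelve. all: by end_near. Qed.
End Sequence.
End IsotropicLaw.

(** * Stieltjes transforms on the real line *)

Section StieltjesTransform.
Variable R : realType.
Local Notation C := R[i].
Local Notation Re := (@complex.Re R).
Local Notation Im := (@complex.Im R).

Lemma measurable_invr : measurable_fun setT (fun t : R => t^-1).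
Proof.
have -> : [set: R] = [set x : R | x != 0] `|` [set 0].
  by apply/seteqP; split => x //= _; have [->|?] := eqVneq x 0; [right|left].
have o : open [set x : R | x != 0] by exact: open_neq.
apply/measurable_funU => //; first exact: open_measurable.
split; last exact: measurable_fun_set1.
apply: open_continuous_measurable_fun => // x; rewrite inE /= => x0.
exact: inv_continuous.
Qed.

Lemma measurable_comp_invr d (T : measurableType d) (f : T -> R) :
  measurable_fun setT f -> measurable_fun setT (fun t => (f t)^-1).
Proof. by move=> mf; apply: measurableT_comp => //; exact: measurable_invr. Qed.

Lemma Re_inv (z : C) : Re z^-1 = Re z / (Re z ^+ 2 + Im z ^+ 2).
Proof. by case: z. Qed.

(** The real part of [1 / (- s - i e)] against its value at [e = 0], uniformly for [s >= del]. It
    brings limits known in the upper half-plane down to the real axis. *)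
Lemma Re_inv_approx (s e del : R) : 0 < del -> del <= s ->
  `|- s / (s ^+ 2 + e ^+ 2) - (- s)^-1| <= e ^+ 2 / del ^+ 3.
Proof.
move=> d0 ds; have s0 : 0 < s by apply: lt_le_trans ds.
have se : 0 < s ^+ 2 + e ^+ 2 by rewrite ltr_wpDr ?sqr_ge0 ?exprn_gt0.
have -> : - s / (s ^+ 2 + e ^+ 2) - (- s)^-1 = e ^+ 2 / (s * (s ^+ 2 + e ^+ 2)).
  by field; rewrite !gt_eqF // oppr_eq0 gt_eqF.
rewrite ger0_norm; last by rewrite divr_ge0 ?sqr_ge0 // mulr_ge0 ?ltW.
apply: ler_wpM2l; first exact: sqr_ge0.
rewrite lef_pV2 ?posrE ?exprn_gt0 ?mulr_gt0 //.
have h2 : del ^+ 2 <= s ^+ 2 by nra.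
have h1 := sqr_ge0 e; have h3 := sqr_ge0 del; rewrite exprS.
by apply: ler_pM => //; [exact: ltW|lra].
Qed.

Variables (pi : probability R R) (lm lp : R).
Hypotheses (lmp : lm <= lp) (supp : pi (~` `[lm, lp]) = 0%E).
Let D : set R := `[lm, lp]%classic.

Lemma measurable_supp : measurable D. Proof. exact: measurable_itv. Qed.

Lemma prob_supp : pi D = 1%E.
Proof.
have := probability_setC pi (measurableC measurable_supp).
by rewrite setCK supp sube0.
Qed.

Lemma Rintegral_supp (f : R -> R) : measurable_fun setT f ->
  Rintegral pi setT f = Rintegral pi D f.
Proof.
move=> mf; rewrite /Rintegral; congr fine.
rewrite [RHS]integral_mkcond; apply: ae_eq_integral => //.
- exact/measurable_EFinP.
- apply/(measurable_restrictT _ measurable_supp); apply: measurable_funTS.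
  exact/measurable_EFinP.
exists (~` D); split => //; first exact: measurableC measurable_supp.
move=> x /= h Dx; apply: h => _; rewrite patchE ifT //.
by rewrite inE.
Qed.

Lemma integrable_supp (f : R -> R) (K : R) : measurable_fun setT f ->
  (forall t, D t -> `|f t| <= K) -> pi.-integrable D (EFin \o f).
Proof.
move=> mf hf; apply: measurable_bounded_integrable.
- exact: measurable_supp.
- exact: le_lt_trans (probability_le1 pi measurable_supp) (ltry _).
- exact: measurable_funTS.
exists K; split; first exact: num_real.
by move=> y Ky t Dt; apply: le_trans (hf t Dt) (ltW Ky).
Qed.

Lemma Rintegral_supp_cst (k : R) : Rintegral pi D (fun=> k) = k.
Proof.
rewrite Rintegral_cst; last exact: measurable_supp.
have e : fine (pi D) = 1 by rewrite prob_supp.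
by rewrite -[RHS]mulr1; congr (k * _); exact: e.
Qed.

Lemma Rintegral_close (f g : R -> R) (K e : R) : measurable_fun setT f -> measurable_fun setT g ->
  (forall t, D t -> `|f t| <= K) -> (forall t, D t -> `|g t| <= K) ->
  (forall t, D t -> `|f t - g t| <= e) ->
  `|Rintegral pi D f - Rintegral pi D g| <= e.
Proof.
move=> mf mg hf hg fg.
have i_f := integrable_supp mf hf; have i_g := integrable_supp mg hg.
have mfg : measurable_fun setT (fun t => f t - g t) by exact: measurable_funB.
have i_fg := integrable_supp mfg fg.
have mD := measurable_supp.
rewrite -RintegralB //; apply: le_trans (le_normr_Rintegral _ _) _ => //.
rewrite -[leRHS]Rintegral_supp_cst; apply: le_Rintegral => //.
  apply: (@integrable_supp _ e); first exact: measurableT_comp.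
  by move=> t Dt; rewrite normr_id fg.
exact: (@integrable_supp _ `|e|).
Qed.

Lemma inv_supp_le x t : lp < x -> D t -> `|(t - x)^-1| <= (x - lp)^-1.
Proof.
move=> lx; rewrite /D /= in_itv /= => /andP[_ tl].
rewrite normfV distrC ger0_norm; last by rewrite subr_ge0; lra.
by rewrite lef_pV2 ?posrE; lra.
Qed.

Lemma measurable_invB x : measurable_fun setT (fun t : R => (t - x)^-1).
Proof. by apply: measurable_comp_invr; exact: measurable_funB. Qed.

Lemma stieltjesRE x : stieltjesR pi x = Rintegral pi D (fun t : R => (t - x)^-1).
Proof. by apply: Rintegral_supp; exact: measurable_invB. Qed.

Lemma stieltjesR_lt0 x : lp < x -> stieltjesR pi x < 0.
Proof.
move=> lx; rewrite stieltjesRE.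
apply: (@le_lt_trans _ _ (- (x - lm)^-1)); last first.
  by rewrite oppr_lt0 invr_gt0; have := lmp; lra.
rewrite -[leRHS]Rintegral_supp_cst; apply: le_Rintegral.
- exact: measurable_supp.
- by apply: integrable_supp (fun t => inv_supp_le lx); exact: measurable_invB.
- exact: (@integrable_supp _ `|- (x - lm)^-1|).
move=> t; rewrite /D /= in_itv /= => /andP[lt tl].
by rewrite -[t - x]opprB invrN lerN2 lef_pV2 ?posrE; lra.
Qed.

Lemma stieltjes_approx x e : lp < x ->
  `|Re (stieltjes pi (x +i* e)%C) - stieltjesR pi x| <= e ^+ 2 / (x - lp) ^+ 3.
Proof.
move=> lx; rewrite /stieltjes /= stieltjesRE.
have E t : Re ((cR t - (x +i* e)%C)^-1) = - (x - t) / ((x - t) ^+ 2 + e ^+ 2).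
  by rewrite Re_inv /= add0r opprB sqrrN -[t - x]opprB sqrrN.
have -> : (fun t => Re ((cR t - (x +i* e)%C)^-1)) =
          (fun t : R => - (x - t) / ((x - t) ^+ 2 + e ^+ 2)) by apply/funext => t.
have mq : measurable_fun setT (fun t : R => - (x - t) / ((x - t) ^+ 2 + e ^+ 2)).
  have mB : measurable_fun setT (fun t : R => x - t) by exact: measurable_funB.
  apply: measurable_funM; first exact: measurable_funN.
  apply: measurable_comp_invr; apply: measurable_funD => //.
  exact: measurable_funX.
rewrite Rintegral_supp //.
have close t : D t -> `|- (x - t) / ((x - t) ^+ 2 + e ^+ 2) - (t - x)^-1| <=
   e ^+ 2 / (x - lp) ^+ 3.
  rewrite /D /= in_itv /= => /andP[lt tl].
  by rewrite -[t - x]opprB; apply: Re_inv_approx; lra.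
apply: (@Rintegral_close _ _ ((x - lp)^-1 + e ^+ 2 / (x - lp) ^+ 3)) => //.
- exact: measurable_invB.
- move=> t Dt; rewrite -[X in `|X|](subrK ((t - x)^-1)).
  apply: le_trans (ler_normD _ _) _; rewrite addrC lerD ?close //.
  exact: inv_supp_le.
- move=> t Dt; apply: le_trans (inv_supp_le lx Dt) _.
  by rewrite lerDl divr_ge0 ?sqr_ge0 // exprn_ge0 // subr_ge0 ltW.
Qed.

Definition stieltjes2 x := Rintegral pi D (fun t : R => (t - x)^-1 ^+ 2).

Lemma measurable_invB2 x : measurable_fun setT (fun t : R => (t - x)^-1 ^+ 2).
Proof. by apply: measurable_funX; exact: measurable_invB. Qed.

Lemma inv2_supp_le x t : lp < x -> D t -> `|(t - x)^-1 ^+ 2| <= (x - lp)^-1 ^+ 2.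
Proof.
move=> lx Dt; rewrite normrX ler_pXn2r ?nnegrE ?inv_supp_le //.
by rewrite invr_ge0; lra.
Qed.

(** A second-order expansion integrated from the exact identity [1/(t-y) - 1/(t-x) - (y-x)/(t-x)^2 =
    (y-x)^2 / ((t-x)^2 (t-y))]; it takes the place of differentiation under the integral. *)
Lemma stieltjes_diff x y : lp < x -> lp < y ->
  `|stieltjesR pi y - stieltjesR pi x - (y - x) * stieltjes2 x| <=
  (y - x) ^+ 2 * ((x - lp)^-1 ^+ 2 * (y - lp)^-1).
Proof.
move=> lx ly; rewrite !stieltjesRE /stieltjes2.
have mD := measurable_supp.
have mx := measurable_invB x; have my := measurable_invB y.
have mx2 := measurable_invB2 x.
have ix := integrable_supp mx (fun t => inv_supp_le lx).
have iy := integrable_supp my (fun t => inv_supp_le ly).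
have ix2 := integrable_supp mx2 (fun t => inv2_supp_le lx).
have mz : measurable_fun setT (fun t : R => (y - x) * (t - x)^-1 ^+ 2).
  exact: measurable_funM.
have iz : pi.-integrable D (EFin \o (fun t : R => (y - x) * (t - x)^-1 ^+ 2)).
  apply: (@integrable_supp _ (`|y - x| * (x - lp)^-1 ^+ 2)) => // t Dt.
  by rewrite normrM ler_wpM2l // inv2_supp_le.
have ixy : pi.-integrable D (EFin \o (fun t : R => (t - y)^-1 - (t - x)^-1)).
  apply: (@integrable_supp _ ((y - lp)^-1 + (x - lp)^-1)).
    exact: measurable_funB.
  move=> t Dt; apply: le_trans (ler_normB _ _) _.
  by rewrite lerD // inv_supp_le.
rewrite -RintegralZl // -RintegralB // -RintegralB //.
pose K := (y - lp)^-1 + (x - lp)^-1 + `|y - x| * (x - lp)^-1 ^+ 2.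
have K1 : 0 <= (y - lp)^-1 by rewrite invr_ge0; lra.
have K2 : 0 <= (x - lp)^-1 by rewrite invr_ge0; lra.
have K3 : 0 <= `|y - x| * (x - lp)^-1 ^+ 2 by rewrite mulr_ge0 ?sqr_ge0.
rewrite -[X in `|X|]subr0 -[X in `|_ - X|]Rintegral_supp_cst.
apply: (@Rintegral_close _ _ K) => //.
- by apply: measurable_funB => //; exact: measurable_funB.
- move=> t Dt; apply: le_trans (ler_normB _ _) _.
  have : `|(y - x) * (t - x)^-1 ^+ 2| <= `|y - x| * (x - lp)^-1 ^+ 2.
    by rewrite normrM ler_wpM2l // inv2_supp_le.
  have := ler_normB ((t - y)^-1) ((t - x)^-1).
  have := inv_supp_le lx Dt; have := inv_supp_le ly Dt; rewrite /K; lra.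
- by move=> t Dt; rewrite normr0; apply: addr_ge0 => //; exact: addr_ge0.
move=> t Dt; rewrite subr0.
have e : (t - y)^-1 - (t - x)^-1 - (y - x) * (t - x)^-1 ^+ 2 =
         (y - x) ^+ 2 * ((t - x)^-1 ^+ 2 * (t - y)^-1).
  move: Dt; rewrite /D /= in_itv /= => /andP[_ tl].
  by field; rewrite !subr_eq0 !lt_eqF //; lra.
rewrite e normrM (ger0_norm (sqr_ge0 _)) ler_wpM2l ?sqr_ge0 // normrM.
by apply: ler_pM => //; [exact: inv2_supp_le|exact: inv_supp_le].
Qed.

(** The variance of [1 / (t - x)] under [pi] is nonnegative: integrate [2 m u - m^2 <= u^2] at
    [u = 1 / (t - x)]. *)
Lemma stieltjes2_ge x : lp < x -> stieltjesR pi x ^+ 2 <= stieltjes2 x.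
Proof.
move=> lx; set m := stieltjesR pi x.
have mD := measurable_supp.
have ix := integrable_supp (measurable_invB x) (fun t => inv_supp_le lx).
have ix2 := integrable_supp (measurable_invB2 x) (fun t => inv2_supp_le lx).
have iz : pi.-integrable D (EFin \o (fun t : R => 2 * m * (t - x)^-1)).
  apply: (@integrable_supp _ (`|2 * m| * (x - lp)^-1)).
    by apply: measurable_funM => //; exact: measurable_invB.
  by move=> t Dt; rewrite normrM ler_wpM2l // inv_supp_le.
have ic : pi.-integrable D (EFin \o (fun=> m ^+ 2)) by exact: (@integrable_supp _ `|m ^+ 2|).
have : Rintegral pi D (fun t : R => 2 * m * (t - x)^-1 - m ^+ 2) <= stieltjes2 x.
  apply: le_Rintegral => //.
    apply: (@integrable_supp _ (`|2 * m| * (x - lp)^-1 + `|m ^+ 2|)).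
      apply: measurable_funB => //; apply: measurable_funM => //.
      exact: measurable_invB.
    move=> t Dt; apply: le_trans (ler_normB _ _) _; rewrite lerD // normrM.
    by rewrite ler_wpM2l // inv_supp_le.
  by move=> t Dt; have := sqr_ge0 ((t - x)^-1 - m); lra.
rewrite RintegralB // RintegralZl // -stieltjesRE -/m Rintegral_supp_cst; lra.
Qed.

Lemma stieltjesR_derive x : lp < x -> is_derive x 1 (stieltjesR pi) (stieltjes2 x).
Proof.
move=> lx.
have cv : h^-1 *: (stieltjesR pi (h *: 1 + x) - stieltjesR pi x) @[h --> 0^'] -->
    (stieltjes2 x : R).
  pose K := (x - lp)^-1 ^+ 2 * (2 / (x - lp)).
  have xl : 0 < x - lp by lra.
  have K0 : 0 <= K by rewrite /K !mulr_ge0 ?sqr_ge0 ?invr_ge0 ?ltW.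
  apply/cvgrPdist_le => e e0.
  have m0 : 0 < Num.min ((x - lp) / 2) (e / (K + 1)).
    by rewrite lt_min !divr_gt0 // ltr_wpDl.
  (* The first bound on [h] keeps [x + h] at distance at least [(x - lp) / 2] from [lp], so that [K]
     bounds the remainder; the second makes [|h| K] at most [e]. *)
  near=> h; have h0 : h != 0 by near: h; exact: nbhs_dnbhs_neq.
  have : `|h| < Num.min ((x - lp) / 2) (e / (K + 1)).
    by near: h; exact: dnbhs0_lt.
  rewrite lt_min => /andP[h1 h2].
  have hx : h *: 1 + x = x + h by rewrite /GRing.scale /= mulr1 addrC.
  have ly : (x - lp) / 2 < x + h - lp by move: h1; rewrite ltr_norml => /andP[]; lra.
  have ly' : lp < x + h by lra.
  have := stieltjes_diff lx ly'; rewrite hx (_ : x + h - x = h) => [hd|]; last by ring.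
  rewrite distrC.
  have -> : h^-1 *: (stieltjesR pi (x + h) - stieltjesR pi x) - stieltjes2 x =
     h^-1 * (stieltjesR pi (x + h) - stieltjesR pi x - h * stieltjes2 x).
    by rewrite /GRing.scale /=; field.
  have nh0 : 0 < `|h| by rewrite normr_gt0.
  rewrite normrM normfV mulrC ler_pdivrMr //; apply: le_trans hd _.
  have iy : (x + h - lp)^-1 <= 2 / (x - lp).
    by rewrite -[2 / _]invrK invf_div lef_pV2 ?posrE //; lra.
  apply: (@le_trans _ _ (h ^+ 2 * K)).
    by apply: ler_wpM2l; [exact: sqr_ge0|apply: ler_wpM2l => //; exact: sqr_ge0].
  rewrite -real_normK ?num_real // expr2 -mulrA mulrC ler_wpM2r //.
  rewrite ltr_pdivlMr in h2; last by rewrite ltr_wpDl.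
  by have := normr_ge0 h; nra.
split; first exact: cvgP cv.
exact: cvg_lim cv.
Unshelve. all: by end_near. Qed.

Variable c : R.
Hypothesis (c01 : 0 < c <= 1).

Definition wfun x := c * x * stieltjesR pi x - (1 - c).

Lemma wfunE x : x != 0 -> x * mtilde pi c x = wfun x.
Proof. by move=> x0; rewrite /mtilde /wfun; field. Qed.

Lemma gfunE x : x != 0 -> gfun pi c x = stieltjesR pi x * wfun x.
Proof. by move=> x0; rewrite -wfunE // /gfun; ring. Qed.

Lemma wfun_lt0 x : 0 < x -> lp < x -> wfun x < 0.
Proof.
move=> x0 lx; have m0 := stieltjesR_lt0 lx; rewrite /wfun.
have /andP[c0 c1] := c01.
have : 0 < c * x * - stieltjesR pi x by rewrite !mulr_gt0 // oppr_gt0.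
lra.
Qed.

Lemma gfun_derive (x : R) : 0 < x -> lp < x ->
  is_derive x 1 (gfun pi c)
    (stieltjes2 x * wfun x + stieltjesR pi x * (c * stieltjesR pi x + c * x * stieltjes2 x)).
Proof.
move=> x0 lx.
have dm := stieltjesR_derive lx.
have dc : is_derive x 1 (fun y : R => c * y) c.
  by apply: is_derive_eq; rewrite /GRing.scale /=; ring.
have dw : is_derive x 1 wfun (c * stieltjesR pi x + c * x * stieltjes2 x).
  have -> : wfun = (fun y : R => c * y) * stieltjesR pi - cst (1 - c).
    by apply/funext => y; rewrite /wfun.
  apply: is_derive_eq; rewrite /GRing.scale /=; ring.
have dg : is_derive x 1 (stieltjesR pi * wfun)
    (stieltjes2 x * wfun x + stieltjesR pi x * (c * stieltjesR pi x + c * x * stieltjes2 x)).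
  by apply: is_derive_eq; rewrite /GRing.scale /=; ring.
apply: near_eq_is_derive dg.
near=> y; rewrite gfunE //.
have y0 : 0 < y by near: y; exact: lt_nbhsr.
by rewrite gt_eqF.
Unshelve. all: by end_near. Qed.

(* Writing [phi = - m > 0], [g = c x phi^2 + (1 - c) phi] with [phi' <= - phi^2], so
   [g' <= c phi^2 (1 - 2 x phi) <= - c phi^2]. *)
Lemma gfun_derive_lt0 (x : R) : 0 < x -> lp < x -> x * stieltjesR pi x <= -1 ->
  derivable (gfun pi c) x 1 /\ derive1 (gfun pi c) x < 0.
Proof.
move=> x0 lx xm; have dg := gfun_derive x0 lx.
split; first exact: ex_derive.
rewrite derive1E derive_val /wfun.
have m0 := stieltjesR_lt0 lx; have m2 := stieltjes2_ge lx.
have /andP[c0 c1] := c01.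
move: (stieltjesR pi x) (stieltjes2 x) xm m0 m2 => m k xm m0 mk.
have -> : k * (c * x * m - (1 - c)) + m * (c * m + c * x * k) =
  c * (m ^+ 2 + 2 * (x * m) * k) - (1 - c) * k by ring.
have mm : 0 < m ^+ 2 by rewrite exprn_even_gt0 //= lt_eqF.
have h1 : m ^+ 2 + 2 * (x * m) * k < 0 by nra.
have h2 : 0 <= (1 - c) * k by nra.
nra.
Qed.

Lemma stieltjesR_continuous (x : R) : lp < x -> {for x, continuous (stieltjesR pi)}.
Proof.
move=> lx; apply: differentiable_continuous; apply/derivable1_diffP.
exact: (@ex_derive _ _ _ _ _ _ _ (stieltjesR_derive lx)).
Qed.

End StieltjesTransform.

(** * Algebra of the resolvent *)

Section SampleAlgebra.
Variable R : realType.
Local Notation C := R[i].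
Local Notation Re := (@complex.Re R).
Local Notation Im := (@complex.Im R).

(** It shows that the set whose supremum defines [opnorm] is bounded, without which the supremum
    would be a mere default value. *)
Lemma n2_mul_le p q (A : 'M[C]_(p, q)) (v : 'cV[C]_q) : n2 (A *m v) <= frob A * n2 v.
Proof.
rewrite [n2 (A *m v)]n2E /frob mulr_suml; apply: ler_sum => k _.
have -> : (A *m v) k 0 = dot (mxH (row k A)) v.
  by rewrite /dot mxHK mxE [RHS]mxE; apply: eq_bigr => l _; rewrite mxE.
have cs := cauchy_schwarz (mxH (row k A)) v.
apply: (@le_trans _ _ ((vnorm (mxH (row k A)) * vnorm v) ^+ 2)).
  by rewrite ler_pXn2r ?nnegrE ?cabs_ge0 ?mulr_ge0 ?vnorm_ge0.
rewrite exprMn !sqr_vnorm.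
rewrite n2E le_eqVlt; apply/orP; left; apply/eqP; congr (_ * _).
by apply: eq_bigr => l _; rewrite mxHE cabsJ mxE.
Qed.

Lemma opnorm_ge p q (A : 'M[C]_(p, q)) (v : 'cV[C]_q) : n2 v = 1 ->
  vnorm (A *m v) <= opnorm A.
Proof.
move=> v1; apply: ub_le_sup; last by exists v => //=; rewrite vnormE v1 sqrtr1.
exists (Num.sqrt (frob A)) => _ [w /= w1 <-]; rewrite vnormE.
apply: ler_wsqrtr; apply: le_trans (n2_mul_le _ _) _.
by rewrite -sqr_vnorm w1 expr1n mulr1.
Qed.

Section SVD.
Variables (p q : nat) (L : 'M[C]_p) (Rm : 'M[C]_(q, p)) (ga : 'I_p -> R).
Hypotheses (LL : mxH L *m L = 1%:M) (RR : mxH Rm *m Rm = 1%:M).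
Let X := L *m rdiag ga *m mxH Rm.

Lemma LLH : L *m mxH L = 1%:M. Proof. exact: mulmx1C. Qed.

Lemma XXHE : X *m mxH X = conjdiag L (fun k => ga k ^+ 2).
Proof.
rewrite /X /conjdiag !mxHM mxHK mxH_rdiag -!mulmxA (mulmxA (mxH Rm)) RR mul1mx.
by rewrite (mulmxA (rdiag ga)) rdiagM.
Qed.

(** Tested at the eigenvector [L e_k] of [X X^*]. *)
Lemma opnorm_ge_gam k : ga k ^+ 2 <= opnorm (X *m mxH X).
Proof.
have e1 : n2 (delta_mx k 0 : 'cV[C]_p) = 1.
  rewrite n2E (bigD1 k) //= big1 => [|l lk].
    by rewrite mxE !eqxx /= addr0 sqr_cabs /= expr1n expr0n addr0.
  by rewrite mxE (negbTE lk) /= cabs0 expr0n.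
have e : n2 (L *m delta_mx k 0) = 1 by rewrite n2_isom.
apply: le_trans (opnorm_ge (X *m mxH X) e).
rewrite XXHE /conjdiag -!mulmxA (mulmxA (mxH L)) LL mul1mx vnormE n2_isom //.
have -> : rdiag (fun k => ga k ^+ 2) *m (delta_mx k 0 : 'cV[C]_p) =
    cR (ga k ^+ 2) *: delta_mx k 0.
  by apply/colP => l; rewrite rdiag_mulE !mxE; case: eqVneq => [->|] //=; rewrite !mulr0.
by rewrite n2Z e1 mulr1 sqrtr_sqr cabs_cR normr_id ger0_norm // sqr_ge0.
Qed.

Lemma tr_resolvent z : Im z != 0 ->
  \tr (invmx (X *m mxH X - z%:M)) = \sum_k (cR (ga k ^+ 2) - z)^-1.
Proof.
move=> z0; pose dz (u : C -> C) := diag_mx (\row_k u (cR (ga k ^+ 2) - z)).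
have e : X *m mxH X - z%:M = L *m dz id *m mxH L.
  have -> : dz id = rdiag (fun k => ga k ^+ 2) - z%:M.
    apply/matrixP => k l; rewrite !mxE; case: eqVneq => _ /=.
      by rewrite !mulr1n.
    by rewrite !mulr0n subr0.
  by rewrite XXHE mulmxBr mulmxBl mul_mx_scalar -scalemxAl LLH scalemx1.
have nz k : cR (ga k ^+ 2) - z != 0.
  apply: contra z0 => /eqP h; rewrite (_ : Im z = - Im (cR (ga k ^+ 2) - z)).
    by rewrite h oppr0.
  by rewrite ImD ImN /= add0r opprK.
have dd : dz id *m dz GRing.inv = 1%:M.
  rewrite /dz mulmx_diag -diag_const_mx; congr diag_mx; apply/rowP => k.
  by rewrite !mxE mulfV.
have inv : (X *m mxH X - z%:M) *m (L *m dz GRing.inv *m mxH L) = 1%:M.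
  rewrite e -!mulmxA (mulmxA (mxH L)) LL mul1mx (mulmxA (dz id)) dd mul1mx.
  exact: LLH.
have u : X *m mxH X - z%:M \in unitmx by have [] := mulmx1_unit inv.
have -> : invmx (X *m mxH X - z%:M) = L *m dz GRing.inv *m mxH L.
  by rewrite -[LHS]mulmx1 -inv mulKmx.
rewrite mxtrace_mulC mulmxA LL mul1mx mxtrace_diag.
by apply: eq_bigr => k _; rewrite mxE.
Qed.

Variable x : R.
(** Defined through the eigenvalues, hence total and Hermitian for every outcome. It inverts
    [X X^* - x] only where no [ga k ^ 2] equals [x], which holds for large [n]. *)
Definition Qres := conjdiag L (fun k => (ga k ^+ 2 - x)^-1).

Lemma QresH : mxH Qres = Qres. Proof. exact: conjdiagH. Qed.

Lemma Qres_inv : (forall k, ga k ^+ 2 != x) -> (X *m mxH X - (cR x)%:M) *m Qres = 1%:M.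
Proof.
move=> gx; have -> : X *m mxH X - (cR x)%:M = conjdiag L (fun k => ga k ^+ 2 - x).
  have -> : (cR x)%:M = conjdiag L (fun=> x).
    by rewrite /conjdiag rdiag_cst mul_mx_scalar -scalemxAl LLH scalemx1.
  by rewrite XXHE /conjdiag -mulmxBl -mulmxBr rdiagB.
rewrite /Qres /conjdiag -!mulmxA (mulmxA (mxH L)) LL mul1mx (mulmxA (rdiag _)) rdiagM.
rewrite (_ : rdiag _ = 1%:M) ?mul1mx ?LLH //.
rewrite -[1%:M]/((cR 1)%:M) -rdiag_cst; congr rdiag; apply/funext => k.
by rewrite mulfV // subr_eq0.
Qed.

Lemma QresX : Qres *m X = L *m rdiag (fun k => ga k / (ga k ^+ 2 - x)) *m mxH Rm.
Proof.
rewrite /Qres /X /conjdiag -!mulmxA (mulmxA (mxH L)) LL mul1mx (mulmxA (rdiag _)) rdiagM.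
by congr (_ *m (_ *m _)); congr rdiag; apply/funext => k; rewrite mulrC.
Qed.

Lemma XQresX : mxH X *m Qres *m X = conjdiag Rm (fun k => ga k ^+ 2 / (ga k ^+ 2 - x)).
Proof.
rewrite -mulmxA QresX /X /conjdiag !mxHM mxHK mxH_rdiag -!mulmxA (mulmxA (mxH L)) LL.
rewrite mul1mx (mulmxA (rdiag _)) rdiagM; congr (_ *m (_ *m _)); congr rdiag.
by apply/funext => k; rewrite mulrA.
Qed.
End SVD.
End SampleAlgebra.

Lemma cvg_subC0 (R : realType) (u : nat -> R) (l : R) :
  u @ \oo --> l -> (fun n => u n - l) @ \oo --> (0 : R).
Proof.
move=> hu; suff h : (u - cst l) @ \oo --> (l - l : R) by rewrite subrr in h.
by apply: cvgB => //; exact: cvg_cst.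
Qed.

(** Deterministic facts, such as the signs of [lp] and of [x m(x) + 1], are read off from the limits
    at one good outcome. *)
Lemma ae_ex (R : realType) d (T : measurableType d) (P : probability T R) (A : T -> Prop) :
  {ae P, forall x, A x} -> exists x, A x.
Proof.
move=> [B [mB PB AB]]; apply: contrapT => /forallNP h.
have BT : B = setT by apply/seteqP; split => // x _; exact: AB (h x).
by have := probability_setT P; rewrite -BT PB => /eqP; rewrite eq_sym onee_eq0.
Qed.

(** * Isotropic convergence *)

Section IsotropicConvergence.
Variable R : realType.
Local Notation C := R[i].
Local Notation Re := (@complex.Re R).
Local Notation Im := (@complex.Im R).
Variables (d : measure_display) (T : measurableType d) (P : probability T R).
Variables (N : nat -> nat) (c : R).
Hypotheses (HN : forall n, (N n <= n)%N) (Hc : 0 < c <= 1)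
  (HNc : (fun n => (N n)%:R / n%:R : R) @ \oo --> c).
Variables (L Gam : forall n, T -> 'M[C]_(N n)) (W : forall n, T -> 'M[C]_n)
  (f : forall n, 'I_(N n) -> 'I_n).
Arguments f : clear implicits.
Hypotheses (Hf : forall n, injective (f n))
  (HL : forall n, haar_unitary P (L n)) (HW : forall n, haar_unitary P (W n))
  (HGm : forall n, rmx_measurable (Gam n))
  (HGdiag : forall n x (k l : 'I_(N n)), k != l -> Gam n x k l = 0)
  (HGnn : forall n x (k : 'I_(N n)), 0 <= Gam n x k k)
  (Hind : forall n, indep3 P (L n) (Gam n) (fun x => colsub (f n) (W n x))).

Let ga n x := gam (Gam n) x.
Arguments ga : clear implicits.
Let Rm n x := colsub (f n) (W n x).
Let X n x := Xmat (L n x) (Gam n x) (Rm n x).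
Let Q (x0 : R) n x := Qres (L n x) (ga n x) x0.

Lemma dim_linear : exists2 c0 : R, 0 < c0 & \forall n \near \oo, c0 * n.+1%:R <= (N n)%:R.
Proof.
(* Eventually [N / n > c / 2], and [n.+1 <= 2 n] costs a second factor 2. *)
have /andP[c0 _] := Hc; exists (c / 4); first lra.
have c2 : 0 < c / 2 by lra.
move/cvgrPdist_lt : HNc => /(_ _ c2) h; near=> n.
have : `|c - (N n)%:R / n%:R| < c / 2 by near: n.
have n1 : (0 < n)%N by near: n; exact: nbhs_infty_gt.
have n1' : 1 <= n%:R :> R by rewrite ler1n.
rewrite ltr_norml => /andP[_ hn].
have : c / 2 < (N n)%:R / n%:R by lra.
rewrite ltr_pdivlMr ?(lt_le_trans _ n1') // => h2.
have : 0 <= c * (n%:R - 1) by rewrite mulr_ge0 ?subr_ge0 // ltW.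
have -> : n.+1%:R = n%:R + 1 :> R by rewrite natr1.
lra.
Unshelve. all: by end_near. Qed.

Lemma dim_gt0 : \forall n \near \oo, (0 < N n)%N.
Proof.
have [c0 c00 h] := dim_linear; apply: filterS h => n hn.
by rewrite -(ltr0n R); apply: lt_le_trans hn; rewrite mulr_gt0.
Qed.

Lemma gam_ge0 n x k : 0 <= ga n x k.
Proof. by have := HGnn x k; rewrite lecE /ga /gam => /andP[_]. Qed.

Lemma Gam_rdiag n x : Gam n x = rdiag (ga n x).
Proof.
apply/matrixP => k l; rewrite !mxE; case: eqVneq => [<-|kl] /=; last exact: HGdiag.
rewrite mulr1n; apply: eqCP => //=; exact: ger0_Im.
Qed.

Lemma XE n x : X n x = L n x *m rdiag (ga n x) *m mxH (Rm n x).
Proof. by rewrite /X /Xmat Gam_rdiag. Qed.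

Lemma ae_isom : {ae P, forall x, forall n,
  mxH (L n x) *m L n x = 1%:M /\ mxH (Rm n x) *m Rm n x = 1%:M}.
Proof.
apply: ae_foralln => n; apply: filterS2 (ae_unitary_L (HL n)) (ae_isom_Rm (@Hf n) (HW n)).
by move=> x.
Qed.

Section Bilinear.
Variables (h : R -> R) (K : R).
Hypotheses (mh : measurable_fun setT h) (hK : forall t, `|h t| <= K).

Lemma ae_bilinear (p : nat -> nat) (Z : forall n, T -> 'M[C]_(p n)) (c0 K' B : R)
    (a b : forall n, 'cV[C]_(p n)) :
  0 < c0 -> (\forall n \near \oo, c0 * n.+1%:R <= (p n)%:R) ->
  (forall n, mxmeas (Z n)) ->
  (forall n (v w : 'cV[C]_(p n)), n2 v = n2 w ->
     \int[P]_x (fluc v (Z n x) ^+ 4)%:E = \int[P]_x (fluc w (Z n x) ^+ 4)%:E)%E ->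
  (forall n, {ae P, forall x, frob (Z n x) <= (p n)%:R * K'}) ->
  (forall n x, mxH (Z n x) = Z n x) ->
  (\forall n \near \oo, n2 (a n) <= B) -> (\forall n \near \oo, n2 (b n) <= B) ->
  {ae P, forall x, csmall (fun n => dot (b n) (Z n x *m a n) -
     cR (Re (\tr (Z n x)) / (p n)%:R) * dot (b n) (a n))}.
Proof.
move=> c00 hp mZ inv hF ZH ha hb.
have bnd (v w : forall n, 'cV[C]_(p n)) : (\forall n \near \oo, n2 (v n) <= B) ->
    (\forall n \near \oo, n2 (w n) <= B) -> \forall n \near \oo, n2 (v n + w n) <= 4 * B.
  move=> hv hw; apply: filterS2 hv hw => n h1 h2.
  by apply: le_trans (n2D_le _ _) _; lra.
have bZ (z : C) : cabs z = 1 -> \forall n \near \oo, n2 (z *: a n) <= B.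
  by move=> z1; apply: filterS ha => n; rewrite n2Z z1 expr1n mul1r.
have i1 : cabs ('i%C : C) = 1 by rewrite /cabs /= expr0n expr1n add0r sqrtr1.
have Nn (v : forall n, 'cV[C]_(p n)) : (\forall n \near \oo, n2 (v n) <= B) ->
   \forall n \near \oo, n2 (- v n) <= B by apply: filterS => n; rewrite n2N.
have H u := @ae_fluc_cvg0 _ _ _ P p Z u c0 K' (4 * B) c00 hp mZ inv hF.
have f1 := H _ (bnd _ _ hb ha); have f2 := H _ (bnd _ _ hb (Nn _ ha)).
have f3 := H _ (bnd _ _ hb (bZ _ i1)); have f4 := H _ (bnd _ _ hb (Nn _ (bZ _ i1))).
apply: filterS2 (filterI f1 f2) (filterI f3 f4) => x [g1 g2] [g3 g4].
have e n := polarization (a n) (b n) (ZH n x).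
under eq_fun do rewrite e.
apply: csmallReIm; first exact: (cvg0_subM 4^-1 g1 g2).
exact: (cvg0_subM 4^-1 g4 g3).
Qed.

Lemma ae_ZL (a b : forall n, 'cV[C]_(N n)) B :
  (\forall n \near \oo, n2 (a n) <= B) -> (\forall n \near \oo, n2 (b n) <= B) ->
  {ae P, forall x, csmall (fun n =>
    dot (b n) (conjdiag (L n x) (fun k => h (ga n x k)) *m a n) -
    cR ((\sum_k h (ga n x k)) / (N n)%:R) * dot (b n) (a n))}.
Proof.
move=> ha hb; have [c0 c00 hp] := dim_linear.
have := @ae_bilinear N (fun n => ZL (L n) (Gam n) h) c0 (K ^+ 2) B a b c00 hp
  (fun n => mxmeas_ZL (HL n) (@HGm n) mh)
  (fun n => ZL_inv (HL n) (HW n) (@HGm n) (@Hind n) mh)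
  (fun n => ae_frob_ZL (Gam n) (HL n) hK)
  (fun n x => conjdiagH _ _) ha hb.
apply: filterS2 ae_isom => x LR; congr (csmall _); apply/funext => n.
by rewrite tr_conjdiag; case: (LR n).
Qed.

Lemma ae_ZR (a b : forall n, 'cV[C]_n) B :
  (\forall n \near \oo, n2 (a n) <= B) -> (\forall n \near \oo, n2 (b n) <= B) ->
  {ae P, forall x, csmall (fun n =>
    dot (b n) (conjdiag (Rm n x) (fun k => h (ga n x k)) *m a n) -
    cR ((\sum_k h (ga n x k)) / n%:R) * dot (b n) (a n))}.
Proof.
move=> ha hb.
have hp : \forall n \near \oo, 2^-1 * n.+1%:R <= n%:R :> R.
  near=> n; have n1 : 1 <= n%:R :> R by rewrite ler1n; near: n; exact: nbhs_infty_gt.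
  by have -> : n.+1%:R = n%:R + 1 :> R; [rewrite natr1|lra].
have hF n : {ae P, forall x, frob (ZR (Gam n) (W n) (f n) h x) <= n%:R * K ^+ 2}.
  apply: filterS (ae_frob_ZR (Gam n) (@Hf n) (HW n) hK) => x /le_trans; apply.
  by rewrite ler_wpM2r ?sqr_ge0 // ler_nat.
have := @ae_bilinear id (fun n => ZR (Gam n) (W n) (f n) h) 2^-1 (K ^+ 2) B a b
  _ hp
  (fun n => mxmeas_ZR (f n) (HW n) (@HGm n) mh)
  (fun n => ZR_inv (HL n) (HW n) (@HGm n) (@Hind n) mh) hF
  (fun n x => conjdiagH _ _) ha hb.
rewrite invr_gt0 => /(_ (ltr0n _ _)).
apply: filterS2 ae_isom => x LR; congr (csmall _); apply/funext => n.
by rewrite tr_conjdiag; case: (LR n).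
Unshelve. all: by end_near. Qed.

Lemma ae_ZLR (a : forall n, 'cV[C]_(N n)) (v : forall n, 'cV[C]_n) B :
  (\forall n \near \oo, n2 (a n) <= B) -> (\forall n \near \oo, n2 (v n) <= B) ->
  {ae P, forall x, csmall (fun n =>
    dot (a n) (L n x *m rdiag (fun k => h (ga n x k)) *m mxH (Rm n x) *m v n))}.
Proof.
move=> ha hv; have [c0 c00 hp] := dim_linear.
(* The norm of [v n] is controlled only for large [n], while the Frobenius bound is asked at every
   [n]. Setting the other vectors to 0 does not affect the limit. *)
pose v' n := if n2 (v n) <= B then v n else 0.
have K0 : 0 <= K by apply: le_trans (hK 0).
have B0 : 0 <= B.
  have [n _ h0] := ha; apply: le_trans (h0 n (leqnn _)); exact: n2_ge0.
have v'B n : n2 (v' n) <= B by rewrite /v'; case: ifP => //; rewrite n20.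
have hF n : {ae P, forall x, frob (ZLR (L n) (Gam n) (W n) (f n) h (v' n) x)
    <= (N n)%:R * (K ^+ 2 * B) ^+ 2}.
  apply: filterS (ae_n2_xiLR (Gam n) (@Hf n) (HL n) (HW n) hK (v' n)) => x hx.
  rewrite frob_rank1; have [N0|N0] := posnP (N n).
    rewrite (_ : xiLR _ _ _ _ _ _ _ = 0) ?n20 ?N0 ?mul0r ?expr0n //.
    by apply/colP => k; case: k => k kN; exfalso; rewrite N0 in kN.
  have N1 : 1 <= (N n)%:R :> R by rewrite ler1n.
  have h1 : n2 (xiLR (L n) (Gam n) (W n) (f n) h (v' n) x) <= K ^+ 2 * B.
    by apply: le_trans hx _; rewrite ler_wpM2l ?sqr_ge0.
  have h2 : n2 (xiLR (L n) (Gam n) (W n) (f n) h (v' n) x) ^+ 2 <= (K ^+ 2 * B) ^+ 2.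
    by rewrite ler_pXn2r ?nnegrE ?n2_ge0 ?mulr_ge0 ?sqr_ge0.
  by apply: le_trans h2 _; rewrite ler_peMl ?sqr_ge0.
have := @ae_fluc_cvg0 _ _ _ P N (fun n => ZLR (L n) (Gam n) (W n) (f n) h (v' n)) a
  c0 ((K ^+ 2 * B) ^+ 2) B c00 hp
  (fun n => mxmeas_ZLR (f n) (HL n) (HW n) (@HGm n) mh (v' n))
  (fun n => ZLR_inv (HL n) (HW n) (@HGm n) (@Hind n) mh (v' n)) hF ha.
have aexi : {ae P, forall x, forall n,
    n2 (xiLR (L n) (Gam n) (W n) (f n) h (v' n) x) <= K ^+ 2 * n2 (v' n)}.
  by apply: ae_foralln => n; exact: (ae_n2_xiLR (Gam n) (@Hf n) (HL n) (HW n) hK).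
apply: filterS2 aexi => x hxi fl.
apply: (@csmall_near _ (fun n => dot (a n) (xiLR (L n) (Gam n) (W n) (f n) h (v' n) x))).
  by apply: filterS hv => n hvn; rewrite /xiLR /v' hvn.
pose xi n := xiLR (L n) (Gam n) (W n) (f n) h (v' n) x.
(* The trace of a rank-one matrix is bounded, so the centring term is of order [1 / N] and the
   squared mixed form tends to 0 together with [fluc]. *)
have e n : cabs (dot (a n) (xi n)) ^+ 2 = fluc (a n) (ZLR (L n) (Gam n) (W n) (f n) h (v' n) x)
    + n2 (a n) * n2 (xi n) / (N n)%:R.
  rewrite /fluc /ZLR mxtrace_rank1 subrK -/(xi n).
  rewrite -mulmxA [mxH (xi n) *m a n]mx11_scalar -/(dot (xi n) (a n)).
  by rewrite mul_mx_scalar dotZr [dot (xi n) _]dotC mulcJ.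
apply/csmallP => ep ep0.
have ep2 : 0 < ep ^+ 2 / 2 by rewrite divr_gt0 // exprn_gt0.
pose C1 := B * (K ^+ 2 * B) / c0.
have C10 : 0 <= C1 by rewrite divr_ge0 ?mulr_ge0 ?sqr_ge0 // ltW.
have C1' : 0 < C1 + 1 by rewrite ltr_wpDl.
move/cvgrPdist_lt : fl => /(_ _ ep2) fl.
move/cvgrPdist_lt : (@cvg_harmonic R) => /(_ _ (divr_gt0 ep2 C1')) har.
near=> n.
have h1 : `|0 - fluc (a n) (ZLR (L n) (Gam n) (W n) (f n) h (v' n) x)| < ep ^+ 2 / 2.
  by near: n.
have h2 : `|0 - harmonic n| < ep ^+ 2 / 2 / (C1 + 1) by near: n.
have h3 : c0 * n.+1%:R <= (N n)%:R by near: n.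
have h4 : n2 (a n) <= B by near: n.
have n0 : 0 < n.+1%:R :> R by rewrite ltr0n.
rewrite -/(xi n) -(@ltr_pXn2r _ 2) ?nnegrE ?cabs_ge0 ?ltW // e.
rewrite sub0r normrN ger0_norm ?harmonic_ge0 //= in h2.
rewrite sub0r normrN in h1; have h1' := ler_norm (fluc (a n) (ZLR (L n) (Gam n) (W n) (f n) h (v' n) x)).
have h5 : n2 (xi n) <= K ^+ 2 * B.
  by apply: le_trans (hxi n) _; rewrite ler_wpM2l ?sqr_ge0.
have h6 : n2 (a n) * n2 (xi n) / (N n)%:R <= C1 / n.+1%:R.
  have -> : C1 / n.+1%:R = B * (K ^+ 2 * B) / (c0 * n.+1%:R).
    by rewrite /C1 invfM !mulrA.
  apply: ler_pM; rewrite ?mulr_ge0 ?n2_ge0 ?invr_ge0 //.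
    by apply: ler_pM => //; exact: n2_ge0.
  by rewrite lef_pV2 ?posrE ?mulr_gt0 //; apply: lt_le_trans h3; rewrite mulr_gt0.
have h7 : C1 / n.+1%:R <= ep ^+ 2 / 2.
  rewrite ltr_pdivlMr // in h2.
  apply: le_trans (ltW h2); rewrite mulrC; apply: ler_wpM2l; last by rewrite lerDl.
  by rewrite invr_ge0 ltW.
apply: le_lt_trans (lerD h1' (le_trans h6 h7)) _; move: h1.
by move: `|_| (ep ^+ 2) => s t; lra.
Unshelve. all: by end_near. Qed.
End Bilinear.

Variables (pi : probability R R) (lm lp : R).
Hypotheses (Hlmp : lm <= lp) (Hsupp : pi (~` `[lm, lp]) = 0%E)
  (HA3 : forall z : C, 0 < Im z ->
     {ae P, forall x, ccvg (fun n =>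
        (N n)%:R^-1 * \tr (invmx (X n x *m mxH (X n x) - z%:M))) (stieltjes pi z)})
  (HA4 : {ae P, forall x, (fun n => opnorm (X n x *m mxH (X n x))) @ \oo --> lp}).

(** The sign of [lp] comes from (A4), which makes it a limit of operator norms. *)
Lemma lp_ge0 : 0 <= lp.
Proof.
have [x [h iso]] : exists x, ((fun n => opnorm (X n x *m mxH (X n x))) @ \oo --> lp) /\
    (forall n, mxH (L n x) *m L n x = 1%:M /\ mxH (Rm n x) *m Rm n x = 1%:M).
  by apply: (@ae_ex _ _ _ P); exact: filterI HA4 ae_isom.
apply: (cvgr_to_ge h); apply: nearW => n.
(* In dimension 0 there is no unit vector, and the supremum of the empty set is 0. *)
have [n0|n0] := posnP (N n).
  rewrite /opnorm (_ : [set _ | _ in _] = set0) ?sup0 //.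
  apply/seteqP; split => // _ [v /= v1 _].
  have := oner_neq0 R; rewrite -v1 vnormE n2E big1 ?sqrtr0 ?eqxx // => -[k kN].
  by exfalso; rewrite n0 in kN.
have [L1 R1] := iso n; rewrite XE.
exact: le_trans (sqr_ge0 _) (opnorm_ge_gam _ L1 R1 (Ordinal n0)).
Qed.

Lemma ae_gam_le (th : R) : lp < th ->
  {ae P, forall x, \forall n \near \oo, forall k, ga n x k ^+ 2 <= th}.
Proof.
move=> lth; apply: filterS2 HA4 ae_isom => x h iso.
have h2 : \forall n \near \oo, opnorm (X n x *m mxH (X n x)) < th.
  exact: cvgr_lt h _ lth.
apply: filterS h2 => n hn k; have [L1 R1] := iso n; rewrite XE in hn.
exact: le_trans (opnorm_ge_gam _ L1 R1 k) (ltW hn).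
Qed.

Section Point.
Variable x0 : R.
Hypothesis lx0 : lp < x0.
Let th := (lp + x0) / 2.
Let m := stieltjesR pi x0.
Let w := wfun pi c x0.

Lemma th_lt : lp < th /\ th < x0.
Proof. by have := lx0; rewrite /th; split; lra. Qed.

(* Real spectral points are reached from [x0 + i e] as [e -> 0], uniformly in [n]. *)
Lemma ae_alpha : {ae P, forall x,
  (fun n => (\sum_k (ga n x k ^+ 2 - x0)^-1) / (N n)%:R) @ \oo --> m}.
Proof.
have [th1 th2] := th_lt.
(* The exceptional set of (A3) depends on [z]; only the countably many heights [1 / i.+1] are
   used. *)
have hA3 : {ae P, forall x, forall i : nat, ccvg (fun n =>
    (N n)%:R^-1 * \tr (invmx (X n x *m mxH (X n x) - (x0 +i* (i.+1%:R^-1))%C%:M)))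
    (stieltjes pi (x0 +i* (i.+1%:R^-1))%C)}.
  by apply: ae_foralln => i; apply: HA3 => /=; rewrite invr_gt0.
apply: filterS3 hA3 (ae_gam_le th1) ae_isom => x hx gx iso.
apply/cvgrPdist_lt => ep ep0.
pose del := x0 - th; have d0 : 0 < del by rewrite /del; lra.
pose C1 := 2 / del ^+ 3.
have C10 : 0 < C1 by rewrite divr_gt0 // exprn_gt0.
have ep1 : 0 < ep / 2 / C1 by apply: divr_gt0 => //; exact: divr_gt0.
have ep1' : 0 < Num.min 1 (ep / 2 / C1) by rewrite lt_min ltr01.
(* The height [e] costs at most [e^2 / del^3] on the side of [pi] and as much on the side of the
   eigenvalues. With [e < 1] and [e C1 < ep / 2] the two together are at most [ep / 2], which leaves
   [ep / 2] for the convergence at [x0 + i e]. *)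
have [i hi] : exists i, harmonic i < Num.min 1 (ep / 2 / C1).
  move/cvgrPdist_lt : (@cvg_harmonic R) => /(_ _ ep1') [i _ h]; exists i.
  by have := h i (leqnn i); rewrite /= sub0r normrN ger0_norm.
pose e : R := i.+1%:R^-1.
have e0 : 0 < e by rewrite invr_gt0.
have [] := hx i; rewrite -/e => /cvgrPdist_lt hRe _.
have ep2 : 0 < ep / 2 by rewrite divr_gt0.
near=> n.
have hn : `|Re (stieltjes pi (x0 +i* e)%C) -
   Re ((N n)%:R^-1 * \tr (invmx (X n x *m mxH (X n x) - (x0 +i* e)%C%:M)))| < ep / 2.
  by near: n; exact: hRe.
have N0 : (0 < N n)%N by near: n; exact: dim_gt0.
have gn : forall k, ga n x k ^+ 2 <= th by near: n.
have Np : 0 < (N n)%:R :> R by rewrite ltr0n.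
have [L1 R1] := iso n.
rewrite XE tr_resolvent // in hn; last by rewrite /= gt_eqF.
have NC : (N n)%:R^-1 = cR (N n)%:R^-1 :> C by rewrite cRV; congr (_^-1); rewrite /cR; exact/esym/rmorph_nat.
rewrite NC ReM [Re (cR _)]/= [Im (cR _)]/= mul0r subr0 Re_sum in hn.
have h1 : `|Re (stieltjes pi (x0 +i* e)%C) - m| <= e ^+ 2 / (x0 - lp) ^+ 3.
  exact: (stieltjes_approx Hsupp).
have h1' : e ^+ 2 / (x0 - lp) ^+ 3 <= e ^+ 2 / del ^+ 3.
  apply: ler_wpM2l; first exact: sqr_ge0.
  rewrite lef_pV2 ?posrE ?exprn_gt0 //; last by rewrite subr_gt0.
  have dl : del <= x0 - lp by rewrite lerD2l lerN2 ltW.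
  by rewrite ler_pXn2r ?nnegrE ?(ltW d0) // (le_trans (ltW d0) dl).
have h2 : `|(N n)%:R^-1 * (\sum_k Re ((cR (ga n x k ^+ 2) - (x0 +i* e)%C)^-1)) -
   (\sum_k (ga n x k ^+ 2 - x0)^-1) / (N n)%:R| <= e ^+ 2 / del ^+ 3.
  rewrite mulrC -mulrBl -sumrB normrM normfV (ger0_norm (ltW Np)) ler_pdivrMr //.
  apply: le_trans (ler_norm_sum _ _ _) _.
  have -> : e ^+ 2 / del ^+ 3 * (N n)%:R = \sum_(k < N n) (e ^+ 2 / del ^+ 3).
    by rewrite sumr_const card_ord mulr_natr.
  apply: ler_sum => k _.
  rewrite Re_inv /= add0r sqrrN -[X in X / _]opprB -[X in _ / (X ^+ 2 + _)]opprB sqrrN.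
  rewrite -[X in _ - X^-1]opprB.
  by apply: Re_inv_approx => //; rewrite /del; have := gn k; lra.
have h3 : e ^+ 2 / del ^+ 3 + e ^+ 2 / del ^+ 3 <= ep / 2.
  move: hi; rewrite lt_min -/e => /andP[e1]; rewrite ltr_pdivlMr // => e2.
  have -> : e ^+ 2 / del ^+ 3 + e ^+ 2 / del ^+ 3 = e * (e * C1).
    by rewrite /C1; field; rewrite gt_eqF.
  apply: le_trans (ltW e2); apply: ler_piMl (ltW e1).
  by rewrite mulr_ge0 ?ltW.
move: h1' h1 h2 h3 hn.
set A := (\sum_k _) / _; set B := _^-1 * _; set D := Re (stieltjes _ _).
set E1 := e ^+ 2 / _; set E2 := e ^+ 2 / del ^+ 3.
rewrite !ltr_norml !ler_norml => ? /andP[? ?] /andP[? ?] ? /andP[? ?].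
by apply/andP; split; lra.
Unshelve. all: by end_near. Qed.

Lemma x0_gt0 : 0 < x0.
Proof. by apply: le_lt_trans lp_ge0 lx0. Qed.

(** Each [1 / (ga^2 - x0)] is at most [- 1 / x0] because [ga^2 >= 0], and the bound survives the
    limit. The interval [[lm, lp]] may reach below 0, so the inequality is taken from the matrix
    model. *)
Lemma stieltjesR_mul_le : x0 * m <= -1.
Proof.
have [th1 th2] := th_lt.
have [x [h gx]] : exists x, ((fun n => (\sum_k (ga n x k ^+ 2 - x0)^-1) / (N n)%:R) @ \oo --> m) /\
    (\forall n \near \oo, forall k, ga n x k ^+ 2 <= th).
  by apply: (@ae_ex _ _ _ P); exact: filterI ae_alpha (ae_gam_le th1).
rewrite mulrC -ler_pdivlMr ?x0_gt0 //; apply: (cvgr_to_le h).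
near=> n.
have N0 : (0 < N n)%N by near: n; exact: dim_gt0.
have gn : forall k, ga n x k ^+ 2 <= th by near: n.
rewrite ler_pdivrMr ?ltr0n //.
have -> : -1 / x0 * (N n)%:R = \sum_(k < N n) (-1 / x0).
  by rewrite sumr_const card_ord mulr_natr.
apply: ler_sum => k _; rewrite -opprB invrN mulN1r lerN2 lef_pV2 ?posrE ?x0_gt0 //.
  by rewrite lerBlDr lerDl sqr_ge0.
by have := gn k; lra.
Unshelve. all: by end_near. Qed.

(** Truncated at [th], the function is bounded by [1 / (x0 - th)] everywhere; at the singular values
    it is eventually the resolvent function, since almost surely they all have squares at most
    [th]. *)
Let hinv (t : R) := (Num.min (t ^+ 2) th - x0)^-1.

Lemma measurable_hinv : measurable_fun setT hinv.
Proof.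
apply: measurable_comp_invr; apply: measurable_funB => //.
by apply: measurable_minr => //; exact: measurable_funX.
Qed.

Lemma hinv_le t : `|hinv t| <= (x0 - th)^-1.
Proof.
have [th1 th2] := th_lt.
have h : Num.min (t ^+ 2) th <= th by rewrite ge_min lexx orbT.
rewrite normfV distrC ger0_norm; last by lra.
by rewrite lef_pV2 ?posrE; lra.
Qed.

Lemma ae_iso_LL (a b : forall n, 'cV[C]_(N n)) B :
  (\forall n \near \oo, n2 (a n) <= B) -> (\forall n \near \oo, n2 (b n) <= B) ->
  {ae P, forall x, csmall (fun n => dot (b n) (Q x0 n x *m a n) - cR m * dot (b n) (a n))}.
Proof.
move=> ha hb; have [th1 th2] := th_lt.
apply: filterS3 (ae_ZL measurable_hinv hinv_le ha hb) ae_alpha (ae_gam_le th1) => x hx al gx.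
have e : \forall n \near \oo, forall k, hinv (ga n x k) = (ga n x k ^+ 2 - x0)^-1.
  by apply: filterS gx => n gn k; rewrite /hinv min_l.
have bd : \forall n \near \oo, cabs (dot (b n) (a n)) <= B.
  apply: filterS2 ha hb => n h1 h2; apply: le_trans (cabs_dot_amgm _ _) _; lra.
have s2 : csmall (fun n => dot (b n) (a n) *
    cR ((\sum_k (ga n x k ^+ 2 - x0)^-1) / (N n)%:R - m)).
  by apply: csmallMbnd bd; apply: csmall_cR; exact: cvg_subC0.
apply: csmall_near (csmallD hx s2); apply: filterS e => n en.
rewrite (eq_bigr _ (fun k _ => en k)).
have -> : (fun k => hinv (ga n x k)) = (fun k => (ga n x k ^+ 2 - x0)^-1) by apply/funext.
by rewrite -/(Qres _ _ _) -/(Q x0 n x) cRD cRN; ring.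
Qed.

Lemma ae_iso_RR (a b : forall n, 'cV[C]_n) B :
  (\forall n \near \oo, n2 (a n) <= B) -> (\forall n \near \oo, n2 (b n) <= B) ->
  {ae P, forall x, csmall (fun n => dot (b n) (mxH (X n x) *m Q x0 n x *m X n x *m a n)
     - cR (1 + w) * dot (b n) (a n))}.
Proof.
move=> ha hb; have [th1 th2] := th_lt.
pose h t := Num.min (t ^+ 2) th * hinv t.
have th0 : 0 <= th by have := lp_ge0; lra.
have mh : measurable_fun setT h.
  apply: measurable_funM; last exact: measurable_hinv.
  by apply: measurable_minr => //; exact: measurable_funX.
have hK t : `|h t| <= th * (x0 - th)^-1.
  rewrite normrM; apply: ler_pM => //; last exact: hinv_le.
  by rewrite ger0_norm ?ge_min ?lexx ?orbT // le_min sqr_ge0.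
apply: filterS2 (filterI (ae_ZR mh hK ha hb) ae_isom) (filterI ae_alpha (ae_gam_le th1)).
move=> x [hx iso] [al gx].
have e : \forall n \near \oo, forall k, h (ga n x k) = ga n x k ^+ 2 / (ga n x k ^+ 2 - x0).
  by apply: filterS gx => n gn k; rewrite /h /hinv !min_l.
have bd : \forall n \near \oo, cabs (dot (b n) (a n)) <= B.
  apply: filterS2 ha hb => n h1 h2; apply: le_trans (cabs_dot_amgm _ _) _; lra.
have s2 : csmall (fun n => dot (b n) (a n) *
    cR ((\sum_k ga n x k ^+ 2 / (ga n x k ^+ 2 - x0)) / n%:R - (1 + w))).
  apply: csmallMbnd bd; apply: csmall_cR; apply: cvg_subC0.
  (* From [ga^2 / (ga^2 - x0) = 1 + x0 / (ga^2 - x0)]: the sum has [N] terms but is normalised by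
     [n], whence the factor [c]. *)
  have -> : 1 + w = c * (1 + x0 * m) by rewrite /w /wfun -/m; ring.
  have : (fun n => (N n)%:R / n%:R * (1 + x0 * ((\sum_k (ga n x k ^+ 2 - x0)^-1) / (N n)%:R)))
     @ \oo --> c * (1 + x0 * m).
    apply: cvgM => //; apply: cvgD; first exact: cvg_cst.
    by apply: cvgM => //; exact: cvg_cst.
  apply: cvg_trans; apply: near_eq_cvg.
  near=> n.
  have N0 : (0 < N n)%N by near: n; exact: dim_gt0.
  have gn : forall k, ga n x k ^+ 2 <= th by near: n.
  have Np : (N n)%:R != 0 :> R by rewrite pnatr_eq0 -lt0n.
  have -> : \sum_k ga n x k ^+ 2 / (ga n x k ^+ 2 - x0) =
     (N n)%:R + x0 * \sum_k (ga n x k ^+ 2 - x0)^-1.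
    rewrite mulr_sumr -[X in X%:R]card_ord -sumr_const -big_split.
    apply: eq_bigr => k _; have := gn k => gk /=.
    by field; rewrite subr_eq0 lt_eqF //; lra.
  move: (\sum_k _) ((N n)%:R : R) (n%:R^-1 : R) Np => S y i y0.
  by field.
apply: csmall_near (csmallD hx s2); apply: filterS e => n en.
have [L1 R1] := iso n.
rewrite (eq_bigr _ (fun k _ => en k)) /Q XE XQresX //.
have -> : (fun k => h (ga n x k)) = (fun k => ga n x k ^+ 2 / (ga n x k ^+ 2 - x0)).
  by apply/funext.
by rewrite cRD cRN; ring.
Unshelve. all: by end_near. Qed.

Lemma ae_iso_LR (a : forall n, 'cV[C]_(N n)) (v : forall n, 'cV[C]_n) B :
  (\forall n \near \oo, n2 (a n) <= B) -> (\forall n \near \oo, n2 (v n) <= B) ->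
  {ae P, forall x, csmall (fun n => dot (a n) (Q x0 n x *m X n x *m v n))}.
Proof.
move=> ha hv; have [th1 th2] := th_lt.
have th0 : 0 <= th by have := lp_ge0; lra.
(* [t^2 <= th] implies [t <= th + 1], a truncation level that avoids a square root. *)
pose h t := Num.min `|t| (th + 1) * hinv t.
have mh : measurable_fun setT h.
  apply: measurable_funM; last exact: measurable_hinv.
  by apply: measurable_minr => //; exact: normr_measurable.
have hK t : `|h t| <= (th + 1) * (x0 - th)^-1.
  rewrite normrM; apply: ler_pM => //; last exact: hinv_le.
  by rewrite ger0_norm ?ge_min ?lexx ?orbT // le_min normr_ge0 addr_ge0.
apply: filterS3 (ae_ZLR mh hK ha hv) ae_isom (ae_gam_le th1) => x hx iso gx.
apply: csmall_near hx; apply: filterS gx => n gn.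
have [L1 R1] := iso n.
have -> : (fun k => h (ga n x k)) = (fun k => ga n x k / (ga n x k ^+ 2 - x0)).
  apply/funext => k; have g1 := gn k; have g0 := gam_ge0 x k.
  rewrite /h /hinv (min_l g1) ger0_norm // min_l //.
  by have := sqr_ge0 (ga n x k - 1); nra.
by rewrite /Q XE; have -> := QresX (Rm n x) (ga n x) L1 x0.
Qed.
End Point.

End IsotropicConvergence.

(** * Entrywise convergence *)

Section MatrixConvergence.
Variable R : realType.
Local Notation C := R[i].
Local Notation Re := (@complex.Re R).
Local Notation Im := (@complex.Im R).

Definition mconv p q (A : nat -> 'M[C]_(p, q)) (A0 : 'M[C]_(p, q)) :=
  forall i j, csmall (fun n => A n i j - A0 i j).

Definition mbnd p q (A : nat -> 'M[C]_(p, q)) (B : R) :=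
  \forall n \near \oo, forall i j, cabs (A n i j) <= B.

Lemma mconv_cst p q (A0 : 'M[C]_(p, q)) : mconv (fun=> A0) A0.
Proof. by move=> i j; under eq_fun do rewrite subrr; exact: csmall0. Qed.

Lemma mconvD p q (A B : nat -> 'M[C]_(p, q)) A0 B0 : mconv A A0 -> mconv B B0 ->
  mconv (fun n => A n + B n) (A0 + B0).
Proof.
move=> hA hB i j; apply: csmall_near (csmallD (hA i j) (hB i j)).
by apply: nearW => n; rewrite !mxE; ring.
Qed.

Lemma mconvN p q (A : nat -> 'M[C]_(p, q)) A0 : mconv A A0 -> mconv (fun n => - A n) (- A0).
Proof.
move=> hA i j; apply: csmall_near (csmallN (hA i j)).
by apply: nearW => n; rewrite !mxE; ring.
Qed.

Lemma mconvB p q (A B : nat -> 'M[C]_(p, q)) A0 B0 : mconv A A0 -> mconv B B0 ->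
  mconv (fun n => A n - B n) (A0 - B0).
Proof. by move=> hA hB; apply: mconvD => //; exact: mconvN. Qed.

Lemma mconv_bnd p q (A : nat -> 'M[C]_(p, q)) A0 : mconv A A0 -> exists B, mbnd A B.
Proof.
move=> hA; pose B0 := \sum_i \sum_j cabs (A0 i j); exists (1 + B0).
have h i j : \forall n \near \oo, cabs (A n i j) <= 1 + B0.
  have /csmallP /(_ _ ltr01) := hA i j; apply: filterS => n h.
  rewrite -(subrK (A0 i j) (A n i j)); apply: le_trans (cabsD _ _) _.
  apply: lerD; first exact: ltW.
  rewrite /B0 (bigD1 i) //= (bigD1 j) //= -addrA lerDl addr_ge0 //.
    by apply: sumr_ge0 => ? _; exact: cabs_ge0.
  by apply: sumr_ge0 => ? _; apply: sumr_ge0 => ? _; exact: cabs_ge0.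
by apply: filter_forall => i; apply: filter_forall => j.
Qed.

Lemma mconv0_bndM p q m (A : nat -> 'M[C]_(p, q)) (V : nat -> 'M[C]_(q, m)) B :
  mconv A 0 -> mbnd V B -> mconv (fun n => A n *m V n) 0.
Proof.
move=> hA hV i j; apply: (@csmall_near _ (fun n => \sum_k V n k j * (A n i k - (0 : 'M[C]_(p, q)) i k))).
  by apply: nearW => n; rewrite !mxE subr0; apply: eq_bigr => k _; rewrite mxE subr0 mulrC.
apply: csmall_sum => k; apply: (csmallMbnd (hA i k) (B := B)).
by apply: filterS hV => n h; exact: h.
Qed.

Lemma mbndM0 p q m (A : nat -> 'M[C]_(p, q)) (V : nat -> 'M[C]_(q, m)) B :
  mbnd A B -> mconv V 0 -> mconv (fun n => A n *m V n) 0.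
Proof.
move=> hA hV i j; apply: (@csmall_near _ (fun n => \sum_k A n i k * (V n k j - (0 : 'M[C]_(q, m)) k j))).
  by apply: nearW => n; rewrite !mxE subr0; apply: eq_bigr => k _; rewrite mxE subr0.
apply: csmall_sum => k; apply: (csmallMbnd (hV k j) (B := B)).
by apply: filterS hA => n h; exact: h.
Qed.

Lemma mconv_sub0 p q (A : nat -> 'M[C]_(p, q)) A0 : mconv A A0 <-> mconv (fun n => A n - A0) 0.
Proof.
by split=> hA i j; apply: csmall_near (hA i j); apply: nearW => n; rewrite !mxE subr0.
Qed.

Lemma mconv_near p q (A A' : nat -> 'M[C]_(p, q)) A0 :
  (\forall n \near \oo, A n = A' n) -> mconv A A0 -> mconv A' A0.
Proof.
by move=> h hA i j; apply: csmall_near (hA i j); apply: filterS h => n ->.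
Qed.

Lemma mconvM p q m (A : nat -> 'M[C]_(p, q)) (V : nat -> 'M[C]_(q, m)) A0 V0 :
  mconv A A0 -> mconv V V0 -> mconv (fun n => A n *m V n) (A0 *m V0).
Proof.
move=> hA hV; apply/mconv_sub0.
have [B hB] := mconv_bnd hV; have [B' hB'] := mconv_bnd (mconv_cst A0).
have := mconvD (mconv0_bndM ((mconv_sub0 _ _).1 hA) hB) (mbndM0 hB' ((mconv_sub0 _ _).1 hV)).
rewrite addr0; apply: mconv_near; apply: nearW => n.
by rewrite mulmxBl mulmxBr addrA subrK.
Qed.

Lemma mconvH p q (A : nat -> 'M[C]_(p, q)) A0 : mconv A A0 -> mconv (fun n => mxH (A n)) (mxH A0).
Proof.
move=> hA i j; apply: csmall_near (csmallJ (hA j i)).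
by apply: nearW => n; rewrite !mxHE conjcB.
Qed.

Lemma mconv_block p q m l (A : nat -> 'M[C]_(p, q)) (B : nat -> 'M[C]_(p, m))
    (D : nat -> 'M[C]_(l, q)) (E : nat -> 'M[C]_(l, m)) A0 B0 D0 E0 :
  mconv A A0 -> mconv B B0 -> mconv D D0 -> mconv E E0 ->
  mconv (fun n => block_mx (A n) (B n) (D n) (E n)) (block_mx A0 B0 D0 E0).
Proof.
move=> hA hB hD hE i j.
case: (split_ordP i) => i' ->; case: (split_ordP j) => j' ->.
- by under eq_fun do rewrite !block_mxEul; exact: hA.
- by under eq_fun do rewrite !block_mxEur; exact: hB.
- by under eq_fun do rewrite !block_mxEdl; exact: hD.
- by under eq_fun do rewrite !block_mxEdr; exact: hE.
Qed.

Lemma mconv_col p q l (A : nat -> 'M[C]_(p, q)) (D : nat -> 'M[C]_(l, q)) A0 D0 :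
  mconv A A0 -> mconv D D0 ->
  mconv (fun n => col_mx (A n) (D n)) (col_mx A0 D0).
Proof.
move=> hA hD i j; case: (split_ordP i) => i' ->.
  by under eq_fun do rewrite !col_mxEu; exact: hA.
by under eq_fun do rewrite !col_mxEd; exact: hD.
Qed.

Lemma mconv_rdiag p (a : nat -> 'I_p -> R) a0 :
  (forall k, (fun n => a n k) @ \oo --> (a0 k : R)) -> mconv (fun n => rdiag (a n)) (rdiag a0).
Proof.
move=> h i j.
apply: (@csmall_near _ (fun n => cR (a n j - a0 j) *+ (i == j))).
  apply: nearW => n; rewrite !mxE cRD cRN.
  by case: eqVneq => [->|_]; rewrite ?mulr1n ?mulr0n ?subr0.
case: (i == j); last by under eq_fun do rewrite mulr0n; exact: csmall0.
by under eq_fun do rewrite mulr1n; apply: csmall_cR; exact: cvg_subC0.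
Qed.

Lemma mconv0_n2 p (v : nat -> 'cV[C]_p) (e : R) : mconv v 0 -> 0 < e ->
  \forall n \near \oo, n2 (v n) < e.
Proof.
move=> hv e0; case: p v hv => [|p] v hv.
  by apply: nearW => n; rewrite n2E big_ord0.
have es : 0 < Num.sqrt (e / p.+1%:R) by rewrite sqrtr_gt0 divr_gt0.
have : \forall n \near \oo, forall i, cabs (v n i 0) < Num.sqrt (e / p.+1%:R).
  apply: filter_forall => i; have /csmallP /(_ _ es) := hv i 0.
  by apply: filterS => n; rewrite mxE subr0.
apply: filterS => n h; rewrite n2E.
have -> : e = \sum_(i < p.+1) e / p.+1%:R.
  by rewrite sumr_const card_ord -[RHS]mulr_natr divfK ?pnatr_eq0.
apply: ltr_sum => [|i _]; first by apply/hasP; exists ord0; rewrite ?mem_index_enum.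
rewrite -[ltRHS]sqr_sqrtr ?divr_ge0 ?ltW //.
by rewrite ltr_pXn2r ?nnegrE ?cabs_ge0 ?sqrtr_ge0.
Qed.

(** With [del] the least limit on [S], entrywise errors below [del / q.+1] change the form by at
    most [del q / q.+1 * |t|^2 < del |t|^2]. The threshold in [n] is thus uniform in [t], which the
    eigenvalue counts require. *)
Lemma pos_eventually q (M : nat -> 'M[C]_q) (D : 'I_q -> R) (S : pred 'I_q) :
  mconv M (rdiag D) -> (forall i, S i -> 0 < D i) ->
  \forall n \near \oo, forall t : 'cV[C]_q, (forall i, ~~ S i -> t i 0 = 0) -> t != 0 ->
    0 < Re (dot t (M n *m t)).
Proof.
move=> hM hD; pose del := \big[Num.min/1]_(i | S i) D i.
have d0 : 0 < del by apply: lt_bigmin.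
have dD i : S i -> del <= D i by move=> Si; apply: bigmin_le_cond.
have q1 : 0 < (q.+1)%:R :> R by [].
have e0 : 0 < del / q.+1%:R by rewrite divr_gt0.
have : \forall n \near \oo, forall i j, cabs (M n i j - rdiag D i j) < del / q.+1%:R.
  apply: filter_forall => i; apply: filter_forall => j.
  by have /csmallP /(_ _ e0) := hM i j.
apply: filterS => n hn t tS t0.
have tp := n2_gt0 t0.
pose E := M n - rdiag D.
have -> : M n = rdiag D + E by rewrite addrC subrK.
rewrite mulmxDl dotDr ReD.
have h1 : del * n2 t <= Re (dot t (rdiag D *m t)).
  rewrite n2E mulr_sumr dotE Re_sum; apply: ler_sum => i _.
  rewrite rdiag_mulE [conjc _ * _]mulrCA mulcJ -cRM /=.
  have [Si|/tS ->] := boolP (S i); last by rewrite cabs0 expr0n !mulr0.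
  by rewrite ler_wpM2r ?sqr_ge0 // dD.
have h2 : cabs (dot t (E *m t)) <= del / q.+1%:R * q%:R * n2 t.
  rewrite dotE; apply: le_trans (cabs_sum _ _ _) _.
  apply: (@le_trans _ _ (\sum_i \sum_j del / q.+1%:R * ((cabs (t i 0) ^+ 2 + cabs (t j 0) ^+ 2) / 2))).
    apply: ler_sum => i _; rewrite mxE cabsM cabsJ.
    apply: le_trans (ler_wpM2l (cabs_ge0 _) (cabs_sum _ _ _)) _.
    rewrite mulr_sumr; apply: ler_sum => j _; rewrite cabsM mulrCA.
    have := hn i j; rewrite (_ : M n i j - rdiag D i j = E i j); last by rewrite !mxE.
    move=> /ltW hE; apply: ler_pM => //; rewrite ?mulr_ge0 ?cabs_ge0 //.
    have := sqr_ge0 (cabs (t i 0) - cabs (t j 0)); lra.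
  under eq_bigr do rewrite -mulr_sumr -mulr_suml big_split /= sumr_const card_ord.
  rewrite -mulr_sumr -mulr_suml big_split /= sumr_const card_ord -n2E.
  rewrite sumrMnl -n2E -[n2 t *+ q]mulr_natr.
  by move: (n2 t) (q%:R : R) (del / _) => u v s; lra.
have /andP[h4 _] : - cabs (dot t (E *m t)) <= Re (dot t (E *m t)) <= cabs (dot t (E *m t)).
  by rewrite -ler_norml cabs_Re.
have h5 : del / q.+1%:R * q%:R * n2 t < del * n2 t.
  by rewrite ltr_pM2r // mulrAC ltr_pdivrMr // ltr_pM2l // ltr_nat.
move: h1 h2 h4 h5; move: (Re _) (Re _) (cabs _) (del * _) (_ / _ * _ * _) => x1 x2 x3 x4 x5.
lra.
Qed.
End MatrixConvergence.

(** * Counting eigenvalues *)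

Section EigenvalueCounting.
Variable R : realType.
Local Notation C := R[i].
Local Notation Re := (@complex.Re R).
Local Notation Im := (@complex.Im R).

(** The equations are indexed by a finite type so that two families of constraints can be joined as
    a sum type. *)
Lemma linear_system_nontrivial (F : fieldType) (I : finType) q (a : I -> 'I_q -> F) :
  (#|I| < q)%N ->
  exists2 t : 'cV[F]_q, t != 0 & forall i, \sum_j a i j * t j 0 = 0.
Proof.
move=> Iq; pose A : 'M[F]_(q, #|I|) := \matrix_(j, k) a (enum_val k) j.
have kA : kermx A != 0.
  rewrite -mxrank_eq0 mxrank_ker subn_eq0 -ltnNge.
  exact: leq_ltn_trans (rank_leq_col A) Iq.
have [k hk] : exists k, row k (kermx A) != 0.
  apply/existsP; apply: contraNT kA => /existsPn h; apply/eqP/row_matrixP => k.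
  by rewrite row0; have := h k; rewrite negbK => /eqP.
exists (row k (kermx A))^T; first by rewrite -trmx0 (inj_eq trmx_inj).
move=> i; have : row k (kermx A) *m A = 0 by rewrite -row_mul mulmx_ker row0.
move/matrixP => /(_ 0 (enum_rank i)); rewrite mxE [RHS]mxE => h; rewrite -[RHS]h.
by apply: eq_bigr => j _; rewrite !mxE enum_rankK mulrC.
Qed.

Variables (p : nat) (M U : 'M[C]_p) (la : 'I_p -> R).
Hypotheses (UU : mxH U *m U = 1%:M) (MU : M *m U = U *m rdiag la)
  (la_noninc : forall k k' : 'I_p, (k <= k')%N -> la k' <= la k).

Lemma UUH : U *m mxH U = 1%:M. Proof. exact: mulmx1C. Qed.

Lemma eigenE : M = U *m rdiag la *m mxH U.
Proof. by rewrite -MU -mulmxA UUH mulmx1. Qed.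

Lemma eigen_qf (a : 'cV[C]_p) :
  Re (dot a (M *m a)) = \sum_k la k * cabs ((mxH U *m a) k 0) ^+ 2.
Proof.
rewrite eigenE -!mulmxA dotMr dotE Re_sum; apply: eq_bigr => k _.
by rewrite rdiag_mulE [conjc _ * _]mulrCA mulcJ -cRM /=.
Qed.

Lemma eigen_n2 (a : 'cV[C]_p) : n2 a = \sum_k cabs ((mxH U *m a) k 0) ^+ 2.
Proof. by rewrite -n2E n2_isom // mxHK UUH. Qed.

(** Courant-Fischer by counting equations. If [la k <= x], then the [k] conditions of orthogonality
    of [Z t] to the first [k] eigenvectors and the [r - dd] vanishing coordinates leave some
    [t != 0], as [k < dd]; for it the form of [M] is at most [x |Z t|^2]. *)
Lemma eigenvalues_gt r (Z : 'M[C]_(p, r)) (dd : nat) (x : R) : (dd <= r)%N ->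
  (forall t : 'cV[C]_r, (forall k : 'I_r, (dd <= k)%N -> t k 0 = 0) -> t != 0 ->
     x * n2 (Z *m t) < Re (dot (Z *m t) (M *m (Z *m t)))) ->
  forall k : 'I_p, (k < dd)%N -> x < la k.
Proof.
move=> ddr hZ k kdd; rewrite ltNge; apply/negP => lax.
pose I : finType := ('I_k + 'I_(r - dd))%type.
pose a (i : I) (j : 'I_r) : C := match i with
  | inl l => (mxH U *m Z) (widen_ord (ltnW (ltn_ord k)) l) j
  | inr l => (j == (dd + l)%N :> nat)%:R end.
have cI : (#|I| < r)%N.
  by rewrite card_sum !card_ord -[X in (_ < X)%N](subnKC ddr) ltn_add2r.
have [t t0 ht] := linear_system_nontrivial a cI.
have tS (j : 'I_r) : (dd <= j)%N -> t j 0 = 0.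
  move=> ddj; have jl : (j - dd < r - dd)%N by rewrite ltn_sub2r // (leq_ltn_trans ddj).
  have := ht (inr (Ordinal jl)); rewrite /= (bigD1 j) //= subnKC // eqxx mul1r.
  by rewrite big1 ?addr0 // => l; rewrite -val_eqE /= => /negbTE ->; rewrite mul0r.
have := hZ t tS t0; rewrite eigen_n2 eigen_qf mulr_sumr; apply/negP; rewrite -leNgt.
apply: ler_sum => l _.
have [lk|kl] := ltnP l k.
  have -> : (mxH U *m (Z *m t)) l 0 = 0.
    rewrite mulmxA mxE -[RHS](ht (inl (Ordinal lk))); apply: eq_bigr => j _ /=.
    by congr ((mxH U *m Z) _ _ * _); apply: val_inj.
  by rewrite cabs0 expr0n !mulr0.
by rewrite ler_wpM2r ?sqr_ge0 // (le_trans (la_noninc kl)).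
Qed.

(** The dual count: if [la k >= x], the span of the first [k.+1] eigenvectors meets the at most
    [dd <= k] constraints in a nonzero vector, whose form is at least [x] times its squared norm. *)
Lemma eigenvalues_lt r (V : 'M[C]_(p, r)) (dd : nat) (x : R) :
  (forall a : 'cV[C]_p, (forall k : 'I_r, (k < dd)%N -> (mxH V *m a) k 0 = 0) -> a != 0 ->
     Re (dot a (M *m a)) < x * n2 a) ->
  forall k : 'I_p, (dd <= k)%N -> la k < x.
Proof.
move=> hV k ddk; rewrite ltNge; apply/negP => lax.
pose I : finType := ('I_(p - k.+1) + 'I_dd)%type.
pose a (i : I) (j : 'I_p) : C := match i with
  | inl l => (j == (k.+1 + l)%N :> nat)%:R
  (* [dd] may exceed [r]; indices beyond [r] give the trivial equation. *)
  | inr l => if insub (val l) is Some l' then (mxH V *m U) (l' : 'I_r) j else 0 end.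
have cI : (#|I| < p)%N.
  rewrite card_sum !card_ord; apply: (@leq_ltn_trans (p - k.+1 + k)).
    by rewrite leq_add2l.
  by rewrite -[X in (_ < X)%N](subnK (ltn_ord k)) ltn_add2l.
have [t t0 ht] := linear_system_nontrivial a cI.
have tS (j : 'I_p) : (k < j)%N -> t j 0 = 0.
  move=> kj; have jl : (j - k.+1 < p - k.+1)%N by rewrite ltn_sub2r // (leq_ltn_trans kj).
  have := ht (inl (Ordinal jl)); rewrite /= (bigD1 j) //= subnKC // eqxx mul1r.
  by rewrite big1 ?addr0 // => l; rewrite -val_eqE /= => /negbTE ->; rewrite mul0r.
have Ut0 : U *m t != 0.
  by apply: contra t0 => /eqP h; rewrite -[t]mul1mx -UU -mulmxA h mulmx0.
have /hV /(_ Ut0) : forall l : 'I_r, (l < dd)%N -> (mxH V *m (U *m t)) l 0 = 0.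
  move=> l ldd; rewrite mulmxA mxE.
  by have := ht (inr (Ordinal ldd)); rewrite /= valK.
rewrite eigen_n2 eigen_qf mulr_sumr; apply/negP; rewrite -leNgt.
rewrite mulmxA UU mul1mx; apply: ler_sum => l _.
have [lk|kl] := leqP l k; last by rewrite tS // cabs0 expr0n !mulr0.
by rewrite ler_wpM2r ?sqr_ge0 // (le_trans lax) // la_noninc.
Qed.
End EigenvalueCounting.

(** * Linearization of the spiked model *)

Section Linearization.
Variable R : realType.
Local Notation C := R[i].
Local Notation Re := (@complex.Re R).
Local Notation Im := (@complex.Im R).

Lemma dot_col p q (a a' : 'cV[C]_p) (b b' : 'cV[C]_q) :
  dot (col_mx a b) (col_mx a' b') = dot a a' + dot b b'.
Proof. by rewrite /dot mxH_col mul_row_col mxE. Qed.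

Variables (p q r : nat) (X : 'M[C]_(p, q)) (U : 'M[C]_(p, r)) (V : 'M[C]_(q, r)).
Variables (om : 'I_r -> R) (x : R) (Q : 'M[C]_p).
Hypotheses (HQ : (X *m mxH X - (cR x)%:M) *m Q = 1%:M) (QH : mxH Q = Q).

Definition spiked := X + U *m rdiag om *m mxH V.
Local Notation Sg := spiked.
Definition linA : 'M[C]_(p + q) := block_mx (- (cR x)%:M) X (mxH X) (- 1%:M).
Definition linAinv : 'M[C]_(p + q) :=
  block_mx Q (Q *m X) (mxH X *m Q) (mxH X *m Q *m X - 1%:M).
Definition linB : 'M[C]_(p + q, r + r) := block_mx U 0 0 V.
Definition linJ : 'M[C]_(r + r) := block_mx 0 (rdiag om) (rdiag om) 0.
Definition linG : 'M[C]_(r + r) :=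
  block_mx (mxH U *m Q *m U) (mxH U *m (Q *m X) *m V)
    (mxH V *m (mxH X *m Q) *m U) (mxH V *m (mxH X *m Q *m X) *m V - mxH V *m V).
Definition linS : 'M[C]_(p + q) := block_mx (- (cR x)%:M) Sg (mxH Sg) (- 1%:M).

Lemma linA_inv : linA *m linAinv = 1%:M.
Proof.
have h : X *m (mxH X *m Q) - cR x *: Q = 1%:M.
  by rewrite -HQ mulmxBl mul_scalar_mx mulmxA.
rewrite /linA /linAinv mulmx_block scalar_mx_block; congr block_mx.
- by rewrite mulNmx mul_scalar_mx addrC.
- rewrite mulNmx mul_scalar_mx mulmxBr mulmx1 !mulmxA scalemxAl addrA -mulNmx -mulmxDl.
  by rewrite addrC -mulmxA addrC [- _ + _]addrC h mul1mx subrr.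
- by rewrite mulNmx mul1mx subrr.
- by rewrite mulNmx mul1mx opprB addrC mulmxA subrK.
Qed.

Lemma linAinvH : mxH linAinv = linAinv.
Proof.
rewrite /linAinv mxH_block QH !mxHM mxHK QH mxHB mxH1 !mxHM mxHK QH.
by rewrite mulmxA.
Qed.

Lemma linBAB : mxH linB *m linAinv *m linB = linG.
Proof.
rewrite /linB /linAinv /linG mxH_block !mxH0 !mulmx_block.
rewrite !(mul0mx, mulmx0, addr0, add0r) mulmxBr mulmx1 mulmxBl.
by [].
Qed.

Lemma linS_E : linA + linB *m linJ *m mxH linB = linS.
Proof.
rewrite /linB /linJ /linA /linS mxH_block !mxH0 !mulmx_block.
rewrite !(mul0mx, mulmx0, addr0, add0r) add_block_mx !addr0; congr block_mx.
by rewrite /spiked mxHD !mxHM mxHK mxH_rdiag mulmxA.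
Qed.

Definition shifted_form (a : 'cV[C]_p) : R :=
  Re (dot a (Sg *m mxH Sg *m a)) - x * n2 a.

(** Completing the square in [b]: the linearized form never exceeds the form of [Y Y^* - x], with
    equality at [b = Y^* a]. The inequality serves [lower_form], the equality [upper_form]. *)
Lemma schur_form (Y : 'M[C]_(p, q)) a b :
  Re (dot (col_mx a b) (block_mx (- (cR x)%:M) Y (mxH Y) (- 1%:M) *m col_mx a b)) =
  Re (dot a (Y *m mxH Y *m a)) - x * n2 a - n2 (b - mxH Y *m a).
Proof.
rewrite mul_block_col dot_col -mulmxA.
have -> : dot a (Y *m (mxH Y *m a)) = dot (mxH Y *m a) (mxH Y *m a) by rewrite dotMr.
rewrite mulNmx mul_scalar_mx mulNmx mul1mx !dotDr !dotNr dotZr.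
have -> : dot a (Y *m b) = dot (mxH Y *m a) b by rewrite dotMr.
set s := mxH Y *m a; rewrite !ReD !ReN ReM !dotvv /=.
rewrite {5}/n2 dotBl !dotBr !ReD !ReN !dotvv /=.
have -> : Re (dot b s) = Re (dot s b) by rewrite dotC ReJ.
rewrite ReD ReN /=.
ring.
Qed.

Lemma linA_le0 : (forall a, n2 (mxH X *m a) <= x * n2 a) ->
  forall w, Re (dot w (linA *m w)) <= 0.
Proof.
move=> h w; rewrite /linA -[w]vsubmxK schur_form.
set a := usubmx w; have := h a.
rewrite -mulmxA dotMr dotvv /=.
by have := n2_ge0 (dsubmx w - mxH X *m a); move: (n2 _) (n2 _) (x * _) => y1 y2 y3; lra.
Qed.

(** At [w = A^-1 B z] the form of [A + B J B^*] involves [A] only through [G = B^* A^-1 B]. *)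
Lemma lower_form (z : 'cV[C]_(r + r)) :
  Re (dot z ((linG + linG *m linJ *m linG) *m z)) <=
  shifted_form (usubmx (linAinv *m linB *m z)).
Proof.
set w := linAinv *m linB *m z.
have <- : dot w (linS *m w) = dot z ((linG + linG *m linJ *m linG) *m z).
  rewrite -linS_E /w -!mulmxA dotMl linAinvH dotMl.
  congr (dot z _).
  rewrite -linBAB mulmxDl mulmxDr mulmxDr mulmxDl; congr (_ + _).
    by rewrite (mulmxA linA) linA_inv mul1mx !mulmxA.
  by rewrite !mulmxA.
by rewrite -[X in linS *m X]vsubmxK -{1}[w]vsubmxK schur_form lerBlDr lerDl n2_ge0.
Qed.

(* For [A <= 0] and every [k], [<w, A w> <= 2 Re <k, B^* w> - <k, B^* A^-1 B k>],
   by expanding the form of [A] at [w - A^-1 B k]; here [k = K B^* w]. *)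
Lemma upper_form (K : 'M[C]_(r + r)) (a : 'cV[C]_p) t :
  (forall w, Re (dot w (linA *m w)) <= 0) ->
  t = col_mx (mxH U *m a) (mxH V *m (mxH Sg *m a)) ->
  shifted_form a <= Re (dot t ((K + mxH K - mxH K *m linG *m K + linJ) *m t)).
Proof.
move=> A0 tE'; pose w := col_mx a (mxH Sg *m a).
have tE : t = mxH linB *m w.
  by rewrite tE' /linB mxH_block !mxH0 mul_block_col !mul0mx addr0 add0r.
have <- : Re (dot w (linS *m w)) = shifted_form a.
  by rewrite schur_form subrr n20 subr0.
rewrite -linS_E mulmxDl dotDr ReD.
have -> : dot w (linB *m linJ *m mxH linB *m w) = dot t (linJ *m t).
  by rewrite -!mulmxA -tE dotMr -tE.
rewrite !mulmxDl mulNmx !dotDr dotNr !ReD ReN lerD2r.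
have := A0 (w - linAinv *m linB *m (K *m t)).
have Ak : linA *m (linAinv *m linB *m (K *m t)) = linB *m (K *m t).
  by rewrite !mulmxA linA_inv mul1mx.
have kA y : dot (linAinv *m linB *m (K *m t)) (linA *m y) = dot (K *m t) (mxH linB *m y).
  rewrite -mulmxA dotMl linAinvH dotMl; congr (dot _ (_ *m _)).
  by rewrite mulmxA (mulmx1C linA_inv) mul1mx.
rewrite mulmxBr dotBl !dotBr !kA Ak dotMr -tE.
have -> : mxH linB *m (linAinv *m linB *m (K *m t)) = linG *m (K *m t).
  by rewrite -linBAB !mulmxA.
have e1 : dot t (mxH K *m t) = dot (K *m t) t by rewrite dotMr mxHK.
have e2 : dot t (mxH K *m linG *m K *m t) = dot (K *m t) (linG *m (K *m t)).
  by rewrite -!mulmxA dotMr mxHK.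
have e3 : Re (dot (K *m t) t) = Re (dot t (K *m t)) by rewrite dotC ReJ.
rewrite e1 e2 !ReD !ReN !ReD !ReN e3.
move: (Re _) (Re _) (Re _) => y1 y2 y3.
lra.
Qed.

Variables (b : 'cV[C]_p) (z : 'cV[C]_(r + r)).
Definition approx_sol := usubmx (linAinv *m (col_mx b 0 - linB *m z)).
Definition approx_err := linJ *m (mxH linB *m linAinv *m col_mx b 0) - (z + linJ *m linG *m z).

(** The lower block of the linearized equation expresses the second component of [f] through
    [approx_sol]; substituting it into the upper block restores [Sigma Sigma^* - x]. *)
Lemma approx_solE : (Sg *m mxH Sg - (cR x)%:M) *m approx_sol =
  b + (U *m usubmx approx_err + Sg *m (V *m dsubmx approx_err)).
Proof.
pose f := linAinv *m (col_mx b 0 - linB *m z).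
have h : linS *m f = col_mx b 0 + linB *m approx_err.
  rewrite -linS_E mulmxDl {1}/f mulmxA linA_inv mul1mx -addrA; congr (_ + _).
  rewrite /approx_err /f mulmxBr mulmxDr !mulmxBr -linBAB !mulmxA opprD addrA.
  by rewrite mulmxBr mulmxN !mulmxA addrA [X in _ = X - _]addrC.
have := h; rewrite /linS /linB -[f]vsubmxK -[X in _ *m X = _]/(col_mx approx_sol _).
rewrite mul_block_col -{1}[approx_err]vsubmxK mul_block_col !mul0mx addr0 add0r add_col_mx add0r.
move/eq_col_mx => [h1 h2].
have e2 : dsubmx f = mxH Sg *m approx_sol - V *m dsubmx approx_err.
  by rewrite -h2 mulNmx mul1mx opprD opprK addrA subrr add0r.
move: h1; rewrite e2 mulmxBr mulmxBl mul_scalar_mx mulNmx mul_scalar_mx.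
by rewrite addrA => /eqP; rewrite subr_eq => /eqP h3; rewrite [b + _]addrA -h3 addrC mulmxA.
Qed.
End Linearization.

(** * Eigenvalue counts and resolvent limits for a sequence of spiked matrices *)

Section SpikedSequence.
Variable R : realType.
Local Notation C := R[i].
Local Notation Re := (@complex.Re R).
Local Notation Im := (@complex.Im R).

Lemma rdiagD p (d e : 'I_p -> R) : rdiag d + rdiag e = rdiag (fun k => d k + e k).
Proof.
rewrite /rdiag -linearD /=; congr diag_mx; apply/rowP => k.
by rewrite !mxE cRD.
Qed.

Lemma rdiagN p (d : 'I_p -> R) : - rdiag d = rdiag (fun k => - d k).
Proof.
rewrite /rdiag -linearN /=; congr diag_mx; apply/rowP => k.
by rewrite !mxE cRN.
Qed.

Lemma eq_rdiag p (d e : 'I_p -> R) : d =1 e -> rdiag d = rdiag e.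
Proof. by move=> h; congr rdiag; apply/funext. Qed.

Lemma rdiag0 p : rdiag (fun _ : 'I_p => 0 : R) = 0.
Proof. by rewrite rdiag_cst raddf0. Qed.

Lemma rdiag1 p : rdiag (fun _ : 'I_p => 1 : R) = 1%:M.
Proof. exact: rdiag_cst. Qed.

Definition dsum p q (a : 'I_p -> R) (b : 'I_q -> R) (k : 'I_(p + q)) :=
  match fintype.split k with inl l => a l | inr l => b l end.

Lemma block_rdiag p q (a : 'I_p -> R) (b : 'I_q -> R) :
  block_mx (rdiag a) 0 0 (rdiag b) = rdiag (dsum a b).
Proof.
apply/matrixP => k l.
have sl (u : 'I_p) : fintype.split (lshift q u) = inl u by exact: (unsplitK (inl u)).
have sr (u : 'I_q) : fintype.split (rshift p u) = inr u by exact: (unsplitK (inr u)).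
case: (split_ordP k) => k' ->; case: (split_ordP l) => l' ->.
- by rewrite block_mxEul /rdiag !mxE /dsum sl (inj_eq (@lshift_inj _ _)).
- by rewrite block_mxEur /rdiag !mxE eq_lrshift mulr0n.
- by rewrite block_mxEdl /rdiag !mxE eq_rlshift mulr0n.
- by rewrite block_mxEdr /rdiag !mxE /dsum sr (inj_eq (@rshift_inj _ _)).
Qed.

Lemma dot_congr k l (T : 'M[C]_(k, l)) M t :
  dot t (mxH T *m M *m T *m t) = dot (T *m t) (M *m (T *m t)).
Proof. by rewrite -mulmxA -mulmxA dotMr mxHK. Qed.

Lemma approx_sol_expand p' q' r' (X : 'M[C]_(p', q')) (U : 'M[C]_(p', r')) (V : 'M[C]_(q', r'))
    (Q : 'M[C]_p') (b : 'cV[C]_p') (z : 'cV[C]_(r' + r')) :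
  approx_sol X U V Q b z =
  Q *m b - (Q *m (U *m usubmx z) + Q *m (X *m (V *m dsubmx z))).
Proof.
rewrite /approx_sol mulmxBr linearB /= /linAinv /linB mul_block_col mulmx0 addr0 col_mxKu.
rewrite -{1}[z]vsubmxK mul_block_col !mul0mx addr0 add0r mul_block_col col_mxKu.
by rewrite !mulmxA.
Qed.

Variables (r : nat) (p q : nat -> nat) (X : forall n, 'M[C]_(p n, q n))
  (Q : forall n, 'M[C]_(p n)) (U : forall n, 'M[C]_(p n, r)) (V : forall n, 'M[C]_(q n, r))
  (om : nat -> 'I_r -> R) (om0 : 'I_r -> R) (x th m w : R).
Hypotheses (HQ : \forall n \near \oo, (X n *m mxH (X n) - (cR x)%:M) *m Q n = 1%:M)
  (QH : forall n, mxH (Q n) = Q n)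
  (th0 : 0 <= th) (thx : th < x)
  (HX : \forall n \near \oo, (forall a, n2 (mxH (X n) *m a) <= th * n2 a) /\
     (forall v, n2 (X n *m v) <= th * n2 v))
  (UU : \forall n \near \oo, mxH (U n) *m U n = 1%:M)
  (VV : \forall n \near \oo, mxH (V n) *m V n = 1%:M)
  (Hom : forall k, (fun n => om n k) @ \oo --> om0 k)
  (m0 : m < 0) (w0 : w < 0)
  (limLL : mconv (fun n => mxH (U n) *m Q n *m U n) (cR m)%:M)
  (limLR : mconv (fun n => mxH (U n) *m (Q n *m X n) *m V n) 0)
  (limRR : mconv (fun n => mxH (V n) *m (mxH (X n) *m Q n *m X n) *m V n) (cR (1 + w))%:M).
Let g := m * w.
Let Sg n := spiked (X n) (U n) (V n) (om n).
Let G n := linG (X n) (U n) (V n) (Q n).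
Let G0 : 'M[C]_(r + r) := block_mx (rdiag (fun=> m)) 0 0 (rdiag (fun=> w)).
Let J0 : 'M[C]_(r + r) := linJ om0.

Lemma linJ_cvg : mconv (fun n => linJ (om n)) J0.
Proof.
apply: mconv_block; [exact: mconv_cst| | |exact: mconv_cst].
all: exact: mconv_rdiag.
Qed.

Lemma linG_cvg : mconv G G0.
Proof.
apply: mconv_block; first by rewrite rdiag_cst.
- exact: limLR.
- have := mconvH limLR; rewrite mxH0; apply: mconv_near; apply: nearW => n.
  by rewrite !mxHM QH mxHK mulmxA.
- have -> : rdiag (fun=> w) = (cR (1 + w))%:M - 1%:M :> 'M[C]_r.
    by rewrite rdiag_cst -raddfB /= cRD (_ : cR 1 = 1) // addrC addKr.
  apply: mconvB => //; apply: mconv_near (mconv_cst 1%:M).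
  by apply: filterS VV => n ->.
Qed.

Section Counting.
Variables (lh : forall n, 'I_(p n) -> R) (uh : forall n, 'M[C]_(p n)).
Hypotheses (uhU : forall n, mxH (uh n) *m uh n = 1%:M)
  (uhE : \forall n \near \oo, Sg n *m mxH (Sg n) *m uh n = uh n *m rdiag (@lh n))
  (lh_noninc : forall n (k k' : 'I_(p n)), (k <= k')%N -> lh k' <= lh k).
Arguments lh : clear implicits.
Variable dd : nat.

(* [T0] and [T1] diagonalise the limits of the quadratic forms in [lower_form] and
   [upper_form]. *)
Let T0 : 'M[C]_(r + r, r) := col_mx (rdiag (fun=> 1)) (rdiag (fun k => - (m * om0 k))).

(** For a given first block [u], the limiting form [m |u|^2 + w |v|^2 + 2 m w om Re <u, v>] is
    largest at [v = - m om u], because [w < 0]; this is the choice made in [T0]. *)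
Lemma lower_limit : mxH T0 *m (G0 + G0 *m J0 *m G0) *m T0 =
  rdiag (fun k => m * (1 - om0 k ^+ 2 * g)).
Proof.
rewrite /T0 /G0 /J0 /linJ mxH_col !mxH_rdiag !mulmx_block add_block_mx.
rewrite mul_row_block mul_row_col !(mul0mx, mulmx0, addr0, add0r) !rdiagM.
rewrite !rdiagD !rdiagM rdiagD; apply: eq_rdiag => k /=; rewrite /g.
by ring.
Qed.

(** As [m < 0], the limit [m (1 - om^2 g)] is positive exactly for the supercritical indices, and
    the test vectors [A^-1 B T0 t] supported on them feed [eigenvalues_gt]. *)
Lemma eigenvalues_eventually_gt : (dd <= r)%N ->
  (forall k : 'I_r, (k < dd)%N -> 1 < om0 k ^+ 2 * g) ->
  \forall n \near \oo, forall k : 'I_(p n), (k < dd)%N -> x < lh n k.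
Proof.
move=> ddr hdd.
have hM : mconv (fun n => mxH T0 *m (G n + G n *m linJ (om n) *m G n) *m T0)
    (rdiag (fun k => m * (1 - om0 k ^+ 2 * g))).
  rewrite -lower_limit; apply: mconvM; last exact: mconv_cst.
  apply: mconvM; first exact: mconv_cst.
  apply: mconvD; first exact: linG_cvg.
  by apply: mconvM linG_cvg; apply: mconvM linG_cvg linJ_cvg.
have := @pos_eventually _ _ _ _ (fun k : 'I_r => (k < dd)%N) hM.
have h0 (k : 'I_r) : (k < dd)%N -> 0 < m * (1 - om0 k ^+ 2 * g).
  by move=> /hdd h; rewrite nmulr_rgt0 // subr_lt0.
move=> /(_ h0); apply: filterS2 (filterI HQ uhE) => n [hQ hE] ht.
apply: (@eigenvalues_gt _ _ _ _ _ (uhU n) hE (@lh_noninc n) r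
  (usubmx (linAinv (X n) (Q n) *m linB (U n) (V n) *m T0)) dd x ddr) => t tS t0.
have := ht t _ t0 => /(_ _)/wrap[k|h1]; first by rewrite -leqNgt; exact: tS.
have h2 := lower_form (U n) (V n) (om n) hQ (QH n) (T0 *m t).
rewrite /shifted_form in h2.
rewrite mul_usub_mx -[_ *m T0 *m t]mulmxA -subr_gt0.
by rewrite dot_congr in h1; exact: lt_le_trans h1 h2.
Qed.

Let T1 : 'M[C]_(r + r) :=
  block_mx (rdiag (fun=> 1)) 0 (rdiag (fun k => - (w * om0 k))) (rdiag (fun=> 1)).
Let T2 : 'M[C]_(r + r) :=
  block_mx (rdiag (fun=> 1)) 0 (rdiag (fun k => w * om0 k)) (rdiag (fun=> 1)).
Let K0 : 'M[C]_(r + r) := block_mx (rdiag (fun=> m^-1)) 0 0 (rdiag (fun=> w^-1)).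
Let Dup : 'I_(r + r) -> R :=
  dsum (fun k : 'I_r => - ((1 - om0 k ^+ 2 * g) / m)) (fun k : 'I_r => - w^-1).

Lemma T1K : T1 *m T2 = 1%:M.
Proof.
rewrite /T1 /T2 mulmx_block !(mul0mx, mulmx0, addr0, add0r) !rdiagM.
rewrite rdiagD scalar_mx_block; congr block_mx.
- by rewrite -rdiag1; apply: eq_rdiag => k; rewrite mulr1.
- by rewrite -rdiag0; apply: eq_rdiag => k; rewrite mulr1 mul1r addNr.
- by rewrite -rdiag1; apply: eq_rdiag => k; rewrite mulr1.
Qed.

(** [K0] is the inverse of [G0], the choice that minimises the limiting bound of [upper_form]
    because [G0] is negative definite. What remains is [K0 + J0], and [T1] completes the square in
    the second block. *)
Lemma upper_limit : - (mxH T1 *m (K0 + mxH K0 - mxH K0 *m G0 *m K0 + J0) *m T1) = rdiag Dup.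
Proof.
have m1 : m != 0 by rewrite lt_eqF.
have w1 : w != 0 by rewrite lt_eqF.
have KH : mxH K0 = K0 by rewrite /K0 mxH_block !mxH0 !mxH_rdiag.
have KG : K0 *m G0 *m K0 = K0.
  rewrite /K0 /G0 !mulmx_block !(mul0mx, mulmx0, addr0, add0r) !rdiagM.
  by congr block_mx; apply: eq_rdiag => k; rewrite mulVf ?mul1r.
rewrite KH KG addrK /T1 mxH_block !mxH0 !mxH_rdiag /K0 /J0 /linJ add_block_mx !(addr0, add0r).
rewrite !mulmx_block !(mul0mx, mulmx0, addr0, add0r) !(rdiagM, rdiagD).
rewrite opp_block_mx !rdiagN /Dup -block_rdiag; congr block_mx.
- by apply: eq_rdiag => k; rewrite /g; field; rewrite ?m1 ?w1.
- by rewrite -rdiag0; apply: eq_rdiag => k; field; rewrite ?m1 ?w1.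
- by rewrite -rdiag0; apply: eq_rdiag => k; field; rewrite ?m1 ?w1.
- by apply: eq_rdiag => k; rewrite mul1r mulr1.
Qed.

(** [T2], the inverse of [T1], leaves the first block [U^* a] unchanged. So [dd] linear conditions
    on [a] remove the supercritical coordinates, while the second block is negative on all of its
    coordinates. *)
Lemma eigenvalues_eventually_lt :
  (forall k : 'I_r, (dd <= k)%N -> om0 k ^+ 2 * g < 1) ->
  \forall n \near \oo, forall k : 'I_(p n), (dd <= k)%N -> lh n k < x.
Proof.
move=> hdd.
have hM : mconv (fun n => - (mxH T1 *m (K0 + mxH K0 - mxH K0 *m G n *m K0 + linJ (om n)) *m T1))
    (rdiag Dup).
  rewrite -upper_limit; apply: mconvN; apply: mconvM; last exact: mconv_cst.
  apply: mconvM; first exact: mconv_cst.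
  apply: mconvD; last exact: linJ_cvg.
  apply: mconvB; first exact: mconv_cst.
  apply: mconvM; last exact: mconv_cst.
  by apply: mconvM; [exact: mconv_cst|exact: linG_cvg].
pose S (k : 'I_(r + r)) := match fintype.split k with inl l => (dd <= l)%N | inr _ => true end.
have hD k : S k -> 0 < Dup k.
  rewrite /S /Dup /dsum; case: (fintype.split k) => l.
    by move=> /hdd h; rewrite oppr_gt0 pmulr_rlt0 ?subr_gt0 // invr_lt0.
  by rewrite oppr_gt0 invr_lt0.
have := pos_eventually hM hD.
apply: filterS3 (filterI HQ uhE) HX => n [hQ hE] [hX _] ht.
apply: (@eigenvalues_lt _ _ _ _ _ (uhU n) hE (@lh_noninc n) r (U n) dd x) => a ha a0.
pose t := col_mx (mxH (U n) *m a) (mxH (V n) *m (mxH (Sg n) *m a)).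
have na := n2_gt0 a0.
have t12 : T1 *m (T2 *m t) = t by rewrite mulmxA T1K mul1mx.
have hA : forall w', Re (dot w' (linA (X n) x *m w')) <= 0.
  apply: linA_le0 => a'; apply: le_trans (hX a') _.
  by rewrite ler_wpM2r ?n2_ge0 // ltW.
have hup : shifted_form (X n) (U n) (V n) (om n) x a <=
   Re (dot t ((K0 + mxH K0 - mxH K0 *m G n *m K0 + linJ (om n)) *m t)).
  exact: (upper_form hQ (QH n) K0 hA).
rewrite -subr_lt0 -/(shifted_form _ _ _ _ _ _).
(* The fixed-size form says nothing when [t = 0]. Then [U^* a = 0], so [Sigma^* a = X^* a], and the
   norm bound [th < x] on [X] decides. *)
have [s0|s0] := eqVneq (T2 *m t) 0.
  have /eqP : t = 0 by rewrite -t12 s0 mulmx0.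
  rewrite col_mx_eq0 => /andP[/eqP u0 _].
  have Sa : mxH (Sg n) *m a = mxH (X n) *m a.
    by rewrite /Sg /spiked mxHD !mxHM mulmxDl -!mulmxA u0 !mulmx0 addr0.
  rewrite /shifted_form -mulmxA dotMr Sa dotvv /=.
  apply: le_lt_trans (lerB (hX a) (lexx _)) _.
  by rewrite -mulrBl pmulr_llt0 // subr_lt0.
apply: le_lt_trans hup _; rewrite -oppr_gt0 -ReN -dotNr -mulNmx.
have h := ht (T2 *m t) _ s0.
rewrite mulNmx dotNr dot_congr t12 -dotNr -mulNmx in h; apply: h => k.
rewrite /S; case: (fintype.splitP k) => // l kl; rewrite -ltnNge => /ha.
have -> : k = lshift r l by apply: val_inj.
by rewrite /T2 /t mul_block_col col_mxEu rdiag1 mul1mx mul0mx addr0.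
Qed.
End Counting.

Section Resolvent.
Variables (b b' : forall n, 'cV[C]_(p n)) (B : R).
Hypotheses (nb : \forall n \near \oo, n2 (b n) <= B) (nb' : \forall n \near \oo, n2 (b' n) <= B)
  (hUb : mconv (fun n => mxH (U n) *m (Q n *m b n) - cR m *: (mxH (U n) *m b n)) 0)
  (hVb : mconv (fun n => mxH (V n) *m (mxH (X n) *m (Q n *m b n))) 0)
  (hUb' : mconv (fun n => mxH (U n) *m (Q n *m b' n) - cR m *: (mxH (U n) *m b' n)) 0)
  (hVb' : mconv (fun n => mxH (V n) *m (mxH (X n) *m (Q n *m b' n))) 0)
  (hbb : csmall (fun n => dot (b' n) (Q n *m b n) - cR m * dot (b' n) (b n)))
  (Hcrit : forall k, om0 k ^+ 2 * g != 1).
Let a1 k := om0 k ^+ 2 * g / (om0 k ^+ 2 * g - 1).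
Let a2 k := om0 k * m / (1 - om0 k ^+ 2 * g).
Let Zm : 'M[C]_(r + r, r) := col_mx (rdiag a1) (rdiag a2).
Let M0 : 'M[C]_(r + r, r) := col_mx (rdiag (fun=> m)) 0.
Let c n := mxH (U n) *m b n.
Let a n := approx_sol (X n) (U n) (V n) (Q n) (b n) (Zm *m c n).
Let err n := approx_err (X n) (U n) (V n) (om n) (Q n) (b n) (Zm *m c n).

(* [Zm c] solves the limiting system [(1 + J0 G0) z = J0 M0 c]. *)
Lemma critical_system : J0 *m M0 - (Zm + J0 *m G0 *m Zm) = 0.
Proof.
have h1 k : 1 - om0 k ^+ 2 * g != 0 by rewrite subr_eq0 eq_sym.
have h2 k : om0 k ^+ 2 * g - 1 != 0 by rewrite subr_eq0.
rewrite /J0 /linJ /M0 /G0 /Zm mulmx_block !mul_block_col !(mul0mx, mulmx0, addr0, add0r).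
rewrite !rdiagM add_col_mx opp_col_mx add_col_mx !rdiagD !rdiagN add0r !rdiagD.
rewrite -[RHS]col_mx0; congr col_mx; rewrite -rdiag0; apply: eq_rdiag => k.
  rewrite /a1 /a2; have := h1 k; have := h2 k; rewrite /g => h3 h4.
  by field; rewrite h3 h4.
by rewrite /a1 /a2; have := h1 k; have := h2 k; rewrite /g => h3 h4; field; rewrite h3 h4.
Qed.

Lemma mbnd_UH (v : forall n, 'cV[C]_(p n)) : (\forall n \near \oo, n2 (v n) <= B) ->
  mbnd (fun n => mxH (U n) *m v n) (Num.sqrt B).
Proof.
apply: filterS2 UU => n Un vB k l; rewrite ord1.
have B0 : 0 <= B by apply: le_trans (n2_ge0 _) vB.
rewrite -(@ler_pXn2r _ 2) ?nnegrE ?cabs_ge0 ?sqrtr_ge0 // [leRHS]sqr_sqrtr //.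
apply: le_trans vB; apply: le_trans (n2_isomH_le (v n) Un).
rewrite [leRHS]n2E (bigD1 k) //= lerDl.
by apply: sumr_ge0 => ? _; exact: sqr_ge0.
Qed.

Lemma err_cvg : mconv err 0.
Proof.
pose vv n := col_mx (mxH (U n) *m (Q n *m b n)) (mxH (V n) *m (mxH (X n) *m (Q n *m b n))).
have h1 : mconv (fun n => vv n - M0 *m c n) 0.
  rewrite -[X in mconv _ X]col_mx0.
  apply: mconv_near (mconv_col hUb hVb); apply: nearW => n.
  rewrite /vv /M0 mul_col_mx mul0mx opp_col_mx add_col_mx oppr0 addr0 rdiag_cst.
  by rewrite mul_scalar_mx.
have h2 : mconv (fun n => linJ (om n) *m M0 - (Zm + linJ (om n) *m G n *m Zm)) 0.
  rewrite -critical_system; apply: mconvB.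
    by apply: mconvM; [exact: linJ_cvg|exact: mconv_cst].
  apply: mconvD; first exact: mconv_cst.
  apply: mconvM; last exact: mconv_cst.
  by apply: mconvM; [exact: linJ_cvg|exact: linG_cvg].
have h3 := mconvD (mconvM linJ_cvg h1) (mconv0_bndM h2 (mbnd_UH nb)).
rewrite mulmx0 addr0 in h3; apply: mconv_near h3; apply: nearW => n.
rewrite /err /approx_err.
have -> : mxH (linB (U n) (V n)) *m linAinv (X n) (Q n) *m col_mx (b n) 0 = vv n.
  rewrite /linB /linAinv mxH_block !mxH0 mulmx_block !(mul0mx, addr0, add0r) mul_block_col.
  by rewrite !mulmx0 !addr0 /vv !mulmxA.
rewrite -/(c n) mulmxBr mulmxBl mulmxDl !mulmxA addrA subrK.
by rewrite /G.
Qed.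

Lemma residual_cvg e : 0 < e ->
  \forall n \near \oo, n2 ((Sg n *m mxH (Sg n) - (cR x)%:M) *m a n - b n) < e.
Proof.
move=> e0.
have B1 := mconv_cst (row_mx 1%:M 0 : 'M[C]_(r, r + r)).
have B2 := mconv_cst (row_mx 0 1%:M : 'M[C]_(r, r + r)).
have cu : mconv (fun n => usubmx (err n)) 0.
  have := mconvM B1 err_cvg; rewrite mulmx0; apply: mconv_near; apply: nearW => n.
  by rewrite -{1}[err n]vsubmxK mul_row_col mul1mx mul0mx addr0.
have cd : mconv (fun n => dsubmx (err n)) 0.
  have := mconvM B2 err_cvg; rewrite mulmx0; apply: mconv_near; apply: nearW => n.
  by rewrite -{1}[err n]vsubmxK mul_row_col mul1mx mul0mx add0r.
have co : mconv (fun n => rdiag (om n) *m dsubmx (err n)) 0.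
  by have := mconvM (mconv_rdiag Hom) cd; rewrite mulmx0.
(* Two uses of [|u + v|^2 <= 2 (|u|^2 + |v|^2)] give the weights 2, [4 th] and 4 to the pieces
   through [U], [X V] and [U Om]. *)
pose K := 2 + 4 * th + 4.
have K0 : 0 < K by rewrite /K; have := th0; lra.
have e1 : 0 < e / K by exact: divr_gt0.
have hn := filterI (mconv0_n2 cu e1) (filterI (mconv0_n2 cd e1) (mconv0_n2 co e1)).
apply: filterS3 (filterI UU VV) (filterI HQ HX) (hn _ _) => n [Un Vn] [hQ [_ hX]] [h1 [h2 h3]].
rewrite /a approx_solE // addrC addKr -/(err n).
apply: le_lt_trans (n2D_le _ _) _.
rewrite n2_isom // /spiked mulmxDl -[U n *m _ *m _ *m _]mulmxA [mxH (V n) *m _]mulmxA Vn mul1mx.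
have h4 := n2D_le (X n *m (V n *m dsubmx (err n))) (U n *m rdiag (om n) *m dsubmx (err n)).
rewrite -[U n *m _ *m _]mulmxA (n2_isom _ Un) in h4.
have h5 := hX (V n *m dsubmx (err n)); rewrite (n2_isom _ Vn) in h5.
have h6 : th * n2 (dsubmx (err n)) <= th * (e / K) by apply: ler_wpM2l => //; exact: ltW.
have -> : e = K * (e / K) by rewrite mulrCA divff ?mulr1 // gt_eqF.
rewrite /K -[U n *m _ *m _]mulmxA.
move: h1 h3 h4 h5 h6; move: (e / K) (n2 (usubmx _)) (n2 (rdiag _ *m _)) (n2 (_ + _))
  (n2 (X n *m _)) (th * n2 _) => y1 y2 y3 y4 y5 y6.
lra.
Qed.

(** The part of the solution carried by [V] disappears, since [<V^* X^* Q b', .>] tends to 0; only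
    the weights [a1] survive, multiplied by [m]. *)
Lemma approx_sol_cvg : csmall (fun n => dot (b' n) (a n) -
  cR m * (dot (b' n) (b n) - dot (mxH (U n) *m b' n) (rdiag a1 *m (mxH (U n) *m b n)))).
Proof.
have small (u : nat -> 'cV[C]_r) d : mconv u 0 -> csmall (fun n => dot (u n) (rdiag d *m c n)).
  move=> hu; have h := mconvM (mconvH hu) (mconv_cst (rdiag d)); rewrite mxH0 mul0mx in h.
  apply: csmall_near (mconv0_bndM h (mbnd_UH nb) 0 0).
  by apply: nearW => n; rewrite -/(c n) [X in _ - X]mxE subr0 /dot mulmxA.
apply: csmall_near (csmallB hbb (csmallD (small _ a1 hUb') (small _ a2 hVb'))).
apply: nearW => n; rewrite /a approx_sol_expand /Zm mul_col_mx col_mxKu col_mxKd.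
have e1 y : dot (b' n) (Q n *m (U n *m y)) = dot (mxH (U n) *m (Q n *m b' n)) y.
  by rewrite dotMr QH dotMr.
have e2 y : dot (b' n) (Q n *m (X n *m (V n *m y))) =
    dot (mxH (V n) *m (mxH (X n) *m (Q n *m b' n))) y.
  by rewrite dotMr QH !dotMr.
rewrite dotBr dotDr e1 e2 -/(c n) dotBl dotZl conjc_cR.
by ring.
Qed.

Lemma approx_resolvent : exists a' : forall n, 'cV[C]_(p n),
  (forall e, 0 < e ->
     \forall n \near \oo, n2 ((Sg n *m mxH (Sg n) - (cR x)%:M) *m a' n - b n) < e) /\
  csmall (fun n => dot (b' n) (a' n) -
    cR m * (dot (b' n) (b n) - dot (mxH (U n) *m b' n) (rdiag a1 *m (mxH (U n) *m b n)))).
Proof. by exists a; split; [exact: residual_cvg|exact: approx_sol_cvg]. Qed.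
End Resolvent.
End SpikedSequence.

(** * Spectral projections *)

Section SpectralProjection.
Variable R : realType.
Local Notation C := R[i].
Local Notation Re := (@complex.Re R).
Local Notation Im := (@complex.Im R).

Lemma vnorm_rdiag_le p (dg : 'I_p -> R) K (v : 'cV[C]_p) :
  0 <= K -> (forall k, `|dg k| <= K) -> vnorm (rdiag dg *m v) <= K * vnorm v.
Proof.
move=> K0 hK; rewrite -(@ler_pXn2r _ 2) ?nnegrE ?vnorm_ge0 ?mulr_ge0 ?vnorm_ge0 //.
by rewrite exprMn !sqr_vnorm; exact: n2_rdiag_le.
Qed.

Lemma n2_unitaryH p (U : 'M[C]_p) (v : 'cV[C]_p) : mxH U *m U = 1%:M -> n2 (mxH U *m v) = n2 v.
Proof. by move=> h; rewrite n2_isom // mxHK UUH. Qed.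

Variables (p : nat) (M U : 'M[C]_p) (la : 'I_p -> R).
Hypotheses (UU : mxH U *m U = 1%:M) (MU : M *m U = U *m rdiag la).
Variables (S : pred 'I_p) (rho eta ka : R).
Hypotheses (eta0 : 0 < eta) (eta1 : eta <= 1) (etaka : eta <= ka / 2)
  (hS : forall k, S k -> `|la k - rho| <= eta ^+ 2 / 2)
  (hNS : forall k, ~~ S k -> ka <= `|la k - rho|).
Let K := 1 + 2 / ka.
Let chi k : R := (S k)%:R.
(* The eigenvalues of [- eta (M - (rho + eta))^-1]. *)
Let f k := eta / (eta - (la k - rho)).

Let ka0 : 0 < ka. Proof. by have := eta0; have := etaka; lra. Qed.

(** The resolvent is evaluated at distance [eta] from [rho], so the block must be located more
    finely, within [eta^2 / 2], for its weight to be [1 + O(eta)]. Outside the block the gap [ka]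
    gives [O(eta)]. The summands 1 and [2 / ka] of [K] serve these two cases. *)
Lemma residue_weight k : (eta - (la k - rho) != 0) /\ `|chi k - f k| <= K * eta.
Proof.
have [e0 e1 eka k0] := And4 eta0 eta1 etaka ka0; set u := la k - rho.
have K1 : K * eta = eta + 2 * eta / ka by rewrite /K mulrDl mul1r mulrAC.
have r0 : 0 <= 2 * eta / ka by rewrite divr_ge0 ?mulr_ge0 ?ltW.
rewrite /chi /f -/u; have [Sk|Sk] := boolP (S k).
  have := hS Sk; rewrite -/u ler_norml => /andP[u1 u2].
  have h : eta ^+ 2 <= eta by rewrite expr2 ler_piMr // ltW.
  have d0 : eta / 2 <= eta - u by lra.
  have dp : 0 < eta - u by lra.
  split; first by rewrite gt_eqF.
  have -> : true%:R - eta / (eta - u) = - (u / (eta - u)).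
    have aux (v : R) : eta - v != 0 -> 1 - eta / (eta - v) = - (v / (eta - v)) by move=> h'; field.
    exact: aux (lt0r_neq0 dp).
  rewrite normrN normrM normfV (gtr0_norm dp) ler_pdivrMr //.
  have u3 : `|u| <= eta ^+ 2 / 2 by rewrite ler_norml u1 u2.
  apply: le_trans u3 _.
  have : 0 <= (2 * eta / ka) * (eta - u) by rewrite mulr_ge0 // ltW.
  have : eta * (eta / 2) <= eta * (eta - u) by rewrite ler_wpM2l // ltW.
  rewrite K1 (mulrDl eta) expr2.
  by move: (2 * eta / ka * (eta - u)) (eta * (eta - u)) => y1 y2; lra.
have := hNS Sk; rewrite -/u => uk.
have d1 : ka / 2 <= `|eta - u|.
  have := ler_normD (u - eta) eta; rewrite subrK (distrC u) (gtr0_norm e0).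
  by move: `|_ - u| `|u| uk => y1 y2; lra.
have dp : 0 < `|eta - u| by apply: lt_le_trans d1; exact: divr_gt0.
split; first by rewrite -normr_gt0.
rewrite sub0r normrN normrM normfV (gtr0_norm e0) ler_pdivrMr //.
apply: (@le_trans _ _ (2 * eta / ka * (ka / 2))).
  by rewrite le_eqVlt; apply/orP; left; apply/eqP; field; rewrite gt_eqF.
apply: ler_pM => //; first by rewrite divr_ge0 // ltW.
by rewrite K1 lerDr ltW.
Qed.

(** If [(M - (rho + eta)) a = b + e], then in the eigenbasis [- eta a] is [f] applied to [b + e].
    The weights [f] are within [K eta] of the indicator of the block and are bounded by [1 + K eta],
    which controls the residual [e]. *)
Lemma spectral_projection_approx (a b b' : 'cV[C]_p) :
  cabs (dot b' (U *m rdiag chi *m mxH U *m b) + cR eta * dot b' a) <=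
  vnorm b' * (K * eta * vnorm b + (1 + K * eta) * vnorm ((M - (cR (rho + eta))%:M) *m a - b)).
Proof.
set e := _ - b.
have Ke0 : 0 <= K * eta.
  by rewrite mulr_ge0 ?addr_ge0 ?divr_ge0 // ltW.
have fk k : `|f k| <= 1 + K * eta.
  have [_ h] := residue_weight k.
  have -> : f k = chi k - (chi k - f k) by rewrite opprB addrC subrK.
  apply: le_trans (ler_normB _ _) _; apply: lerD => //.
  by rewrite /chi; case: (S k); rewrite ?normr1 ?normr0.
have hE : M = U *m rdiag la *m mxH U by exact: eigenE.
have UH := UUH UU.
have ae : cR eta *: (mxH U *m a) = - (rdiag f *m (mxH U *m b + mxH U *m e)).
  have -> : mxH U *m b + mxH U *m e = rdiag (fun k => la k - (rho + eta)) *m (mxH U *m a).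
    rewrite -mulmxDr /e addrC subrK hE mulmxBl mulmxBr -rdiagB mulmxBl rdiag_cst.
    by congr (_ - _); [rewrite !mulmxA UU mul1mx|rewrite !mul_scalar_mx scalemxAr].
  rewrite mulmxA rdiagM -mulNmx rdiagN -mul_scalar_mx -rdiag_cst.
  congr (_ *m _); apply: eq_rdiag => k; have [d0 _] := residue_weight k.
  by rewrite /f; field.
have -> : cR eta * dot b' a = dot (mxH U *m b') (cR eta *: (mxH U *m a)).
  by rewrite dotZr dotMl mxHK mulmxA UH mul1mx.
move: (e) ae => e' ->; rewrite -!mulmxA dotMr mulmxDr dotNr.
have -> : dot (mxH U *m b') (rdiag chi *m (mxH U *m b)) -
    dot (mxH U *m b') (rdiag f *m (mxH U *m b) + rdiag f *m (mxH U *m e')) =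
  dot (mxH U *m b') (rdiag (fun k => chi k - f k) *m (mxH U *m b)) -
  dot (mxH U *m b') (rdiag f *m (mxH U *m e')).
  by rewrite -rdiagB mulmxBl dotBr dotDr opprD addrA.
have vU v : vnorm (mxH U *m v) = vnorm v by rewrite !vnormE n2_unitaryH.
apply: le_trans (cabsB _ _) _; rewrite mulrDr; apply: lerD.
  apply: le_trans (cauchy_schwarz _ _) _; rewrite vU ler_wpM2l ?vnorm_ge0 // -(vU b).
  by apply: vnorm_rdiag_le => // k; case: (residue_weight k).
apply: le_trans (cauchy_schwarz _ _) _; rewrite vU ler_wpM2l ?vnorm_ge0 // -(vU e').
by apply: vnorm_rdiag_le => //; rewrite addr_ge0.
Qed.
End SpectralProjection.

(** * Blocks of indices as intervals between partial sums of the multiplicities *)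

Section Blocks.
Variables (s : nat) (j : 'I_s -> nat).
Let psum t := (\sum_(l < s | (l < t)%N) j l)%N.

Lemma psum_le t t' : (t <= t')%N -> (psum t <= psum t')%N.
Proof.
move=> tt'; rewrite /psum [leqRHS](bigID (fun l : 'I_s => (l < t)%N)) /=.
rewrite (eq_bigl (fun l : 'I_s => (l < t')%N && (l < t)%N)) ?leq_addr // => l.
by case: ltnP => lt; rewrite ?andbF // (leq_trans lt).
Qed.

Lemma psum_le_sum t : (psum t <= \sum_l j l)%N.
Proof. by rewrite [leqRHS](bigID (fun l : 'I_s => (l < t)%N)) leq_addr. Qed.

Lemma inblockE (l : 'I_s) k : inblock j l k = (psum l <= k < psum l.+1)%N.
Proof. by []. Qed.

Lemma inblock_exists k : (k < \sum_l j l)%N -> exists l, inblock j l k.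
Proof.
have -> : (\sum_l j l = psum s)%N by apply: eq_bigl => l; rewrite ltn_ord.
suff h t : (t <= s)%N -> (k < psum t)%N -> exists l, inblock j l k by exact: h.
elim: t => [|t IH] ts.
  by rewrite /psum big_pred0.
move=> kt; have [kt'|tk] := ltnP k (psum t); first exact: IH (ltnW ts) kt'.
by exists (Ordinal ts); rewrite inblockE tk.
Qed.

(** Comparing block indices amounts to comparing [k] with a partial sum, the form in which the
    eigenvalue counts come. *)
Lemma inblock_ltE (i l : 'I_s) k : inblock j l k -> (l < i)%N = (k < psum i)%N.
Proof.
rewrite inblockE => /andP[k1 k2]; apply/idP/idP => h.
  exact: leq_trans k2 (psum_le h).
by rewrite ltnNge; apply/negP => il; have := leq_trans h (leq_trans (psum_le il) k1); rewrite ltnn.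
Qed.

Lemma inblock_leE (i l : 'I_s) k : inblock j l k -> (l <= i)%N = (k < psum i.+1)%N.
Proof.
rewrite inblockE => /andP[k1 k2]; apply/idP/idP => h.
  exact: leq_trans k2 (@psum_le l.+1 i.+1 h).
rewrite leqNgt; apply/negP => il; have := leq_trans h (leq_trans (psum_le il) k1).
by rewrite ltnn.
Qed.

Lemma inblock_eqE (i l : 'I_s) k : inblock j l k -> inblock j i k = (l == i).
Proof.
move=> lk; rewrite inblockE leqNgt -(inblock_ltE i lk) -(inblock_leE i lk).
by rewrite -leqNgt -eqn_leq eq_sym.
Qed.
End Blocks.

Lemma blockprojE (R : realType) p q s (j : 'I_s -> nat) (i : 'I_s) (A : 'M[R[i]]_(p, q)) :
  blockproj j i A = A *m rdiag (fun k => (inblock j i k)%:R) *m mxH A.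
Proof.
apply/matrixP => k l; rewrite /blockproj summxE mxE big_mkcond.
apply: eq_bigr => t _; rewrite mul_mx_diag !mxE.
case: ifP => _; last by rewrite /= cRE mulr0 mul0r.
by rewrite big_ord1 !mxE (_ : cR _ = 1) // mulr1.
Qed.

(** * The outlier equation *)

Section SpikeWindow.
Variables (R : realType) (pi : probability R R) (lm lp c rho : R).
Hypotheses (lmp : lm <= lp) (supp : pi (~` `[lm, lp]) = 0%E) (c01 : 0 < c <= 1)
  (rho0 : 0 < rho) (lrho : lp < rho) (mrho : rho * stieltjesR pi rho <= -1).
Local Notation g := (gfun pi c).
Local Notation m := (stieltjesR pi).

Lemma gfun_slope : (fun h => (g (rho + h) - g rho) / h) @ 0^' --> derive1 g rho.
Proof.
have [dg _] := gfun_derive_lt0 lmp supp c01 rho0 lrho mrho.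
have := dg; rewrite /derivable derive1E /derive => h.
have -> : (fun h => (g (rho + h) - g rho) / h) =
  (fun h => h^-1 *: ((g \o shift rho) (h *: 1) - g rho)).
  by apply/funext => y /=; rewrite [_%:A]mulr1 [rho + y]addrC mulrC.
exact: h.
Qed.

Lemma gfun_continuous : {for rho, continuous g}.
Proof.
have [dg _] := gfun_derive_lt0 lmp supp c01 rho0 lrho mrho.
by apply: differentiable_continuous; apply/derivable1_diffP.
Qed.

(** Only the sign of the derivative at [rho] is used, through the difference quotient; monotonicity
    of [g] on an interval is not invoked. *)
Lemma gfun_side : \forall h \near (0 : R)^', (0 < h -> g (rho + h) < g rho) /\
  (h < 0 -> g rho < g (rho + h)).
Proof.
have [_ g0] := gfun_derive_lt0 lmp supp c01 rho0 lrho mrho.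
have hs : \forall h \near (0 : R)^', (g (rho + h) - g rho) / h < 0.
  exact: cvgr_lt gfun_slope _ g0.
apply: filterS hs => h h1; split=> h0.
  by rewrite -subr_lt0; move: h1; rewrite pmulr_llt0 // invr_gt0.
by rewrite -subr_gt0; move: h1; rewrite nmulr_llt0 // invr_lt0.
Qed.

Variables (s : nat) (om : 'I_s -> R) (i : 'I_s).
Hypotheses (Hompos : forall i, 0 < om i) (Homdec : forall i i' : 'I_s, (i < i')%N -> om i' < om i)
  (Hrhoeq : om i ^+ 2 * g rho = 1).

Lemma g_rho_gt0 : 0 < g rho.
Proof.
have : 0 < om i ^+ 2 * g rho by rewrite Hrhoeq.
by rewrite pmulr_rgt0 // exprn_gt0.
Qed.

Lemma spike_lt (l : 'I_s) : (l < i)%N -> 1 < om l ^+ 2 * g rho.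
Proof.
move=> li; rewrite -Hrhoeq ltr_pM2r ?g_rho_gt0 //.
by rewrite ltr_pXn2r ?nnegrE ?ltW // Homdec.
Qed.

Lemma spike_gt (l : 'I_s) : (i < l)%N -> om l ^+ 2 * g rho < 1.
Proof.
move=> li; rewrite -Hrhoeq ltr_pM2r ?g_rho_gt0 //.
by rewrite ltr_pXn2r ?nnegrE ?ltW // Homdec.
Qed.

Lemma spike_neq (l : 'I_s) : l != i -> om l ^+ 2 * g rho != 1.
Proof.
rewrite neq_ltn => /orP[/spike_lt h|/spike_gt h]; first by rewrite gt_eqF.
by rewrite lt_eqF.
Qed.

Lemma spike_window : exists2 ka, 0 < ka & lp < rho - ka /\
  (forall x (l : 'I_s), rho < x -> x <= rho + ka ->
     ((l < i)%N -> 1 < om l ^+ 2 * g x) /\ ((i <= l)%N -> om l ^+ 2 * g x < 1)) /\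
  (forall x (l : 'I_s), x < rho -> rho - ka <= x ->
     ((l <= i)%N -> 1 < om l ^+ 2 * g x) /\ ((i < l)%N -> om l ^+ 2 * g x < 1)).
Proof.
have cg (l : 'I_s) : (fun x => om l ^+ 2 * g x) @ rho --> om l ^+ 2 * g rho.
  by apply: cvgM; [exact: cvg_cst|exact: gfun_continuous].
have fa (D : R -> 'I_s -> Prop) :
    (forall l, \forall x \near rho, D x l) -> \forall x \near rho, forall l, D x l.
  exact: (@filter_forall R 'I_s (fun l x => D x l) (nbhs rho) (nbhs_filter rho)).
have h1 : \forall x \near rho, forall l : 'I_s, (l < i)%N -> 1 < om l ^+ 2 * g x.
  apply: (fa (fun x (l : 'I_s) => (l < i)%N -> 1 < om l ^+ 2 * g x)) => l.
  have [il|li] := leqP i l; first by near=> x.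
  by near=> x => _; near: x; exact: cvgr_gt (cg l) _ (spike_lt li).
have h2 : \forall x \near rho, forall l : 'I_s, (i < l)%N -> om l ^+ 2 * g x < 1.
  apply: (fa (fun x (l : 'I_s) => (i < l)%N -> om l ^+ 2 * g x < 1)) => l.
  have [il|li] := leqP l i; first by near=> x.
  by near=> x => _; near: x; exact: cvgr_lt (cg l) _ (spike_gt li).
have h3 : \forall x \near rho, lp < x by exact: lt_nbhsr.
have [e1 /= e10 h4] : exists2 e, 0 < e & forall x, `|rho - x| < e ->
    (forall l : 'I_s, (l < i)%N -> 1 < om l ^+ 2 * g x) /\
    (forall l : 'I_s, (i < l)%N -> om l ^+ 2 * g x < 1) /\ lp < x.
  suff /nbhs_ballP[e /= e0 he] : \forall x \near rho,
      (forall l : 'I_s, (l < i)%N -> 1 < om l ^+ 2 * g x) /\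
      (forall l : 'I_s, (i < l)%N -> om l ^+ 2 * g x < 1) /\ lp < x.
    by exists e => // x xe; exact: he.
  by near=> x; split; [near: x|split; near: x].
have [e2 /= e20 h5] : exists2 e, 0 < e & forall h, `|h| < e -> h != 0 ->
    (0 < h -> g (rho + h) < g rho) /\ (h < 0 -> g rho < g (rho + h)).
  have := gfun_side; rewrite near_withinE => /nbhs_ballP[e /= e0 he].
  exists e => // h hh h0.
  have hb : ball (0 : R) e h by rewrite -ball_normE /ball_ /= sub0r normrN.
  exact: he hb h0.
have omi : 0 < om i ^+ 2 by rewrite exprn_gt0.
have e120 : 0 < Num.min e1 e2 by rewrite lt_min e10 e20.
(* The half turns the open neighbourhoods into a closed window, so that its end points [rho + ka]
   and [rho - ka] are usable. *)
exists (Num.min e1 e2 / 2); first by rewrite divr_gt0.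
have m1 : Num.min e1 e2 <= e1 by rewrite ge_min lexx.
have m2 : Num.min e1 e2 <= e2 by rewrite ge_min lexx orbT.
move: (Num.min e1 e2) e120 m1 m2 => e e0 m1 m2.
have near1 x : `|rho - x| <= e / 2 -> `|rho - x| < e1 /\ `|x - rho| < e2.
  by rewrite [`|x - rho|]distrC => h; split; lra.
split; first by have [|_ [_ ->]] // := h4 (rho - e / 2); rewrite opprB addrC subrK gtr0_norm; lra.
split=> x l rx xk.
  have [n1 n2] : `|rho - x| < e1 /\ `|x - rho| < e2.
    by apply: near1; rewrite ltr0_norm; lra.
  have [a1 [a2 _]] := h4 x n1; split; first exact: a1.
  rewrite leq_eqVlt => /orP[/eqP/val_inj <-|]; last exact: a2.
  have [|b1 _] := h5 (x - rho) n2; first by rewrite subr_eq0 gt_eqF.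
  by rewrite -Hrhoeq ltr_pM2l //; move: b1; rewrite [rho + _]addrC subrK subr_gt0; exact.
have [n1 n2] : `|rho - x| < e1 /\ `|x - rho| < e2.
  by apply: near1; rewrite gtr0_norm; lra.
have [a1 [a2 _]] := h4 x n1; split; last exact: a2.
rewrite leq_eqVlt => /orP[/eqP/val_inj ->|]; last exact: a1.
have [|_ b1] := h5 (x - rho) n2; first by rewrite subr_eq0 lt_eqF.
by rewrite -Hrhoeq ltr_pM2l //; move: b1; rewrite [rho + _]addrC subrK subr_lt0; exact.
Unshelve. all: by end_near. Qed.

Variables (eta : nat -> R).
Hypotheses (eta0 : forall n, 0 < eta n) (etac : eta @ \oo --> (0 : R)).

Lemma cvg_rho_eta (F : R -> R) : {for rho, continuous F} -> (fun n => F (rho + eta n)) @ \oo --> F rho.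
Proof.
move=> cF; have h : (cst rho + eta) @ \oo --> rho + 0 by apply: cvgD => //; exact: cvg_cst.
by rewrite addr0 in h; exact: (cvg_comp (cst rho + eta) F h cF).
Qed.

Lemma cvg_eta_stieltjes : (fun n => eta n * m (rho + eta n)) @ \oo --> (0 : R).
Proof.
rewrite -(mul0r (m rho)); apply: cvgM => //.
by apply: cvg_rho_eta; exact: (stieltjesR_continuous supp).
Qed.

(** For [l = i] the denominator is [om_i^2 (g(rho + eta) - g(rho))], so the factor [eta] produces
    the inverse of a difference quotient. For the other blocks the fraction stays bounded and [eta]
    kills it. *)
Lemma cvg_residue (l : 'I_s) :
  (fun n => eta n * m (rho + eta n) *
     (om l ^+ 2 * g (rho + eta n) / (om l ^+ 2 * g (rho + eta n) - 1))) @ \oo -->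
  (l == i)%:R * (rho * m rho ^+ 2 * mtilde pi c rho / derive1 g rho).
Proof.
have cg := cvg_rho_eta gfun_continuous.
have cm := cvg_rho_eta (stieltjesR_continuous supp lrho).
have [->|li] := eqVneq l i; last first.
  rewrite mul0r -(mul0r (om l ^+ 2 * g rho / (om l ^+ 2 * g rho - 1))).
  apply: cvgM; first exact: cvg_eta_stieltjes.
  apply: cvgM; first by apply: cvgM => //; exact: cvg_cst.
  apply: cvgV; first by rewrite subr_eq0 spike_neq.
  by apply: cvgB; [apply: cvgM => //; exact: cvg_cst|exact: cvg_cst].
have [_ g0] := gfun_derive_lt0 lmp supp c01 rho0 lrho mrho.
have cs : (fun n => (g (rho + eta n) - g rho) / eta n) @ \oo --> derive1 g rho.
  apply: (cvg_comp eta (fun h => (g (rho + h) - g rho) / h)) gfun_slope.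
  move=> A hA; have h2 : \forall n \near \oo, eta n != 0 -> A (eta n) by exact: etac hA.
  have h3 : \forall n \near \oo, A (eta n) by apply: filterS h2 => n; apply; rewrite gt_eqF.
  exact: h3.
have -> : (fun n => eta n * m (rho + eta n) *
     (om i ^+ 2 * g (rho + eta n) / (om i ^+ 2 * g (rho + eta n) - 1))) =
   (fun n => m (rho + eta n) * g (rho + eta n) / ((g (rho + eta n) - g rho) / eta n)).
  apply/funext => n; rewrite -[X in _ - X]Hrhoeq -mulrBr.
  have en : eta n != 0 by rewrite gt_eqF.
  have on : om i != 0 by rewrite gt_eqF.
  rewrite invfM invf_div.
  (* Should the increment vanish, both sides are 0 by the convention [0^-1 = 0], so the rewriting
     holds at every [n]. *)
  have [->|y] := eqVneq (g (rho + eta n) - g rho) 0; first by rewrite invr0 !mulr0.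
  by field; rewrite y on.
have -> : true%:R * (rho * m rho ^+ 2 * mtilde pi c rho / derive1 g rho) = m rho * g rho / derive1 g rho.
  rewrite mul1r; congr (_ * _); rewrite /gfun; ring.
apply: cvgM; first exact: cvgM.
by apply: cvgV => //; rewrite lt_eqF.
Qed.
End SpikeWindow.

(** The four summands are the errors of the spectral projection, of the approximate resolvent, of
    the term [eta m <b1, b2>], and of the residue weights. *)
Lemma error_budget (R : realType) (B K t : R) : 1 <= B -> 0 <= K -> 0 < t ->
  B * (K * t * B + (1 + K) * t) + t + t * (B * B) + B * (t * B) < 6 * B ^+ 2 * (1 + K) * t.
Proof.
move=> B1 K0 t0.
have -> : B * (K * t * B + (1 + K) * t) + t + t * (B * B) + B * (t * B) =
  (B ^+ 2 * K + B * (1 + K) + 1 + 2 * B ^+ 2) * t by ring.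
rewrite ltr_pM2r //; have B2 : B <= B ^+ 2 by rewrite expr2; nra.
have : B * (1 + K) <= B ^+ 2 * (1 + K) by rewrite ler_wpM2r // addr_ge0.
have : 0 <= B ^+ 2 * K by rewrite mulr_ge0 // sqr_ge0.
rewrite !mulrDr !mulr1; move: (B * K) (B ^+ 2) B2 => y1 y2 B2.
rewrite -[6 * y2 * K]mulrA; move: (y2 * K) => y3.
lra.
Qed.

(** * The limit at a fixed outcome *)

Section DeterministicLimit.
Variable R : realType.
Local Notation C := R[i].
Local Notation Re := (@complex.Re R).
Local Notation Im := (@complex.Im R).
Variables (pi : probability R R) (lm lp c rho : R).
Hypotheses (lmp : lm <= lp) (supp : pi (~` `[lm, lp]) = 0%E) (c01 : 0 < c <= 1)
  (lp0 : 0 <= lp) (lrho : lp < rho) (mrho : rho * stieltjesR pi rho <= -1).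
Local Notation g := (gfun pi c).
Local Notation m := (stieltjesR pi).
Local Notation w := (wfun pi c).
Variables (r s : nat) (j : 'I_s -> nat) (om : 'I_s -> R) (i : 'I_s) (bl : 'I_r -> 'I_s).
Hypotheses (Hr : (\sum_(l < s) j l)%N = r)
  (Hompos : forall i, 0 < om i) (Homdec : forall i i' : 'I_s, (i < i')%N -> om i' < om i)
  (Hrhoeq : om i ^+ 2 * g rho = 1) (blE : forall k : 'I_r, inblock j (bl k) k).
Variables (p q : nat -> nat) (X : forall n, 'M[C]_(p n, q n)) (Q : R -> forall n, 'M[C]_(p n))
  (U : forall n, 'M[C]_(p n, r)) (V : forall n, 'M[C]_(q n, r)) (Om : nat -> 'I_r -> R)
  (lh : forall n, 'I_(p n) -> R) (uh : forall n, 'M[C]_(p n))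
  (b1 b2 : forall n, 'cV[C]_(p n)) (B ka th : R).
Arguments lh : clear implicits.
Definition isotropic (x : R) := [/\
  mconv (fun n => mxH (U n) *m Q x n *m U n) (cR (m x))%:M,
  mconv (fun n => mxH (U n) *m (Q x n *m X n) *m V n) 0,
  mconv (fun n => mxH (V n) *m (mxH (X n) *m Q x n *m X n) *m V n) (cR (1 + w x))%:M,
  (forall b, (b = b1) \/ (b = b2) ->
     mconv (fun n => mxH (U n) *m (Q x n *m b n) - cR (m x) *: (mxH (U n) *m b n)) 0 /\
     mconv (fun n => mxH (V n) *m (mxH (X n) *m (Q x n *m b n))) 0) &
  csmall (fun n => dot (b1 n) (Q x n *m b2 n) - cR (m x) * dot (b1 n) (b2 n))].
Let eta n := ka / n.+1%:R.
Hypotheses (B1 : 1 <= B) (th0 : 0 <= th) (thx : th < rho - ka) (ka0 : 0 < ka) (lka : lp < rho - ka)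
  (HQ : forall x, th < x -> \forall n \near \oo, (X n *m mxH (X n) - (cR x)%:M) *m Q x n = 1%:M)
  (QH : forall x n, mxH (Q x n) = Q x n)
  (HX : \forall n \near \oo, (forall a, n2 (mxH (X n) *m a) <= th * n2 a) /\
     (forall v, n2 (X n *m v) <= th * n2 v))
  (UU : \forall n \near \oo, mxH (U n) *m U n = 1%:M)
  (VV : \forall n \near \oo, mxH (V n) *m V n = 1%:M)
  (HOm : forall k, (fun n => Om n k) @ \oo --> om (bl k))
  (uhU : forall n, mxH (uh n) *m uh n = 1%:M)
  (uhE : \forall n \near \oo,
     spiked (X n) (U n) (V n) (Om n) *m mxH (spiked (X n) (U n) (V n) (Om n)) *m uh n =
     uh n *m rdiag (lh n))
  (lh_noninc : forall n (k k' : 'I_(p n)), (k <= k')%N -> lh n k' <= lh n k)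
  (Hb : \forall n \near \oo, vnorm (b1 n) <= B /\ vnorm (b2 n) <= B)
  (Hplus : forall n, isotropic (rho + eta n)) (Hminus : forall n, isotropic (rho - eta n))
  (win_plus : forall x (l : 'I_s), rho < x -> x <= rho + ka ->
     ((l < i)%N -> 1 < om l ^+ 2 * g x) /\ ((i <= l)%N -> om l ^+ 2 * g x < 1))
  (win_minus : forall x (l : 'I_s), x < rho -> rho - ka <= x ->
     ((l <= i)%N -> 1 < om l ^+ 2 * g x) /\ ((i < l)%N -> om l ^+ 2 * g x < 1)).
Let coef := rho * m rho ^+ 2 * mtilde pi c rho / derive1 g rho.

Let rho0 : 0 < rho. Proof. exact: le_lt_trans lp0 lrho. Qed.

Let eta_gt0 n : 0 < eta n. Proof. by rewrite divr_gt0. Qed.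

Let eta_le n : eta n <= ka.
Proof. by rewrite /eta ler_pdivrMr // ler_peMr ?(ltW ka0) // ler1n. Qed.

Let eta_cvg : eta @ \oo --> (0 : R).
Proof.
have h : (cst ka * harmonic) @ \oo --> ka * (0 : R).
  by apply: cvgM; [exact: cvg_cst|exact: cvg_harmonic].
by rewrite mulr0 in h.
Qed.

Let gE x : lp < x -> m x * w x = g x.
Proof. by move=> lx; rewrite gfunE // gt_eqF // (le_lt_trans lp0). Qed.

Lemma eigenvalues_count x (dd : nat) : rho - ka <= x -> isotropic x -> (dd <= r)%N ->
  (forall k : 'I_r, (k < dd)%N -> 1 < om (bl k) ^+ 2 * g x) ->
  (forall k : 'I_r, (dd <= k)%N -> om (bl k) ^+ 2 * g x < 1) ->
  \forall n \near \oo, forall k : 'I_(p n),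
    ((k < dd)%N -> x < lh n k) /\ ((dd <= k)%N -> lh n k < x).
Proof.
move=> kx [h1 h2 h3 _ _] ddr hlt hge.
have lx : lp < x by exact: lt_le_trans kx.
have tx : th < x by exact: lt_le_trans kx.
have x0 : 0 < x by exact: le_lt_trans lp0 lx.
have m0 := stieltjesR_lt0 lmp supp lx.
have w0 := wfun_lt0 lmp supp c01 x0 lx.
have e1 := eigenvalues_eventually_gt (HQ tx) (QH x) VV HOm m0 h1 h2 h3 uhU uhE lh_noninc ddr.
have e2 := eigenvalues_eventually_lt (HQ tx) (QH x) tx HX VV HOm m0 w0 h1 h2 h3 uhU uhE lh_noninc (dd := dd).
rewrite (gE lx) in e1 e2.
apply: filterS2 (e1 hlt) (e2 hge) => n a1 a2 k; split; [exact: a1|exact: a2].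
Qed.

(** Just above [rho] the supercritical indices are those of the blocks before [i]. *)
Lemma eigenvalues_plus N : \forall n \near \oo, forall k : 'I_(p n),
  ((k < \sum_(t < s | (t < i)%N) j t)%N -> rho + eta N < lh n k) /\
  ((\sum_(t < s | (t < i)%N) j t <= k)%N -> lh n k < rho + eta N).
Proof.
have e0 := eta_gt0 N; have ek := eta_le N.
apply: eigenvalues_count (Hplus N) _ _ _ => [||k|k].
- by move: ka0 e0; lra.
- by rewrite -Hr; exact: psum_le_sum.
- rewrite -(inblock_ltE i (blE k)) => h.
  by have [|//|a1 _] := win_plus (x := rho + eta N) (bl k); [rewrite ltrDl|rewrite lerD2l|exact: a1].
- rewrite leqNgt -(inblock_ltE i (blE k)) -leqNgt => h.
  by have [|//|_ a1] := win_plus (x := rho + eta N) (bl k); [rewrite ltrDl|rewrite lerD2l|exact: a1].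
Qed.

(** Just below [rho] the block [i] itself has joined the supercritical ones. *)
Lemma eigenvalues_minus N : \forall n \near \oo, forall k : 'I_(p n),
  ((k < \sum_(t < s | (t <= i)%N) j t)%N -> rho - eta N < lh n k) /\
  ((\sum_(t < s | (t <= i)%N) j t <= k)%N -> lh n k < rho - eta N).
Proof.
have e0 := eta_gt0 N; have ek := eta_le N.
apply: eigenvalues_count (Hminus N) _ _ _ => [||k|k].
- by rewrite lerD2l lerN2.
- by rewrite -Hr; exact: (psum_le_sum _ i.+1).
- rewrite -(inblock_leE i (blE k)) => h.
  by have [|//|a1 _] := win_minus (x := rho - eta N) (bl k); [rewrite gtrBl|rewrite lerD2l lerN2|exact: a1].
- rewrite leqNgt -(inblock_leE i (blE k)) -ltnNge => h.
  by have [|//|_ a1] := win_minus (x := rho - eta N) (bl k); [rewrite gtrBl|rewrite lerD2l lerN2|exact: a1].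
Qed.

Lemma eigenvalues_window N : \forall n \near \oo, forall k : 'I_(p n),
  (inblock j i k -> `|lh n k - rho| <= eta N) /\ (~~ inblock j i k -> ka <= `|lh n k - rho|).
Proof.
(* Index 0 of the same sequence gives the outer window: the counts at [rho + ka] and [rho - ka] push
   the other eigenvalues out, while those at [eta N] trap the block. *)
have e00 : eta 0 = ka by rewrite /eta divr1.
have h1 := eigenvalues_plus N; have h2 := eigenvalues_minus N.
have h3 := eigenvalues_plus 0; have h4 := eigenvalues_minus 0.
rewrite !e00 in h3 h4.
near=> n.
have a1 : forall k : 'I_(p n), ((k < \sum_(t < s | (t < i)%N) j t)%N -> rho + eta N < lh n k) /\
  ((\sum_(t < s | (t < i)%N) j t <= k)%N -> lh n k < rho + eta N) by near: n.
have a2 : forall k : 'I_(p n), ((k < \sum_(t < s | (t <= i)%N) j t)%N -> rho - eta N < lh n k) /\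
  ((\sum_(t < s | (t <= i)%N) j t <= k)%N -> lh n k < rho - eta N) by near: n.
have a3 : forall k : 'I_(p n), ((k < \sum_(t < s | (t < i)%N) j t)%N -> rho + ka < lh n k) /\
  ((\sum_(t < s | (t < i)%N) j t <= k)%N -> lh n k < rho + ka) by near: n.
have a4 : forall k : 'I_(p n), ((k < \sum_(t < s | (t <= i)%N) j t)%N -> rho - ka < lh n k) /\
  ((\sum_(t < s | (t <= i)%N) j t <= k)%N -> lh n k < rho - ka) by near: n.
move=> k; rewrite /inblock; split.
  move=> /andP[k1 k2]; have [_ /(_ k1) d1] := a1 k; have [/(_ k2) d2 _] := a2 k.
  by rewrite ler_norml; apply/andP; split; lra.
rewrite negb_and -ltnNge -leqNgt => /orP[k1|k2].
  have [/(_ k1) d1 _] := a3 k; apply: le_trans (ler_norm _); lra.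
have [_ /(_ k2) d1] := a4 k; rewrite distrC; apply: le_trans (ler_norm _); lra.
Unshelve. all: by end_near. Qed.

Let chi p (k : 'I_p) : R := (inblock j i k)%:R.

Lemma dot_rdiag_lin k (x y : R) (d d' : 'I_k -> R) (u v : 'cV[C]_k) :
  dot u (rdiag (fun l => x * d l - y * d' l) *m v) =
  cR x * dot u (rdiag d *m v) - cR y * dot u (rdiag d' *m v).
Proof.
rewrite !dotE !mulr_sumr -sumrB; apply: eq_bigr => l _.
by rewrite !rdiag_mulE cRD cRN !cRM; ring.
Qed.

(** For a given precision, [N] and hence the spectral point [rho + eta N] are fixed first, and only
    then does [n] grow. All errors are multiples of [tau], whose size [e / D] is dictated by
    [error_budget]. *)
Lemma deterministic_limit : csmall (fun n =>
   dot (b1 n) (blockproj j i (uh n) *m b2 n) - cR coef * dot (b1 n) (blockproj j i (U n) *m b2 n)).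
Proof.
apply/csmallP => e e0.
pose K := 1 + 2 / ka; have K1 : 1 <= K by rewrite lerDl divr_ge0 // ltW.
pose D := 6 * B ^+ 2 * (1 + K).
have B20 : 1 <= B ^+ 2 by rewrite exprn_ege1.
have D0 : 0 < D by rewrite /D; apply: mulr_gt0; lra.
pose tau := e / D; have tau0 : 0 < tau by exact: divr_gt0.
pose a1 (x : R) (l : 'I_s) := om l ^+ 2 * g x / (om l ^+ 2 * g x - 1).
have hN : \forall N \near \oo, [/\ eta N < tau, eta N <= 1, eta N <= ka / 2,
    `|eta N * m (rho + eta N)| < tau &
    forall l : 'I_s, `|eta N * m (rho + eta N) * a1 (rho + eta N) l - (l == i)%:R * coef| < tau].
  have c1 : \forall N \near \oo, eta N < tau by exact: cvgr_lt eta_cvg _ tau0.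
  have c2 : \forall N \near \oo, eta N < 1 by exact: cvgr_lt eta_cvg _ ltr01.
  have k2 : 0 < ka / 2 by exact: divr_gt0.
  have c3 : \forall N \near \oo, eta N < ka / 2 by exact: cvgr_lt eta_cvg _ k2.
  have c4 : \forall N \near \oo, `|eta N * m (rho + eta N)| < tau.
    have /cvgrPdist_lt/(_ _ tau0) := cvg_eta_stieltjes supp lrho eta_cvg.
    by apply: filterS => n; rewrite sub0r normrN.
  have c5 : \forall N \near \oo, forall l : 'I_s,
      `|eta N * m (rho + eta N) * a1 (rho + eta N) l - (l == i)%:R * coef| < tau.
    apply: filter_forall => l.
    have /cvgrPdist_lt/(_ _ tau0) := cvg_residue lmp supp c01 rho0 lrho mrho
      Hompos Homdec Hrhoeq eta_gt0 eta_cvg (l := l).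
    by apply: filterS => n; rewrite distrC.
  near=> N; split; first by near: N.
  - by apply: ltW; near: N.
  - by apply: ltW; near: N.
  - by near: N.
  - by near: N.
have [N [y1 y2 y3 y4 y5]] : exists N, [/\ eta N < tau, eta N <= 1, eta N <= ka / 2,
    `|eta N * m (rho + eta N)| < tau &
    forall l : 'I_s, `|eta N * m (rho + eta N) * a1 (rho + eta N) l - (l == i)%:R * coef| < tau].
  by have [N _ h] := hN; exists N; exact: h (leqnn N).
have e2 : 0 < eta N ^+ 2 / 2 by rewrite divr_gt0 // exprn_gt0.
(* A second, finer index: the block has to be located within [eta N ^ 2 / 2], whereas the resolvent
   is taken at distance [eta N]. *)
have [N' hN'] : exists N', eta N' <= eta N ^+ 2 / 2.
  have h : \forall N' \near \oo, eta N' < eta N ^+ 2 / 2 by exact: cvgr_lt eta_cvg _ e2.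
  by have [N' _ h'] := h; exists N'; apply/ltW/h' => /=.
set x := rho + eta N in y4 y5.
have lx : lp < x by rewrite (lt_trans lrho) // ltrDl.
have tx : th < x by have := thx; have := ka0; have := eta_gt0 N; rewrite /x; lra.
have Hc k : om (bl k) ^+ 2 * (m x * w x) != 1.
  rewrite (gE lx); have [|//|h1 h2] := win_plus (x := x) (bl k); first by rewrite ltrDl.
    by rewrite lerD2l.
  by have [/h2 h|/h1 h] := leqP i (bl k); [rewrite lt_eqF|rewrite gt_eqF].
have [I1 I2 I3 I4 I5] := Hplus N.
have nb (b : forall n, 'cV[C]_(p n)) : (b = b1) \/ (b = b2) -> \forall n \near \oo, n2 (b n) <= B ^+ 2.
  move=> hb; apply: filterS Hb => n [h1 h2]; rewrite -sqr_vnorm.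
  rewrite ler_pXn2r ?nnegrE ?vnorm_ge0 //; last by have := B1; lra.
  by case: hb => ->.
have [J1 J2] := I4 b1 (or_introl erefl); have [J3 J4] := I4 b2 (or_intror erefl).
have [a [ha1 ha2]] := approx_resolvent (HQ tx) (QH x) th0 HX UU VV HOm I1 I2 I3
  (nb b2 (or_intror erefl)) J3 J4 J1 J2 I5 Hc.
have t2 : 0 < tau ^+ 2 by rewrite exprn_gt0.
have h1 := ha1 _ t2.
have h2 : \forall n \near \oo, cabs (dot (b1 n) (a n) - cR (m x) * (dot (b1 n) (b2 n) -
   dot (mxH (U n) *m b1 n) (rdiag (fun k => om (bl k) ^+ 2 * (m x * w x) / (om (bl k) ^+ 2 * (m x * w x) - 1)) *m
     (mxH (U n) *m b2 n)))) < tau by exact: (csmallP _).1 ha2 _ tau0.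
have hw := eigenvalues_window N'.
apply: filterS3 (filterI h1 h2) (filterI hw Hb) (filterI UU uhE) => n [r1 r2] [w1 [v1 v2]] [Un En].
have hS (k : 'I_(p n)) : inblock j i k -> `|lh n k - rho| <= eta N ^+ 2 / 2.
  by move=> ik; apply: le_trans hN'; apply: (w1 k).1.
have hNS (k : 'I_(p n)) : ~~ inblock j i k -> ka <= `|lh n k - rho| by apply: (w1 k).2.
have Y1b := spectral_projection_approx (uhU n) En (eta_gt0 N) y2 y3 hS hNS (a n) (b2 n) (b1 n).
rewrite -blockprojE -/K -/x in Y1b.
set c1 := mxH (U n) *m b1 n in r2; set c2 := mxH (U n) *m b2 n in r2.
have a1E : (fun k => om (bl k) ^+ 2 * (m x * w x) / (om (bl k) ^+ 2 * (m x * w x) - 1)) =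
  fun k => a1 x (bl k) by rewrite /a1 (gE lx).
rewrite {}a1E in r2.
set res := _ - b2 n in r1 Y1b.
set Y1 := (X in cabs X <= _) in Y1b; set Y2 := (X in cabs X < _) in r2.
pose d k := eta N * m x * a1 x (bl k) - coef * chi k.
pose Y3 := dot c1 (rdiag d *m c2).
have Y3E : Y3 = cR (eta N * m x) * dot c1 (rdiag (fun k => a1 x (bl k)) *m c2) -
    cR coef * dot c1 (rdiag (@chi r) *m c2).
  exact: dot_rdiag_lin.
have PiE : dot (b1 n) (blockproj j i (U n) *m b2 n) = dot c1 (rdiag (@chi r) *m c2).
  by rewrite blockprojE -!mulmxA dotMr.
(* [Y1] compares the projection with [- eta <b1, a>], [Y2] compares [<b1, a>] with its limit, and
   [Y3] compares the weights [eta m a1] with [coef] times the indicator of the block. The remaining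
   term is small because of [eta m]. *)
have -> : dot (b1 n) (blockproj j i (uh n) *m b2 n) - cR coef * dot (b1 n) (blockproj j i (U n) *m b2 n) =
   Y1 - cR (eta N) * Y2 - cR (eta N * m x) * dot (b1 n) (b2 n) + Y3.
  by rewrite Y3E PiE /Y1 /Y2 cRM; ring.
have B0 : 0 <= B by apply: le_trans B1.
have vc (b : 'cV[C]_(p n)) : vnorm (mxH (U n) *m b) <= vnorm b.
  by rewrite !vnormE ler_sqrt ?n2_ge0 // n2_isomH_le.
have K0 : 0 <= K by apply: le_trans K1.
have tau0' := ltW tau0; have eta0' := ltW (eta_gt0 N).
have vres : vnorm res <= tau.
  by rewrite -(@ler_pXn2r _ 2) ?nnegrE ?vnorm_ge0 // sqr_vnorm ltW.
have Ke : K * eta N <= K * tau by rewrite ler_wpM2l // ltW.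
have Ke1 : 1 + K * eta N <= 1 + K by rewrite lerD2l ler_piMr.
have Ke0 : 0 <= K * eta N by exact: mulr_ge0.
have f1 : cabs Y1 <= B * (K * tau * B + (1 + K) * tau).
  have p1 := mulr_ge0 Ke0 (vnorm_ge0 (b2 n)); have p2 := addr_ge0 ler01 Ke0.
  have p3 := mulr_ge0 p2 (vnorm_ge0 res).
  apply: le_trans Y1b _; apply: (ler_pM (vnorm_ge0 _) (addr_ge0 p1 p3) v1); apply: lerD.
    exact: (ler_pM Ke0 (vnorm_ge0 _) Ke v2).
  exact: (ler_pM p2 (vnorm_ge0 _) Ke1 vres).
have f2 : cabs (cR (eta N) * Y2) <= tau.
  rewrite cabsM cabs_cR ger0_norm //; apply: le_trans (ltW r2).
  by rewrite ler_piMl // cabs_ge0.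
have f3 : cabs (cR (eta N * m x) * dot (b1 n) (b2 n)) <= tau * (B * B).
  rewrite cabsM cabs_cR; apply: ler_pM; rewrite ?cabs_ge0 //; first exact: ltW.
  by apply: le_trans (cauchy_schwarz _ _) _; apply: ler_pM; rewrite ?vnorm_ge0.
have dk k : `|d k| <= tau.
  by rewrite /d /chi (inblock_eqE i (blE k)) [coef * _]mulrC ltW.
have f4 : cabs Y3 <= B * (tau * B).
  apply: le_trans (cauchy_schwarz _ _) _; apply: ler_pM; rewrite ?vnorm_ge0 //.
    exact: le_trans (vc _) v1.
  apply: le_trans (vnorm_rdiag_le _ tau0' dk) _.
  by apply: ler_wpM2l => //; exact: le_trans (vc _) v2.
have eE : e = 6 * B ^+ 2 * (1 + K) * tau by rewrite -/D /tau mulrC divfK // gt_eqF.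
rewrite eE; apply: le_lt_trans (error_budget B1 K0 tau0).
apply: le_trans (cabsD _ _) (lerD _ f4); apply: le_trans (cabsB _ _) (lerD _ f3).
exact: le_trans (cabsB _ _) (lerD f1 f2).
Unshelve. all: by end_near. Qed.
End DeterministicLimit.

Lemma ae_forall_fin (R : realType) d (T : measurableType d) (P : probability T R)
    (I : finType) (A : I -> T -> Prop) :
  (forall i, {ae P, forall x, A i x}) -> {ae P, forall x, forall i, A i x}.
Proof. by move=> h; apply: filter_forall. Qed.

(** * Isotropic limits for the columns of [U] and [V], almost surely *)

Section AlmostSureIsotropy.
Variable R : realType.
Local Notation C := R[i].

Lemma mxH_mul_col p q (A : 'M[C]_(p, q)) (v : 'cV[C]_p) k : (mxH A *m v) k 0 = dot (col k A) v.
Proof. by rewrite dotE mxE; apply: eq_bigr => l _; rewrite !mxE. Qed.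

Lemma sandwich_entry p q p' q' (A : 'M[C]_(p, q)) (M : 'M[C]_(p, p')) (B : 'M[C]_(p', q')) k l :
  (mxH A *m M *m B) k l = dot (col k A) (M *m col l B).
Proof.
by rewrite -mxH_mul_col colE !mulmxA -colE [RHS]mxE.
Qed.

Lemma gram_entry p q (A : 'M[C]_(p, q)) k l : mxH A *m A = 1%:M ->
  dot (col k A) (col l A) = (k == l)%:R.
Proof. by move=> h; rewrite -[col l A]mul1mx -sandwich_entry mulmx1 h mxE. Qed.

Lemma isom_col_n2 (p : nat -> nat) r (A : forall n, 'M[C]_(p n, r)) k B : 1 <= B ->
  (\forall n \near \oo, mxH (A n) *m A n = 1%:M) ->
  \forall n \near \oo, n2 (col k (A n)) <= B.
Proof.
by move=> B1; apply: filterS => n h; rewrite /n2 gram_entry // eqxx.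
Qed.

Variables (d : measure_display) (T : measurableType d) (P : probability T R).
Variables (N : nat -> nat) (c : R).
Hypotheses (HN : forall n, (N n <= n)%N) (Hc : 0 < c <= 1)
  (HNc : (fun n => (N n)%:R / n%:R : R) @ \oo --> c).
Variables (L Gam : forall n, T -> 'M[C]_(N n)) (W : forall n, T -> 'M[C]_n)
  (f : forall n, 'I_(N n) -> 'I_n).
Arguments f : clear implicits.
Hypotheses (Hf : forall n, injective (f n))
  (HL : forall n, haar_unitary P (L n)) (HW : forall n, haar_unitary P (W n))
  (HGm : forall n, rmx_measurable (Gam n))
  (HGdiag : forall n x (k l : 'I_(N n)), k != l -> Gam n x k l = 0)
  (HGnn : forall n x (k : 'I_(N n)), 0 <= Gam n x k k)
  (Hind : forall n, indep3 P (L n) (Gam n) (fun x => colsub (f n) (W n x))).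
Let X x n := Xmat (L n x) (Gam n x) (colsub (f n) (W n x)).
Let Q x (x0 : R) n := Qres (L n x) (gam (Gam n) x) x0.
Variables (pi : probability R R) (lm lp : R).
Hypotheses (Hlmp : lm <= lp) (Hsupp : pi (~` `[lm, lp]) = 0%E)
  (HA3 : forall z : C, 0 < complex.Im z ->
     {ae P, forall x, ccvg (fun n =>
        (N n)%:R^-1 * \tr (invmx (X x n *m mxH (X x n) - z%:M))) (stieltjes pi z)})
  (HA4 : {ae P, forall x, (fun n => opnorm (X x n *m mxH (X x n))) @ \oo --> lp}).
Variables (r : nat) (U : forall n, 'M[C]_(N n, r)) (V : forall n, 'M[C]_(n, r))
  (b1 b2 : forall n, 'cV[C]_(N n)) (B : R).
Hypotheses (B1 : 1 <= B)
  (UU : \forall n \near \oo, mxH (U n) *m U n = 1%:M)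
  (VV : \forall n \near \oo, mxH (V n) *m V n = 1%:M)
  (nb1 : \forall n \near \oo, n2 (b1 n) <= B) (nb2 : \forall n \near \oo, n2 (b2 n) <= B).

(** With [r] fixed, the matrix limits consist of finitely many bilinear forms in columns of norm 1,
    and orthonormality of the columns turns them into scalar matrices. *)
Lemma ae_isotropic x0 : lp < x0 ->
  {ae P, forall x, isotropic pi c (X x) (Q x) U V b1 b2 x0}.
Proof.
move=> lx.
have nU k := isom_col_n2 k B1 UU; have nV k := isom_col_n2 k B1 VV.
have LL a b := ae_iso_LL Hc HNc Hf HL HW HGm HGdiag HGnn Hind Hsupp HA3 HA4 lx (a := a) (b := b) (B := B).
have LR a v := ae_iso_LR Hc HNc Hf HL HW HGm HGdiag HGnn Hind HA4 lx (a := a) (v := v) (B := B).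
have RR a b := ae_iso_RR HN Hc HNc Hf HL HW HGm HGdiag HGnn Hind Hsupp HA3 HA4 lx (a := a) (b := b) (B := B).
have h1 := ae_forall_fin (fun k => ae_forall_fin (fun l => LL _ _ (nU l) (nU k))).
have h2 := ae_forall_fin (fun k => ae_forall_fin (fun l => LR _ _ (nU k) (nV l))).
have h3 := ae_forall_fin (fun k => ae_forall_fin (fun l => RR _ _ (nV l) (nV k))).
have h4 b nb := ae_forall_fin (fun k => LL b _ nb (nU k)).
have h6 b nb := ae_forall_fin (fun k => LR b _ nb (nV k)).
have h5 := LL _ _ nb2 nb1.
have z0 m n (k : 'I_m) (l : 'I_n) (y : C) : y - (0 : 'M[C]_(m, n)) k l = y by rewrite mxE subr0.
have sE (u v : 'cV[C]_r) (a : C) k : (u - a *: v) k 0 = u k 0 - a * v k 0 by rewrite !mxE.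
have vec (x : T) (b : forall n, 'cV[C]_(N n)) :
    (forall k, csmall (fun n => dot (col k (U n)) (Q x x0 n *m b n) -
       cR (stieltjesR pi x0) * dot (col k (U n)) (b n))) ->
    (forall k, csmall (fun n => dot (b n) (Q x x0 n *m X x n *m col k (V n)))) ->
    mconv (fun n => mxH (U n) *m (Q x x0 n *m b n) - cR (stieltjesR pi x0) *: (mxH (U n) *m b n)) 0 /\
     mconv (fun n => mxH (V n) *m (mxH (X x n) *m (Q x x0 n *m b n))) 0.
  move=> u1 u2; split=> k l; rewrite ord1.
    apply: csmall_near (u1 k); apply: nearW => n.
    by rewrite z0 sE !mxH_mul_col.
  apply: csmall_near (csmallJ (u2 k)); apply: nearW => n.
  rewrite z0 mxH_mul_col [RHS]dotC; congr conjc.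
  by rewrite -mulmxA [RHS]dotMl mxHK [RHS]dotMl /Q QresH.
apply: filterS3 (filterI h1 h2) (filterI h3 (filterI (h4 _ nb1) (h6 _ nb1)))
  (filterI (filterI (h4 _ nb2) (h6 _ nb2)) h5) =>
  x [g1 g2] [g3 [g4 g5]] [[g6 g7] g8]; split.
- move=> k l; apply: csmall_near (g1 k l); apply: filterS UU => n Un.
  by rewrite sandwich_entry mxE gram_entry // mulr_natr.
- move=> k l; apply: csmall_near (g2 k l); apply: nearW => n.
  by rewrite z0 sandwich_entry.
- move=> k l; apply: csmall_near (g3 k l); apply: filterS VV => n Vn.
  by rewrite sandwich_entry mxE gram_entry // mulr_natr.
- by move=> b [->|->]; [exact: (vec _ _ g4 g5)|exact: (vec _ _ g6 g7)].
- exact: g8.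
Qed.
End AlmostSureIsotropy.

Theorem theorem2
  (R : realType) (d : measure_display) (T : measurableType d)
  (P : probability T R)
  (* (A1) *)
  (N : nat -> nat) (c : R)
  (HN : forall n, (N n <= n)%N)
  (Hc : 0 < c <= 1)
  (HNc : (fun n => (N n)%:R / n%:R : R) @ \oo --> c)
  (* (A2) *)
  (L Gam : forall n, T -> 'M[R[i]]_(N n))
  (W : forall n, T -> 'M[R[i]]_n)
  (f : forall n, 'I_(N n) -> 'I_n)
  (Hf : forall n, injective (f n))
  (HL : forall n, haar_unitary P (L n))
  (HW : forall n, haar_unitary P (W n))
  (HGm : forall n, rmx_measurable (Gam n))
  (HGdiag : forall n x (k l : 'I_(N n)), k != l -> Gam n x k l = 0)
  (HGnn : forall n x (k : 'I_(N n)), 0 <= Gam n x k k)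
  (Hind : forall n,
     indep3 P (L n) (Gam n) (fun x => colsub (f n) (W n x)))
  (* (A3) *)
  (pi : probability R R) (lm lp : R)
  (Hlmp : lm <= lp)
  (Hsupp : pi (~` `[lm, lp]) = 0%E)
  (HA3 : forall z : R[i], 0 < complex.Im z ->
     {ae P, forall x, ccvg (fun n =>
        (N n)%:R^-1 * \tr (invmx (
           Xmat (L n x) (Gam n x) (colsub (f n) (W n x)) *m
           mxH (Xmat (L n x) (Gam n x) (colsub (f n) (W n x))) - z%:M)))
        (stieltjes pi z)})
  (* (A4) *)
  (HA4 : {ae P, forall x, (fun n => opnorm (
           Xmat (L n x) (Gam n x) (colsub (f n) (W n x)) *m
           mxH (Xmat (L n x) (Gam n x) (colsub (f n) (W n x))))) @ \oo --> lp})
  (* (A5) *)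
  (r s : nat) (j : 'I_s -> nat)
  (Hj : forall i, (0 < j i)%N)
  (Hr : (\sum_(i < s) j i)%N = r)
  (om : 'I_s -> R)
  (Hompos : forall i, 0 < om i)
  (Homdec : forall i i' : 'I_s, (i < i')%N -> om i' < om i)
  (Pn : forall n, 'M[R[i]]_(N n, n))
  (U : forall n, 'M[R[i]]_(N n, r)) (V : forall n, 'M[R[i]]_(n, r))
  (Om : forall n, 'I_r -> R)
  (HSVD : exists n0, forall n, (n0 <= n)%N ->
     [/\ mxH (U n) *m U n = 1%:M, mxH (V n) *m V n = 1%:M,
         Pn n = U n *m diag_mx (\row_k cR (Om n k)) *m mxH (V n),
         (forall k, 0 < Om n k) &
         (forall k k' : 'I_r, (k <= k')%N -> Om n k' <= Om n k)])
  (HOm : forall (i : 'I_s) (k : 'I_r), inblock j i k ->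
     (fun n => Om n k) @ \oo --> om i)
  (* eigen-decomposition of Sigma Sigma^* *)
  (lh : forall n, T -> 'I_(N n) -> R)
  (uh : forall n, T -> 'M[R[i]]_(N n))
  (Heig : forall n x,
     [/\ mxH (uh n x) *m uh n x = 1%:M,
         (Xmat (L n x) (Gam n x) (colsub (f n) (W n x)) + Pn n) *m
         mxH (Xmat (L n x) (Gam n x) (colsub (f n) (W n x)) + Pn n) *m uh n x
           = uh n x *m diag_mx (\row_k cR (lh n x k)) &
         (forall k k' : 'I_(N n), (k <= k')%N -> lh n x k' <= lh n x k)])
  (* the block i and the threshold condition *)
  (i : 'I_s)
  (Hthr : exists l : \bar R,
     ((fun y => (gfun pi c y)%:E) @ lp^'+ --> l) /\ (1%:E < (om i ^+ 2)%:E * l)%E)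
  (rho : R) (Hrho : lp < rho) (Hrhoeq : om i ^+ 2 * gfun pi c rho = 1)
  (* bounded deterministic vectors *)
  (b1 b2 : forall n, 'cV[R[i]]_(N n))
  (Hb : exists B : R, forall n, vnorm (b1 n) <= B /\ vnorm (b2 n) <= B) :
  {ae P, forall x, ccvg (fun n =>
      (mxH (b1 n) *m blockproj j i (uh n x) *m b2 n) 0 0 -
      cR (rho * stieltjesR pi rho ^+ 2 * mtilde pi c rho /
          derive1 (gfun pi c) rho) *
      (mxH (b1 n) *m blockproj j i (U n) *m b2 n) 0 0) 0}.
Proof.
have [n0 hn0] := HSVD.
have UU : \forall n \near \oo, mxH (U n) *m U n = 1%:M.
  by exists n0 => // n /= /hn0 [].
have VV : \forall n \near \oo, mxH (V n) *m V n = 1%:M.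
  by exists n0 => // n /= /hn0 [].
have PE : \forall n \near \oo, Pn n = U n *m rdiag (Om n) *m mxH (V n).
  by exists n0 => // n /= /hn0 [].
have lp0 := lp_ge0 Hf HL HW HGdiag HGnn HA4.
have mrho := stieltjesR_mul_le Hc HNc Hf HL HW HGdiag HGnn Hsupp HA3 HA4 Hrho.
have rho0 : 0 < rho by exact: le_lt_trans lp0 Hrho.
have [ka ka0 [lka [win_plus win_minus]]] :=
  spike_window Hlmp Hsupp Hc rho0 Hrho mrho Hompos Homdec Hrhoeq.
have [bl blE] : exists bl : 'I_r -> 'I_s, forall k, inblock j (bl k) k.
  apply: (@fin_all_exists _ _ (fun (k : 'I_r) l => inblock j l k)) => k.
  by apply: inblock_exists; rewrite Hr.
(* The added 1 lets one bound serve the unit columns of [U] and [V] as well as [b1] and [b2], and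
   gives the [1 <= B] of the error budget. *)
have [B0 hB0] := Hb; pose B := 1 + `|B0|.
have B1 : 1 <= B by rewrite lerDl.
have vB n : vnorm (b1 n) <= B /\ vnorm (b2 n) <= B.
  have B0B : B0 <= B by apply: le_trans (ler_norm _) _; rewrite lerDr.
  by have [h1 h2] := hB0 n; split; [exact: le_trans h1 B0B|exact: le_trans h2 B0B].
have nB (v : forall n, 'cV[R[i]]_(N n)) : (forall n, vnorm (v n) <= B) ->
    \forall n \near \oo, n2 (v n) <= B ^+ 2.
  move=> h; apply: nearW => n; rewrite -sqr_vnorm ler_pXn2r ?nnegrE ?vnorm_ge0 //.
  exact: le_trans B1.
have nb1 := nB b1 (fun n => (vB n).1); have nb2 := nB b2 (fun n => (vB n).2).
have BB1 : 1 <= B ^+ 2 by rewrite exprn_ege1.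
(* A single bound for the squared singular values, below every spectral point in use and above [lp],
   so that it holds for large [n]. *)
pose th := (lp + (rho - ka)) / 2.
have th1 : lp < th by rewrite /th; lra.
have th2 : th < rho - ka by rewrite /th; lra.
have th0 : 0 <= th by lra.
have eta0 n : 0 < ka / n.+1%:R by rewrite divr_gt0.
have etak n : ka / n.+1%:R <= ka by rewrite ler_pdivrMr // ler_peMr ?(ltW ka0) // ler1n.
(* Used below only at [rho + ka / n.+1] and [rho - ka / n.+1], so that countably many null sets are
   discarded before an outcome is fixed. *)
have iso x0 := ae_isotropic HN Hc HNc Hf HL HW HGm HGdiag HGnn Hind Hsupp HA3 HA4 BB1 UU VV nb1 nb2 (x0 := x0).
have iso1 : {ae P, forall x, forall n, isotropic pi c
    (fun n => Xmat (L n x) (Gam n x) (colsub (f n) (W n x)))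
    (fun x0 n => Qres (L n x) (gam (Gam n) x) x0) U V b1 b2 (rho + ka / n.+1%:R)}.
  by apply: ae_foralln => n; apply: iso; rewrite (lt_trans Hrho) // ltrDl.
have iso2 : {ae P, forall x, forall n, isotropic pi c
    (fun n => Xmat (L n x) (Gam n x) (colsub (f n) (W n x)))
    (fun x0 n => Qres (L n x) (gam (Gam n) x) x0) U V b1 b2 (rho - ka / n.+1%:R)}.
  by apply: ae_foralln => n; apply: iso; rewrite (lt_le_trans lka) // lerD2l lerN2.
have gle := ae_gam_le Hf HL HW HGdiag HGnn HA4 th1.
apply: filterS2 (filterI iso1 iso2) (filterI gle (ae_isom Hf HL HW)) => x [i1 i2] [gx Lx].
apply: csmall_ccvg0.
have XE' n := XE L W f HGdiag HGnn n x.
have gx' : \forall n \near \oo, forall k, gam (Gam n) x k ^+ 2 <= th by exact: gx.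
have HQ y : th < y -> \forall n \near \oo,
    (Xmat (L n x) (Gam n x) (colsub (f n) (W n x)) *m
     mxH (Xmat (L n x) (Gam n x) (colsub (f n) (W n x))) - (cR y)%:M) *m
    Qres (L n x) (gam (Gam n) x) y = 1%:M.
  move=> ty; apply: filterS gx' => n gn; have [L1 R1] := Lx n.
  by rewrite XE'; apply: Qres_inv => // k; rewrite lt_eqF // (le_lt_trans (gn k)).
have HX : \forall n \near \oo,
    (forall a, n2 (mxH (Xmat (L n x) (Gam n x) (colsub (f n) (W n x))) *m a) <= th * n2 a) /\
    (forall v, n2 (Xmat (L n x) (Gam n x) (colsub (f n) (W n x)) *m v) <= th * n2 v).
  apply: filterS gx' => n gn; have [L1 R1] := Lx n.
  have gk k : `|gam (Gam n) x k| <= Num.sqrt th.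
    by rewrite -sqrtr_sqr ler_sqrt.
  rewrite XE'; split=> v.
    rewrite !mxHM mxHK mxH_rdiag -!mulmxA n2_isom //.
    apply: le_trans (n2_rdiag_le _ gk) _; rewrite sqr_sqrtr //.
    by apply: ler_wpM2l => //; exact: n2_isomH_le.
  rewrite -!mulmxA n2_isom //.
  apply: le_trans (n2_rdiag_le _ gk) _; rewrite sqr_sqrtr //.
  by apply: ler_wpM2l => //; exact: n2_isomH_le.
have uhE : \forall n \near \oo,
    spiked (Xmat (L n x) (Gam n x) (colsub (f n) (W n x))) (U n) (V n) (Om n) *m
    mxH (spiked (Xmat (L n x) (Gam n x) (colsub (f n) (W n x))) (U n) (V n) (Om n)) *m uh n x =
    uh n x *m rdiag (lh n x).
  apply: filterS PE => n Pe; have [_ hE _] := Heig n x.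
  by rewrite /spiked -Pe hE.
have uhU n : mxH (uh n x) *m uh n x = 1%:M by case: (Heig n x).
have mono n (k k' : 'I_(N n)) : (k <= k')%N -> lh n x k' <= lh n x k.
  by case: (Heig n x) => _ _; exact.
have lim := deterministic_limit Hlmp Hsupp Hc lp0 Hrho mrho Hr Hompos Homdec Hrhoeq blE
  B1 th0 th2 ka0 lka HQ (fun y n => QresH _ _ _) HX UU VV (fun k => HOm _ _ (blE k)) uhU uhE mono
  (nearW _ vB) i1 i2 win_plus win_minus.
apply: csmall_near (lim _); apply: nearW => n.
by rewrite /dot !mulmxA.
Qed.
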